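(* Let $V$ be a $C_\infty$-algebra, and write $\Pi:=\prod_{k=1}^\infty(\Sigma V^* )^{\hat\otimes k}$. (i) The bar complex $C^\bullet_{\mathrm{Bar}}(V)=(\Sigma\Pi,b')$ splits as the direct product of the subcomplexes $\Sigma\left(e(i)[\Pi]\right)$: $$C^\bullet_{\mathrm{Bar}}(V)=\prod_{i=1}^\infty\left(\Sigma\left(e(i)[\Pi]\right),b'\right).$$ (ii) The Hochschild complex of the $C_\infty$-algebra $V$ with coefficients in $V^*$ (identified with $(\Sigma\Pi,b)$) splits as the direct product of the subcomplexes $\Sigma\left(\tilde e(i)[\Pi]\right)$: $$C^\bullet_{\mathrm{Hoch}}(V,V^* )=\prod_{i=0}^\infty\left(\Sigma\left(\tilde e(i)[\Pi]\right),b\right).$$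
   Context: Conventions. $\mathbb K$ is an evenly graded commutative ring containing $\mathbb Q$; all modules are graded $\mathbb K$-modules, cohomologically graded, and the Koszul sign rule is used. $(\Sigma V)^i=V^{i+1}$, $(\Sigma^{-1}V)^i=V^{i-1}$; $\Sigma V^*$ means $\mathrm{Hom}_{\mathbb K}(\Sigma V,\mathbb K)$. A profinite module is an inverse limit of free modules of finite rank with the inverse limit topology; $\hat\otimes$ is the completed tensor product. For a profinite module $W$, $\widehat TW=\prod_{i\ge 0}W^{\hat\otimes i}$, and $\widehat LW\subset\widehat TW$ is the Lie subalgebra (for the graded commutator) of all convergent (possibly infinite) linear combinations of Lie monomials. Vector field = continuous derivation; $\mathrm{Der}(X)$ is the graded Lie algebra of vector fields on $X$. $C_\infty$-algebra. Let $V$ be a free graded module. A $C_\infty$-structure on $V$ is a vector field $m:\widehat L\Sigma V^*\to\widehat L\Sigma V^*$ of degree one with $m^2=0$. It extends uniquely to a vector field, again denoted $m$, on $\widehat T\Sigma V^*$ (of degree one, with $m^2=0$). Associative forms. For $X=\widehat TW$, $\Omega^1_{\mathrm{Ass}}(X)=X\hat\otimes(X/\mathbb K)$ with elements written $x\,dy$, a bimodule via $a\cdot x\,dy=ax\,dy$, $x\,dy\cdot a=x\,d(ya)-xy\,da$; $\Omega^\bullet_{\mathrm{Ass}}(X)=\widehat T_X(\Sigma^{-1}\Omega^1_{\mathrm{Ass}}(X))$ with the unique differential $d$ extending $x\mapsto dx$; $DR^\bullet_{\mathrm{Ass}}(X)=\Omega^\bullet_{\mathrm{Ass}}(X)/[\Omega^\bullet_{\mathrm{Ass}}(X),\Omega^\bullet_{\mathrm{Ass}}(X)]$,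 where the denominator consists of convergent combinations of graded commutators. $DR^i$ is the $i$-fold suspension of the part of form-degree $i$. For a vector field $\xi$ on $X$, the Lie derivative $L_\xi$ is the derivation of $\Omega^\bullet_{\mathrm{Ass}}(X)$ with $L_\xi(x)=\xi(x)$, $L_\xi(dx)=(-1)^{|\xi|}d(\xi(x))$; it induces $L_\xi$ on $DR^\bullet_{\mathrm{Ass}}(X)$. There is an isomorphism $\Theta_{\mathrm{Ass}}:\prod_{k\ge1}W^{\hat\otimes k}=W\hat\otimes\widehat TW\to DR^1_{\mathrm{Ass}}(\widehat TW)$, $x\otimes y\mapsto dx\cdot y$. Complexes. With $W=\Sigma V^*$: $b'$ is the restriction of $m$ to $\Pi=\prod_{k\ge1}W^{\hat\otimes k}$; $C^\bullet_{\mathrm{Bar}}(V)=(\Sigma\Pi,b')$. $C^\bullet_{\mathrm{Hoch}}(V,V^* )=(\Sigma DR^1_{\mathrm{Ass}}(\widehat T\Sigma V^* ),L_m)$, and $b:=\Theta_{\mathrm{Ass}}^{-1}L_m\Theta_{\mathrm{Ass}}$, so $C^\bullet_{\mathrm{Hoch}}(V,V^* )$ is identified via $\Theta_{\mathrm{Ass}}$ with $(\Sigma\Pi,b)$. Idempotents. $\widehat TW$ is a Hopf algebra with multiplication $\mu$ and the cocommutative (shuffle) coproduct $\Delta$, the continuous algebra homomorphism with $\Delta(w)=w\otimes1+1\otimes w$ for $w\in W$. The modified shuffle operator is $s=\mu\Delta:\widehat TW\to\widehat TW$, with components $s_n:W^{\hat\otimes n}\to W^{\hat\otimes n}$. Put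 $\lambda_i=2^i$. Define $e(i):\widehat TW\to\widehat TW$, $i\ge0$, with components on $W^{\hat\otimes n}$ $$e_n(i)=\Big[\prod_{0\le r\le n,\,r\ne i}(\lambda_i-\lambda_r)\Big]^{-1}\prod_{0\le r\le n,\,r\neq i}(s_n-\lambda_r\mathrm{id})\ \ (0\le i\le n),\qquad e_n(i)=0\ \ (i>n).$$ Define $\tilde e(i):=1\hat\otimes e(i)$ on $W\hat\otimes\widehat TW=\prod_{k\ge1}W^{\hat\otimes k}$. *)

(* Defs.v *)
From HB Require Import structures.
From mathcomp Require Import all_boot all_order all_algebra.
From mathcomp Require Import all_classical.
From mathcomp Require Import ring zify.

Set Implicit Arguments.
Unset Strict Implicit.
Unset Printing Implicit Defensive.

Import GRing.Theory.

Local Open Scope classical_set_scope.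
Local Open Scope ring_scope.

(* Conventions.

   A commutative ring containing Q is a (nonzero) commutative rat-algebra K.
   Its grading is internal: gr i is the set of elements of degree i.

   A free graded module V is given by a homogeneous basis B with degrees
   deg : B -> int.  Then W = Sigma V^* has the dual topological basis (t_c),
   c : B, where t_c has degree 1 - deg c: the shift lowers the degree of c by
   one and Hom(-, K) negates it.

   W^{(x)n} is the product of copies of K indexed by the words of length n in
   B, and the completed tensor algebra of W consists of the noncommutative
   power series f : seq B -> K, with f u the coefficient of
   t_u = t_{u_1}...t_{u_n}.  In the category of graded modules such products
   are taken degree by degree: f is homogeneous of degree d when f u has degree
   d - |t_u| for every u.  A graded module of series is thus represented by the
   family, indexed by d : int, of the sets of its homogeneous elements of
   degree d, and all conditions on operators only concern homogeneous elements.
   Similarly a completed tensor product of two such modules consists of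
   functions of two words.

   Since K is evenly graded, the scalars contribute no Koszul sign, and the
   parity of a homogeneous f agrees with that of t_u whenever f u != 0. *)

Section Grading.
Variable K : comAlgType rat.

Record even_grading := EvenGrading {
  gr :> int -> set K;
  gr0 : forall i, gr i 0;
  grB : forall i x y, gr i x -> gr i y -> gr i (x - y);
  gr1 : gr 0 1;
  grM : forall i j x y, gr i x -> gr j y -> gr (i + j) (x * y);
  gr_decomposition : forall x, exists c : int -> K,
    [/\ finite_set [set i | c i != 0], forall i, gr i (c i)
      & x = \sum_(i \in [set: int]) c i];
  gr_independence : forall c : int -> K,
    finite_set [set i | c i != 0] -> (forall i, gr i (c i)) ->
    \sum_(i \in [set: int]) c i = 0 -> forall i, c i = 0;
  gr_even : forall i x, gr i x -> odd (absz i) -> x = 0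
}.

Definition ksign (p q : int) : K := (-1) ^+ absz (p * q).

Definition kscale (I : Type) (k : K) (f : I -> K) : I -> K := fun i => k * f i.

Definition gmod (I : Type) := int -> set (I -> K).

Definition susp (I : Type) (A : gmod I) : gmod I := fun d => A (d + 1).

(* The homogeneous elements of the product of copies of K indexed by I, the
   i-th basis element having degree dg i. *)
Definition homog (gr : even_grading) (I : Type) (dg : I -> int) : gmod I :=
  fun d => [set f | forall i, gr (d - dg i) (f i)].

(* The topology is the inverse limit topology: a basis of neighbourhoods of 0
   consists of the graded submodules of the f vanishing on a given finite set
   of indices.  This is continuity at 0, hence continuity, of an additive T. *)
Definition continuous_on (I J : eqType) (A : gmod I)
    (T : (I -> K) -> (J -> K)) :=
  forall j, exists F : seq I, forall d f,
    A d f -> {in F, forall i, f i = 0} -> T f j = 0.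

(* Convergence of an infinite sum in the inverse limit topology. *)
Definition summable (J : choiceType) (I : Type) (x : J -> I -> K) :=
  forall i, finite_set [set j | x j i != 0].

Definition infsum (J : choiceType) (I : Type) (x : J -> I -> K) : I -> K :=
  fun i => \sum_(j \in [set: J]) x j i.

Section Complexes.
Variables (gr : even_grading) (I : eqType).
Implicit Types (A P : gmod I) (D : (I -> K) -> (I -> K)).

Record is_submodule A : Prop := IsSubmodule {
  sub0 : forall d, A d 0;
  subD : forall d f g, A d f -> A d g -> A d (f + g);
  subZ : forall i d k f, gr i k -> A d f -> A (i + d) (kscale k f)
}.

Record is_complex A D : Prop := IsComplex {
  complex_mod : is_submodule A;
  complex_deg : forall d f, A d f -> A (d + 1) (D f);
  complexD : forall d f g, A d f -> A d g -> D (f + g) = D f + D g;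
  complexZ : forall i d k f, gr i k -> A d f -> D (kscale k f) = kscale k (D f);
  complex_sq : forall d f, A d f -> D (D f) = 0
}.

Record is_subcomplex A D P : Prop := IsSubcomplex {
  subcomplex_sub : forall d, P d `<=` A d;
  subcomplex_mod : is_submodule P;
  subcomplex_stable : forall d f, P d f -> P (d + 1) (D f)
}.

Definition gprod (P : nat -> gmod I) : int -> set (nat -> I -> K) :=
  fun d => [set x | forall i, P i d (x i)].

(* The complex (A, D) is the direct product of its subcomplexes P i: the
   summation map from their external product, with the differential acting
   componentwise, is everywhere defined and is an isomorphism of complexes and
   a homeomorphism. *)
Record splits_as_product A D (P : nat -> gmod I) : Prop := SplitsAsProduct {
  split_complex : is_complex A D;
  split_subcomplex : forall i, is_subcomplex A D (P i);
  split_summable : forall d x, gprod P d x -> summable x;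
  split_bij : forall d, set_bij (gprod P d) (A d) (@infsum nat I);
  split_diff : forall d x, gprod P d x ->
    D (infsum x) = infsum (fun i => D (x i));
  split_continuous : forall u, exists (n : nat) (F : seq I), forall d x,
    gprod P d x -> (forall i, (i < n)%N -> {in F, forall v, x i v = 0}) ->
    infsum x u = 0;
  split_open : forall i u, exists F : seq I, forall d x,
    gprod P d x -> {in F, forall v, infsum x v = 0} -> x i u = 0
}.

End Complexes.
End Grading.

Section TensorAlgebra.
Variables (K : comAlgType rat) (gr : even_grading K).
Variables (B : choiceType) (deg : B -> int).

Definition wdeg (u : seq B) : int := \sum_(c <- u) (1 - deg c).

Definition mono (u : seq B) : seq B -> K := fun v => (v == u)%:R.

Definition mulS (f g : seq B -> K) : seq B -> K :=
  fun u => \sum_(i < (size u).+1) f (take i u) * g (drop i u).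

Definition That : gmod K (seq B) := homog gr wdeg.

Definition Pi : gmod K (seq B) := fun d => [set f | That d f /\ f [::] = 0].

Definition Wmod : gmod K (seq B) :=
  fun d => [set f | That d f /\ forall u, size u != 1%N -> f u = 0].

Definition brk (p q : int) (f g : seq B -> K) : seq B -> K :=
  mulS f g - kscale (ksign K p q) (mulS g f).

Inductive lie_monomial : int -> (seq B -> K) -> Prop :=
| Lie_gen d w : Wmod d w -> lie_monomial d w
| Lie_brk p q f g : lie_monomial p f -> lie_monomial q g ->
    lie_monomial (p + q) (brk p q f g).

(* The coefficients of the linear combinations are absorbed by the monomials,
   whose entries are arbitrary elements of W. *)
Definition Lhat : gmod K (seq B) := fun d =>
  [set f | exists (J : choiceType) (x : J -> seq B -> K),
    [/\ forall j, lie_monomial d (x j), summable x & f = infsum x]].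

(* Continuous derivations of degree n of the graded algebra A with product
   pr p q : A p -> A q -> A (p + q). *)
Record vector_field (A : gmod K (seq B))
    (pr : int -> int -> (seq B -> K) -> (seq B -> K) -> (seq B -> K))
    (n : int) (xi : (seq B -> K) -> (seq B -> K)) : Prop := VectorField {
  vf_deg : forall d f, A d f -> A (d + n) (xi f);
  vfD : forall d f g, A d f -> A d g -> xi (f + g) = xi f + xi g;
  vfZ : forall i d k f, gr i k -> A d f -> xi (kscale k f) = kscale k (xi f);
  vf_leibniz : forall p q f g, A p f -> A q g ->
    xi (pr p q f g)
    = pr (p + n) q (xi f) g + kscale (ksign K n p) (pr p (q + n) f (xi g));
  vf_continuous : continuous_on A xi
}.

Definition lie_vector_field := vector_field Lhat brk.
Definition ass_vector_field := vector_field That (fun _ _ => mulS).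

Definition is_Cinfty (m : (seq B -> K) -> (seq B -> K)) :=
  lie_vector_field 1 m /\ forall d f, Lhat d f -> m (m f) = 0.

(* M is the extension of m to a vector field on the completed tensor algebra;
   its values on homogeneous series are determined by m. *)
Definition is_extension (m M : (seq B -> K) -> (seq B -> K)) :=
  ass_vector_field 1 M /\ forall d f, Lhat d f -> M f = m f.

Definition tens (f g : seq B -> K) : seq B * seq B -> K :=
  fun p => f p.1 * g p.2.

(* (a (x) b)(a' (x) b') = (-1)^(|b||a'|) aa' (x) bb'. *)
Definition mul2 (F G : seq B * seq B -> K) : seq B * seq B -> K := fun p =>
  \sum_(i < (size p.1).+1) \sum_(j < (size p.2).+1)
    ksign K (wdeg (take j p.2)) (wdeg (drop i p.1))
    * (F (take i p.1, take j p.2) * G (drop i p.1, drop j p.2)).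

Definition Delta_gen (c : B) : seq B * seq B -> K :=
  tens (mono [:: c]) (mono [::]) + tens (mono [::]) (mono [:: c]).

Definition Delta_word (u : seq B) : seq B * seq B -> K :=
  foldr (fun c F => mul2 (Delta_gen c) F) (tens (mono [::]) (mono [::])) u.

(* The coefficient at p of the convergent sum of the f u Delta(t_u): only
   finitely many u contribute, the rearrangements of p.1 ++ p.2. *)
Definition Delta (f : seq B -> K) : seq B * seq B -> K :=
  fun p => \sum_(u \in [set: seq B]) f u * Delta_word u p.

Definition mu (F : seq B * seq B -> K) : seq B -> K :=
  fun u => \sum_(i < (size u).+1) F (take i u, drop i u).

Definition shuf (f : seq B -> K) : seq B -> K := mu (Delta f).

Definition lam (r : nat) : rat := 2%:R ^+ r.

Definition part (n : nat) (f : seq B -> K) : seq B -> K :=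
  fun u => if size u == n then f u else 0.

Definition idem_comp (n i : nat) (f : seq B -> K) : seq B -> K :=
  if (i <= n)%N then
    (\prod_(0 <= r < n.+1 | r != i) (lam i - lam r))^-1 *:
      foldr (fun r g => shuf g - lam r *: g) f
            [seq r <- iota 0 n.+1 | r != i]
  else 0.

Definition idem (i : nat) (f : seq B -> K) : seq B -> K :=
  fun u => idem_comp (size u) i (part (size u) f) u.

(* 1 (x) e(i) on the completed tensor product of W and its tensor algebra, in
   which the coefficient of t_c (x) t_v is f (c :: v). *)
Definition idem_tilde (i : nat) (f : seq B -> K) : seq B -> K :=
  fun u => if u is c :: v then idem i (fun v' => f (c :: v')) v else 0.

(* Forms of degree one: omega (u, v) is the coefficient of t_u d(t_v), and the
   quotient by K of the second factor is represented by the vanishing of the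
   coefficients of t_u d(1).  They are graded without the desuspension that
   occurs in the algebra of all forms, that is, so that |x dy| = |x| + |y|; this
   is the grading of DR^1, which is the suspension of the part of form degree
   one. *)
Definition Omega1 : gmod K (seq B * seq B) := fun d =>
  [set w | homog gr (fun p => wdeg p.1 + wdeg p.2) d w
           /\ forall u, w (u, [::]) = 0].

Definition form1 (x y : seq B -> K) : seq B * seq B -> K :=
  fun p => if p.2 is [::] then 0 else x p.1 * y p.2.

(* The operations on one-forms below are the linear continuous extensions of
   the formulas for x dy; see the lemmas at the end of the file. *)
Definition lactO (a : seq B -> K) (w : seq B * seq B -> K) :
    seq B * seq B -> K :=
  fun p => mulS a (fun u => w (u, p.2)) p.1.

Definition ractO (w : seq B * seq B -> K) (a : seq B -> K) :
    seq B * seq B -> K :=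
  fun p => if p.2 is [::] then 0
           else mulS (fun v => w (p.1, v)) a p.2 - mu w p.1 * a p.2.

(* The restriction to one-forms of the Lie derivative, for xi of degree n:
   L_xi (x dy) = xi(x) dy + (-1)^(|xi||x|) x d(xi(y)).  The sign in
   L_xi (dy) = (-1)^|xi| d(xi(y)) is absorbed by the suspension. *)
Definition LieD (n : int) (xi : (seq B -> K) -> (seq B -> K))
    (w : seq B * seq B -> K) : seq B * seq B -> K :=
  fun p => if p.2 is [::] then 0
           else xi (fun u => w (u, p.2)) p.1
                + ksign K n (wdeg p.1) * xi (fun v => w (p.1, v)) p.2.

(* The part of form degree one of the space of convergent combinations of
   graded commutators: the component of form degree one of a commutator of
   forms is a sum of commutators of series with one-forms.  DR^1 is the
   quotient of Omega1 by DRcomm. *)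
Definition DRcomm : gmod K (seq B * seq B) := fun d =>
  [set w | exists (J : choiceType) (x : J -> seq B * seq B -> K),
    [/\ forall j, exists p q a eta,
          [/\ p + q = d, That p a, Omega1 q eta
            & x j = lactO a eta - kscale (ksign K p q) (ractO eta a)],
        summable x & w = infsum x]].

(* Theta (x (x) y) = dx . y, by dt_c . t_v = d(t_c t_v) - t_c d(t_v). *)
Definition Theta (f : seq B -> K) : seq B * seq B -> K := fun p =>
  if p.2 is [::] then 0 else
  match p.1 with
  | [::] => f p.2
  | [:: c] => - f (c :: p.2)
  | _ => 0
  end.

(* b = Theta^-1 L_M Theta. *)
Definition hoch_diff (M : (seq B -> K) -> (seq B -> K)) (f : seq B -> K) :
    seq B -> K :=
  xget 0 [set g | exists d, [/\ Pi d f, Pi (d + 1) g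
                              & DRcomm (d + 1) (Theta g - LieD 1 M (Theta f))]].

(* Theta identifies (Pi, b) with (DR^1, L_M). *)
Record hoch_identification (M : (seq B -> K) -> (seq B -> K)) : Prop :=
  HochIdentification {
  hoch_deg : forall d f, Pi d f -> Omega1 d (Theta f);
  hoch_inj : forall d f, Pi d f -> DRcomm d (Theta f) -> f = 0;
  hoch_surj : forall d w, Omega1 d w ->
    exists2 f, Pi d f & DRcomm d (w - Theta f);
  hoch_Lie : forall d w, DRcomm d w -> DRcomm (d + 1) (LieD 1 M w);
  hoch_chain : forall d f, Pi d f ->
    DRcomm (d + 1) (Theta (hoch_diff M f) - LieD 1 M (Theta f))
}.

Definition image_Pi (T : (seq B -> K) -> (seq B -> K)) : gmod K (seq B) :=
  fun d => T @` Pi d.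

End TensorAlgebra.

Section PureTensors.
Variables (K : comAlgType rat) (gr : even_grading K).
Variables (B : choiceType) (deg : B -> int).
Implicit Types f x y a w : seq B -> K.

Lemma subfE (I : Type) (f g : I -> K) i : (f - g) i = f i - g i.
Proof. by []. Qed.

Lemma lactO_form a x y : lactO a (form1 x y) = form1 (mulS a x) y.
Proof.
apply/funext => -[u [|c v]]; rewrite /lactO /form1 /mulS /=.
  by rewrite big1 // => i _; rewrite mulr0.
by rewrite mulr_suml; apply: eq_bigr => i _; rewrite mulrA.
Qed.

Lemma ractO_form1 x y a :
  ractO (form1 x y) a = form1 x (mulS y a) - form1 (mulS x y) a.
Proof.
apply/funext => -[u [|c v]]; rewrite subfE /ractO /form1 /= ?subrr //.
have -> : mulS (fun v0 => match v0 with [::] => 0 | _ :: _ => x u * y v0 end) a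
            (c :: v)
          = x u * mulS y a (c :: v) - x u * y [::] * a (c :: v).
  rewrite /mulS /= big_ord_recl [X in _ = _ * X - _]big_ord_recl /=.
  rewrite mul0r add0r mulrDr mulrA addrAC subrr add0r mulr_sumr.
  by apply: eq_bigr => i _; rewrite mulrA.
have -> : mu (fun p => match p.2 with [::] => 0 | _ :: _ => x p.1 * y p.2 end) u
          = mulS x y u - x u * y [::].
  rewrite /mulS /mu !big_ord_recr /= drop_size take_size addr0 addrK.
  apply: eq_bigr => i _.
  by case E: (drop i u) => //; move/(congr1 size): E; rewrite size_drop /=
     => /eqP; rewrite subn_eq0 leqNgt ltn_ord.
by rewrite mulrBl; ring.
Qed.

Lemma Theta_tensor d w y : Wmod gr deg d w ->
  Theta (mulS w y) = ractO (form1 (mono K [::]) w) y.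
Proof.
move=> [_ hw]; have w0 : w [::] = 0 by apply: hw.
have mulw c v : mulS w y (c :: v) = w [:: c] * y v.
  rewrite /mulS /= !big_ord_recl /= w0 mul0r add0r drop0 take0 big1 ?addr0//.
  move=> i _; rewrite hw ?mul0r//=.
  by move: (ltn_ord i); case: v i => [|c' v] i //= _; case: (val i).
have mono_mul u : mulS (mono K [::]) w u = w u.
  rewrite /mulS big_ord_recl /= take0 /mono eqxx mul1r drop0 big1 ?addr0// => i _.
  case: u i => [|c' v] i; first by case: i.
  by rewrite /= mul0r.
rewrite ractO_form1; apply/funext => -[u [|c v]]; rewrite subfE /Theta /form1 /= ?subrr//.
rewrite mono_mul /mono; case: u => [|c' [|c'' u]] /=.
- by rewrite mul1r w0 mul0r subr0.
- by rewrite mul0r add0r mulw.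
- by rewrite hw// !mul0r subr0.
Qed.


Lemma Delta_mono u : Delta deg (mono K u) = Delta_word K deg u.
Proof.
apply/funext => p; rewrite /Delta -(fsbig_widen [set u] setT) //=; last first.
  by move=> v [_ /= /eqP vu]; rewrite /mono (negbTE vu) mul0r.
by rewrite fsbig_set1 /mono eqxx mul1r.
Qed.

Lemma mul_mono_nil f : mulS (mono K [::]) f = f.
Proof.
apply/funext => u.
rewrite /mulS big_ord_recl /= take0 /mono eqxx mul1r drop0 big1 ?addr0// => i _.
case: u i => [|c v] i; first by case: i.
by rewrite /= mul0r.
Qed.

Lemma mulS_nil f : mulS f (mono K [::]) = f.
Proof.
apply/funext => u; rewrite /mulS big_ord_recr /= take_size drop_size.
rewrite /mono eqxx mulr1 big1 ?add0r// => i _.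
case E: (drop i u) => //=; last by rewrite mulr0.
by move/(congr1 size): E; rewrite size_drop => /eqP; rewrite subn_eq0 leqNgt ltn_ord.
Qed.

Lemma That_mono_nil : That gr deg 0 (mono K [::]).
Proof.
move=> u /=; rewrite /mono; case: eqP => [->|_]; last exact: gr0.
by rewrite /wdeg big_nil subrr; apply: gr1.
Qed.

Lemma vf_mono_nil n xi : ass_vector_field gr deg n xi -> xi (mono K [::]) = 0.
Proof.
move=> X; have := vf_leibniz X That_mono_nil That_mono_nil.
have -> : kscale (ksign K n 0) (mulS (mono K [::]) (xi (mono K [::])))
  = mulS (mono K [::]) (xi (mono K [::])).
  by apply/funext => u; rewrite /kscale /ksign mulr0 mul1r.
rewrite !mul_mono_nil mulS_nil => /eqP.
by rewrite -subr_eq0 opprD addrA subrr sub0r oppr_eq0 => /eqP.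
Qed.

Lemma ksign_odd (p q q' : int) : ~~ odd (absz (q - q')) -> ksign K p q = ksign K p q'.
Proof.
move=> h; rewrite /ksign -signr_odd -[RHS]signr_odd !abszM !oddM; congr (_ ^+ nat_of_bool (_ && _)).
by apply/idP/idP; lia.
Qed.

Lemma LieD_form1 n xi p q x y : ass_vector_field gr deg n xi ->
  That gr deg p x -> That gr deg q y ->
  LieD deg n xi (form1 x y)
  = form1 (xi x) y + kscale (ksign K n p) (form1 x (xi y)).
Proof.
move=> X hx hy; apply/funext => -[u [|c v]]; rewrite /LieD/= /kscale/=.
  by rewrite (_ : (_ + _) (u, [::]) = 0 + ksign K n p * 0)// mulr0 addr0.
rewrite (_ : (_ + _) (u, c :: v) = xi x u * y (c :: v) + ksign K n p * (x u * xi y (c :: v)))//.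
congr (_ + _).
  rewrite (_ : (fun u0 => _) = kscale (y (c :: v)) x); last first.
    by apply/funext => w; rewrite /kscale mulrC.
  by rewrite (vfZ X (hy _) hx) /kscale mulrC.
pose y' : seq B -> K := y - kscale (y [::]) (mono K [::]).
have hm : That gr deg q (kscale (y [::]) (mono K [::])).
  move=> w; rewrite /= /kscale /mono; case: eqP => [->|_]; rewrite ?mulr1 ?mulr0//.
  exact: gr0.
have hy' : That gr deg q y' by move=> w; apply: grB; [exact: hy|exact: hm].
have -> : (fun w : seq B => form1 x y (u, w)) = kscale (x u) y'.
  apply/funext => -[|d w]; rewrite /kscale /form1 /= /y' subfE /kscale /mono /=.
    by rewrite mulr1 subrr mulr0.
  by rewrite mulr0 subr0.
rewrite (vfZ X (hx _) hy').
have -> : xi y' = xi y.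
  have e : y = y' + kscale (y [::]) (mono K [::]) by rewrite subrK.
  rewrite [in RHS]e (vfD X hy' hm).
  have hy0 : gr q (y [::]) by have := hy [::]; rewrite /wdeg big_nil subr0.
  rewrite (vfZ X hy0 That_mono_nil) (vf_mono_nil X).
  by apply/funext => w; rewrite [RHS](_ : _ = xi y' w + y [::] * 0) // mulr0 addr0.
rewrite /kscale.
have [->|xu] := eqVneq (x u) 0; first by rewrite !(mul0r, mulr0).
congr (_ * _); apply: ksign_odd; apply/negP => o.
move/eqP: xu; apply; apply: (gr_even (hx u)).
by move: o; lia.
Qed.
End PureTensors.

(* Main.v *)
Require Import Defs.
From HB Require Import structures.
From mathcomp Require Import all_boot all_order all_algebra.
From mathcomp Require Import all_classical.
From mathcomp Require Import ring zify.

Set Implicit Arguments.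
Unset Strict Implicit.
Unset Printing Implicit Defensive.

Import GRing.Theory.

Local Open Scope classical_set_scope.
Local Open Scope ring_scope.

(* Write s = mu Delta for the modified shuffle operator.  Lie series p are
   primitive: Delta (p x) = (p (x) 1 + 1 (x) p) Delta x.

   Spectrum of s.  Let F_k be the span of the products of at most k Lie
   monomials.  For p Lie, s(p x) = 2 p s(x) modulo terms in which p occurs in a
   bracket, so (s - 2^k) F_k is contained in F_(k-1).  A word of length n lies
   in F_n, hence is a sum of eigenvectors of s of eigenvalues 2^j, j <= n, and
   e(i) is the projection onto the 2^i-eigenspace.

   Part (i).  The differential M is a derivation with M(W) contained in the Lie
   series, so Delta M = (M (x) 1 + 1 (x) M) Delta and M commutes with s.  It
   therefore preserves the eigenspaces of s.  These split the product because
   the 2^i-eigenspace vanishes in word lengths smaller than i.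

   Part (ii).  Let R(p, y) be the preimage of dp.y under Theta, modulo
   commutators.  Then R(pq, y) = R(p, qy) +- R(q, yp), whence
   R([p, q], y) = R(p, [q, y]) +- R(q, [p, y]).  As s commutes with ad p for p
   Lie, induction gives (1 (x) s) R(p, y) = R(p, s y) for all Lie p.  Since
   b(t_c (x) y) = R(M t_c, y) +- t_c (x) M y, the operator 1 (x) s commutes with
   b, and the argument of (i) applies again.

   Continuous operators are compared on words, that is, on the topological
   basis. *)

(** * Continuous linear operators *)

(** Scalars are even, so Koszul signs see only parities. Operators are therefore treated as linear
    on all series, with parities and signs carried by booleans, and integer degrees return only
    where homogeneity is checked. That e(i) preserves degrees rests on one fact about K: rational
    scalars have degree 0.

    The obstacle in (ii) is that b is specified only by a choice modulo convergent sums of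
    commutators. It is removed by an explicit map [untheta] on one-forms, which sends x dy to a
    signed sum of rotations bringing each letter of y in turn to the front. It kills graded
    commutators, it is a left inverse of [Theta] on series without constant term, and F - Theta
    (untheta F) is a convergent sum of commutators for every homogeneous one-form F. Hence the
    commutators are the kernel of [untheta], and b = untheta L_M Theta is a formula that can be
    compared with 1 (x) s on words. *)

Section ContinuousLinear.
Variable K : comAlgType rat.

Lemma addfE (I : Type) (f g : I -> K) i : (f + g) i = f i + g i.
Proof. by []. Qed.

Lemma oppfE (I : Type) (f : I -> K) i : (- f) i = - f i.
Proof. by []. Qed.

Lemma zerofE (I : Type) (i : I) : (0 : I -> K) i = 0.
Proof. by []. Qed.

Lemma ratscaleE (I : Type) (q : rat) (f : I -> K) : q *: f = kscale q%:A f.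
Proof. by apply/funext => i; rewrite /kscale mulr_algl. Qed.

Lemma kscaleA (I : Type) a b (f : I -> K) : kscale a (kscale b f) = kscale (a * b) f.
Proof. by apply/funext => i; rewrite /kscale mulrA. Qed.

Lemma kscaleDr (I : Type) a (f g : I -> K) : kscale a (f + g) = kscale a f + kscale a g.
Proof. by apply/funext => i; rewrite /kscale addfE mulrDr. Qed.

Lemma kscaler0 (I : Type) a : kscale a (0 : I -> K) = 0.
Proof. by apply/funext => i; rewrite /kscale mulr0. Qed.

Lemma kscale0r (I : Type) (f : I -> K) : kscale 0 f = 0.
Proof. by apply/funext => i; rewrite /kscale mul0r. Qed.

Lemma kscale1r (I : Type) (f : I -> K) : kscale 1 f = f.
Proof. by apply/funext => i; rewrite /kscale mul1r. Qed.

Lemma kscaleN1r (I : Type) (f : I -> K) : kscale (- 1) f = - f.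
Proof. by apply/funext => i; rewrite /kscale mulN1r. Qed.

Definition delta (I : eqType) (i : I) : I -> K := fun j => (j == i)%:R.

Lemma fsum_seq (I : choiceType) (F : I -> K) (s : seq I) : uniq s ->
  (forall i, F i != 0 -> i \in s) ->
  \sum_(i \in [set: I]) F i = \sum_(i <- s) F i.
Proof.
move=> us hs; rewrite (@fsbig_seq _ _ _ _ s F us); apply/esym/fsbig_widen => //.
move=> i [_ nis]; apply/eqP; move/negP: nis; apply: contraNT; exact: hs.
Qed.

Lemma finite_suppP (I : choiceType) (F : I -> K) (s : seq I) :
  (forall i, F i != 0 -> i \in s) -> finite_set [set i | F i != 0].
Proof.
move=> hs; apply: (@sub_finite_set _ _ [set` s]); first by move=> i /hs.
exact: finite_seq.
Qed.

Lemma finite_suppE (I : choiceType) (F : I -> K) :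
  finite_set [set i | F i != 0] -> exists2 s : seq I, uniq s & forall i, F i != 0 -> i \in s.
Proof.
move=> /finite_seqP[s hs]; exists (undup s); first exact: undup_uniq.
move=> i Fi; rewrite mem_undup; have : [set i | F i != 0] i by [].
by rewrite hs.
Qed.

(** Unlike a vector field, such an operator is linear on all series, homogeneous or not. The third
    condition is continuity at 0 for the product topology, so the operator is determined by its
    values on the basis [delta]. *)
Record clin (I J : eqType) (T : (I -> K) -> (J -> K)) : Prop := Clin {
  clinD : forall f g, T (f + g) = T f + T g;
  clinZ : forall k f, T (kscale k f) = kscale k (T f);
  clin_fin : forall j, exists F : seq I, forall f,
    {in F, forall i, f i = 0} -> T f j = 0
}.

Section Closure.
Variables I J L : eqType.
Implicit Types T : (I -> K) -> (J -> K).

Lemma clin0 T : clin T -> T 0 = 0.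
Proof. by move=> cT; rewrite -(kscale0r 0) (clinZ cT) kscale0r. Qed.

Lemma clinN T f : clin T -> T (- f) = - T f.
Proof. by move=> cT; rewrite -kscaleN1r (clinZ cT) kscaleN1r. Qed.

Lemma clinB T f g : clin T -> T (f - g) = T f - T g.
Proof. by move=> cT; rewrite (clinD cT) clinN. Qed.

Lemma clin_rat T (q : rat) f : clin T -> T (q *: f) = q *: T f.
Proof. by move=> cT; rewrite !ratscaleE (clinZ cT). Qed.

Lemma clin_sum T (X : Type) (s : seq X) (P : pred X) (F : X -> I -> K) : clin T ->
  T (\sum_(x <- s | P x) F x) = \sum_(x <- s | P x) T (F x).
Proof.
move=> cT; elim/big_rec2: _ => [|x f g _ <-]; first exact: clin0.
by rewrite (clinD cT).
Qed.

Lemma clin_id : clin (fun f : I -> K => f).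
Proof. by split=> // i; exists [:: i] => f; apply; rewrite inE. Qed.

Lemma clin_zero : clin (fun _ : I -> K => (0 : J -> K)).
Proof.
split=> [f g|k f|j]; rewrite ?addr0 ?kscaler0//; by exists [::].
Qed.

Lemma clin_add T1 T2 : clin T1 -> clin T2 -> clin (fun f => T1 f + T2 f).
Proof.
move=> c1 c2; split=> [f g|k f|j].
- by rewrite (clinD c1) (clinD c2); ring.
- by rewrite (clinZ c1) (clinZ c2) kscaleDr.
have [F1 h1] := clin_fin c1 j; have [F2 h2] := clin_fin c2 j.
exists (F1 ++ F2) => f hf; rewrite addfE h1 ?h2 ?addr0// => i iF;
  by apply: hf; rewrite mem_cat iF ?orbT.
Qed.

Lemma clin_opp T : clin T -> clin (fun f => - T f).
Proof.
move=> c; split=> [f g|k f|j].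
- by rewrite (clinD c) opprD.
- by rewrite (clinZ c); apply/funext => i; rewrite /kscale oppfE mulrN.
by have [F h] := clin_fin c j; exists F => f hf; rewrite oppfE h ?oppr0.
Qed.

Lemma clin_sub T1 T2 : clin T1 -> clin T2 -> clin (fun f => T1 f - T2 f).
Proof. by move=> c1 c2; apply/clin_add/clin_opp. Qed.

Lemma clin_scale T k : clin T -> clin (fun f => kscale k (T f)).
Proof.
move=> c; split=> [f g|k' f|j].
- by rewrite (clinD c) kscaleDr.
- by rewrite (clinZ c) !kscaleA mulrC.
by have [F h] := clin_fin c j; exists F => f hf; rewrite /kscale h ?mulr0.
Qed.

Lemma clin_ratscale T (q : rat) : clin T -> clin (fun f => q *: T f).
Proof.
move=> c; rewrite (_ : (fun f => _) = fun f => kscale q%:A (T f)); first exact: clin_scale.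
by apply/funext => f; rewrite ratscaleE.
Qed.

Lemma clin_bigsum (X : Type) (s : seq X) (P : pred X) (T : X -> (I -> K) -> (J -> K)) :
  (forall x, clin (T x)) -> clin (fun f => \sum_(x <- s | P x) T x f).
Proof.
move=> c; elim: s => [|x s IHs].
  rewrite (_ : (fun f => _) = fun=> 0); first exact: clin_zero.
  by apply/funext => f; rewrite big_nil.
rewrite (_ : (fun f => _) = if P x then fun f => T x f + \sum_(x <- s | P x) T x f
   else fun f => \sum_(x <- s | P x) T x f).
  by case: (P x) => //; apply: clin_add.
by apply/funext => f; rewrite big_cons; case: (P x).
Qed.

Lemma clin_finseq T (s : seq J) : clin T -> exists F : seq I, forall f,
  {in F, forall i, f i = 0} -> {in s, forall j, T f j = 0}.
Proof.
move=> cT; elim: s => [|j s [F hF]]; first by exists [::].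
have [G hG] := clin_fin cT j; exists (G ++ F) => f hf j'; rewrite inE => /orP[/eqP->|js].
  by apply: hG => i iG; apply: hf; rewrite mem_cat iG.
by apply: hF => // i iF; apply: hf; rewrite mem_cat iF orbT.
Qed.

Lemma clin_comp T (U : (J -> K) -> (L -> K)) : clin U -> clin T -> clin (fun f => U (T f)).
Proof.
move=> cU cT; split=> [f g|k f|l].
- by rewrite (clinD cT) (clinD cU).
- by rewrite (clinZ cT) (clinZ cU).
have [G hG] := clin_fin cU l; have [F hF] := clin_finseq G cT.
by exists F => f hf; apply: hG; apply: hF.
Qed.

(** All three conditions concern one output coordinate at a time, so the operator U that T is
    compared with may change with the coordinate. *)
Lemma clin_coord (T : (I -> K) -> (J -> K)) :
  (forall j, exists2 U : (I -> K) -> (J -> K), clin U & forall f, T f j = U f j) ->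
  clin T.
Proof.
move=> h; split=> [f g|k f|j].
- by apply/funext => j; have [U c e] := h j; rewrite addfE !e (clinD c).
- by apply/funext => j; have [U c e] := h j; rewrite /kscale !e (clinZ c).
have [U c e] := h j; have [F hF] := clin_fin c j.
by exists F => f /hF; rewrite e.
Qed.

Lemma clin_pullback (a : J -> K) (phi : J -> I) : clin (fun f j => a j * f (phi j)).
Proof.
split=> [f g|k f|j].
- by apply/funext => j; rewrite addfE mulrDr.
- by apply/funext => j; rewrite /kscale mulrCA.
by exists [:: phi j] => f ->; rewrite ?mulr0 ?inE.
Qed.

End Closure.

(** Only finitely many coordinates of f influence T f at j, so f may be replaced by its truncation
    to them, a finite combination of basis vectors. *)
Lemma clin_approx (I J : eqType) (T : (I -> K) -> J -> K) (f : I -> K) j : clin T ->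
  exists s : seq I, T f j = \sum_(i <- s) f i * T (delta i) j.
Proof.
move=> cT; have [F0 hF0] := clin_fin cT j; exists (undup F0).
pose g := \sum_(i <- undup F0) kscale (f i) (delta i).
have : T (f - g) j = 0.
  apply: hF0 => i iF; rewrite subfE /g fct_sumE (bigD1_seq i) ?mem_undup ?undup_uniq//=.
  rewrite /kscale /delta eqxx mulr1 big1 ?addr0 ?subrr// => k ki.
  by rewrite eq_sym (negbTE ki) mulr0.
rewrite clinB// subfE => /eqP; rewrite subr_eq0 => /eqP->.
rewrite /g clin_sum// fct_sumE; apply: eq_bigr => i _.
by rewrite (clinZ cT).
Qed.

(** Testing only on the support of f turns a hypothesis on f, such as its parity, into one on a
    single word. *)
Lemma clin_ext0 (I J : eqType) (T : (I -> K) -> J -> K) (f : I -> K) : clin T ->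
  (forall i, f i != 0 -> T (delta i) = 0) -> T f = 0.
Proof.
move=> cT h; apply/funext => j; have [s ->] := clin_approx f j cT.
rewrite big1// => i _; have [->|fi] := eqVneq (f i) 0; first by rewrite mul0r.
by rewrite h// mulr0.
Qed.

Lemma clin_ext (I J : eqType) (T U : (I -> K) -> J -> K) (f : I -> K) : clin T -> clin U ->
  (forall i, f i != 0 -> T (delta i) = U (delta i)) -> T f = U f.
Proof.
move=> cT cU h; apply/eqP; rewrite -subr_eq0; apply/eqP.
apply: (@clin_ext0 _ _ (fun f => T f - U f)); first exact: clin_sub.
by move=> i /h ->; rewrite subrr.
Qed.

Lemma infsumE (X : choiceType) (I : Type) (x : X -> I -> K) i (s : seq X) : uniq s -> (forall j, x j i != 0 -> j \in s) ->
  infsum x i = \sum_(j <- s) x j i.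
Proof. exact: fsum_seq. Qed.

(** * Convergent sums *)

Section Sums.
Variables (X : choiceType) (I : eqType).
Implicit Types x : X -> I -> K.

Lemma summable_seq x (F : seq I) : summable x ->
  exists2 s : seq X, uniq s & {in F, forall i j, x j i != 0 -> j \in s}.
Proof.
move=> sx; elim: F => [|i F [s us hs]]; first by exists [::].
have [t ut ht] := finite_suppE (sx i).
exists (undup (t ++ s)); first exact: undup_uniq.
move=> k; rewrite inE => /orP[/eqP->|kF] j xj; rewrite mem_undup mem_cat.
  by rewrite ht.
by rewrite (hs k kF j xj) orbT.
Qed.

(** T at j depends on finitely many input coordinates, and by summability only finitely many terms
    are nonzero at one of these. *)
Lemma clin_approx_infsum (J : eqType) (T : (I -> K) -> J -> K) x j : clin T -> summable x ->
  exists s : seq X, [/\ uniq s, T (infsum x) j = \sum_(k <- s) T (x k) j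
     & forall k, T (x k) j != 0 -> k \in s].
Proof.
move=> cT sx; have [F hF] := clin_fin cT j.
have [s us hs] := summable_seq F sx; exists s; split => //.
  have : T (infsum x - \sum_(k <- s) x k) j = 0.
    by apply: hF => i iF; rewrite subfE fct_sumE (@infsumE _ _ _ _ s)// ?subrr//; exact: hs.
  by rewrite clinB// subfE => /eqP; rewrite subr_eq0 => /eqP->; rewrite clin_sum// fct_sumE.
move=> k; apply: contraNT => ks; apply/eqP; apply: hF => i iF.
by apply/eqP; apply: contraNT ks; apply: hs.
Qed.

Lemma clin_infsum (J : eqType) (T : (I -> K) -> J -> K) x : clin T -> summable x ->
  T (infsum x) = infsum (fun k => T (x k)).
Proof.
move=> cT sx; apply/funext => j; have [s [us -> hs]] := clin_approx_infsum j cT sx.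
by rewrite (@infsumE _ _ _ _ s).
Qed.

Lemma clin_infsum_ext (J : eqType) (T U : (I -> K) -> J -> K) x : clin T -> clin U ->
  summable x -> (forall k, T (x k) = U (x k)) -> T (infsum x) = U (infsum x).
Proof.
move=> cT cU sx h; rewrite !clin_infsum//; congr infsum; exact/funext.
Qed.

Lemma infsum0 : infsum (fun _ : X => 0 : I -> K) = 0.
Proof. by apply/funext => i; rewrite (@infsumE _ _ _ _ [::]) ?big_nil// => j; rewrite eqxx. Qed.

Lemma infsumD x y : summable x -> summable y ->
  infsum (fun k => x k + y k) = infsum x + infsum y.
Proof.
move=> sx sy; apply/funext => i; rewrite addfE.
have [s us hs] := finite_suppE (sx i); have [t ut ht] := finite_suppE (sy i).
have uu := undup_uniq (s ++ t).
rewrite !(@infsumE _ _ _ _ (undup (s ++ t)))//.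
- by rewrite -big_split.
- by move=> j /ht; rewrite mem_undup mem_cat orbC => ->.
- by move=> j /hs; rewrite mem_undup mem_cat => ->.
move=> j; rewrite addfE mem_undup mem_cat; apply: contraNT; rewrite negb_or => /andP[js jt].
have /eqP-> : x j i == 0 by apply: contraNT js; exact: hs.
by rewrite add0r; apply: contraNT jt; exact: ht.
Qed.

End Sums.

(** * Extension of values on the topological basis *)

Section Extension.
Variables (I : choiceType) (J : eqType) (phi : I -> J -> K).

Definition ext (f : I -> K) : J -> K := fun j => \sum_(i \in [set: I]) f i * phi i j.

(** Values on the basis extend to a continuous operator under this condition: each output coordinate
    receives finitely many contributions. *)
Definition colfin := forall j, exists s : seq I, forall i, phi i j != 0 -> i \in s.

Hypothesis phi_fin : colfin.

Lemma extE j : exists s : seq I, [/\ uniq s, forall i, phi i j != 0 -> i \in s &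
  forall f, ext f j = \sum_(i <- s) f i * phi i j].
Proof.
have [s hs] := phi_fin j; exists (undup s); split; first exact: undup_uniq.
  by move=> i /hs; rewrite mem_undup.
move=> f; apply: fsum_seq; first exact: undup_uniq.
by move=> i; rewrite mem_undup => fp; apply: hs; apply: contraNneq fp => ->; rewrite mulr0.
Qed.

Lemma clin_extension : clin ext.
Proof.
split=> [f g|k f|j].
- apply/funext => j; have [s [_ _ e]] := extE j; rewrite addfE !e -big_split/=.
  by apply: eq_bigr => i _; rewrite addfE mulrDl.
- apply/funext => j; have [s [_ _ e]] := extE j; rewrite /kscale !e mulr_sumr/=.
  by apply: eq_bigr => i _; rewrite mulrA.
have [s [_ _ e]] := extE j; exists s => f hf; rewrite e big_seq big1// => i /hf ->.
by rewrite mul0r.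
Qed.

Lemma ext_delta i : ext (delta i) = phi i.
Proof.
apply/funext => j; rewrite /ext (@fsum_seq _ _ [:: i])// ?big_seq1.
  by rewrite /delta eqxx mul1r.
by move=> k; rewrite inE /delta; case: (k == i) => //=; rewrite mul0r eqxx.
Qed.

End Extension.

End ContinuousLinear.

(** * Series in one and two words *)

(** Signs are booleans rather than powers of -1, so that after a case analysis on parities an
    identity with Koszul signs is decided by [ring]. *)
Definition sgf (V : zmodType) (b : bool) (x : V) : V := if b then - x else x.

Section WordSeries.
Variables (K : comAlgType rat) (B : choiceType) (deg : B -> int).
Local Notation series := (seq B -> K).
Local Notation mono := (@mono K B).
Implicit Types (f g h p q x y : series) (u v w : seq B).

Lemma clin_matrix (I J : eqType) (X : Type) (s : J -> seq X) (a : J -> X -> K)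
    (phi : J -> X -> I) :
  clin (fun (F : I -> K) j => \sum_(i <- s j) a j i * F (phi j i)).
Proof.
apply: clin_coord => j.
exists (fun F _ => \sum_(i <- s j) a j i * F (phi j i)) => //.
have h : clin (fun F : I -> K => \sum_(i <- s j) (fun k : J => a j i * F (phi j i))).
  apply: clin_bigsum => i.
  exact: (clin_pullback (fun=> a j i) (fun=> phi j i)).
rewrite (_ : (fun F => _) = fun F : I -> K => \sum_(i <- s j) (fun k : J => a j i * F (phi j i)))//.
by apply/funext => F; apply/funext => k; rewrite fct_sumE.
Qed.

Lemma clin_mulSl g : clin (fun f => mulS f g).
Proof.
rewrite (_ : (fun f => _) = fun f u => \sum_(i <- index_iota 0 (size u).+1)
   g (drop i u) * f (take i u)); first exact: clin_matrix.
apply/funext => f; apply/funext => u; rewrite big_mkord; apply: eq_bigr => i _.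
by rewrite mulrC.
Qed.

Lemma clin_mulS f : clin (mulS f).
Proof.
rewrite (_ : mulS f = fun g u => \sum_(i <- index_iota 0 (size u).+1)
   f (take i u) * g (drop i u)); first exact: clin_matrix.
by apply/funext => g; apply/funext => u; rewrite big_mkord.
Qed.

Lemma mulSDl f g h : mulS (f + g) h = mulS f h + mulS g h.
Proof. exact: (clinD (clin_mulSl h)). Qed.

Lemma mulSNl f h : mulS (- f) h = - mulS f h.
Proof. exact: (clinN _ (clin_mulSl h)). Qed.

Lemma mulSDr f g h : mulS h (f + g) = mulS h f + mulS h g.
Proof. exact: (clinD (clin_mulS h)). Qed.

Lemma mulSNr f h : mulS h (- f) = - mulS h f.
Proof. exact: (clinN _ (clin_mulS h)). Qed.

Lemma mulS_at_nil f g : mulS f g [::] = f [::] * g [::].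
Proof. by rewrite /mulS big_ord_recl big_ord0 addr0. Qed.

Lemma mulS_at_cons f g c u :
  mulS f g (c :: u) = f [::] * g (c :: u) + mulS (fun w => f (c :: w)) g u.
Proof. by rewrite /mulS big_ord_recl take0 drop0. Qed.

(** Induction on the word at which the coefficient is taken. Removing its first letter c replaces f
    by its left quotient by c, so f has to vary. *)
Lemma mulSA f g h : mulS (mulS f g) h = mulS f (mulS g h).
Proof.
apply/funext => u; elim: u f => [|c u IHu] f; first by rewrite !mulS_at_nil mulrA.
rewrite !mulS_at_cons mulS_at_nil.
rewrite (_ : (fun w => mulS f g (c :: w))
  = kscale (f [::]) (fun w => g (c :: w)) + mulS (fun w => f (c :: w)) g); last first.
  by apply/funext => w; rewrite mulS_at_cons.
rewrite mulSDl addfE IHu (clinZ (clin_mulSl h)) /kscale; ring.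
Qed.

Lemma mulS_letter_nil c g : mulS (mono [:: c]) g [::] = 0.
Proof. by rewrite mulS_at_nil mul0r. Qed.

Lemma mulS_letter c g d u : mulS (mono [:: c]) g (d :: u) = (d == c)%:R * g u.
Proof.
rewrite mulS_at_cons {1}/Defs.mono mul0r add0r.
rewrite (_ : (fun w => mono [:: c] (d :: w)) = kscale (d == c)%:R (mono [::])); last first.
  by apply/funext => w; rewrite /kscale /Defs.mono eqseq_cons -natrM mulnb.
by rewrite (clinZ (clin_mulSl g)) mul_mono_nil.
Qed.

Lemma mono_cons c u : mono (c :: u) = mulS (mono [:: c]) (mono u).
Proof.
apply/funext => -[|d w]; first by rewrite mulS_letter_nil.
by rewrite mulS_letter /Defs.mono eqseq_cons -natrM mulnb.
Qed.

Lemma mono_cat u v : mono (u ++ v) = mulS (mono u) (mono v).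
Proof.
elim: u => [|c u IHu] /=; first by rewrite mul_mono_nil.
by rewrite mono_cons IHu (mono_cons c u) mulSA.
Qed.

Lemma wdeg_nil : wdeg deg [::] = 0.
Proof. by rewrite /wdeg big_nil. Qed.

Lemma wdeg_cons c u : wdeg deg (c :: u) = (1 - deg c) + wdeg deg u.
Proof. by rewrite /wdeg big_cons. Qed.

Lemma wdeg_cat u v : wdeg deg (u ++ v) = wdeg deg u + wdeg deg v.
Proof. by rewrite /wdeg big_cat. Qed.

Lemma wdeg_perm u v : perm_eq u v -> wdeg deg u = wdeg deg v.
Proof. exact: perm_big. Qed.

Definition par u : bool := odd (absz (wdeg deg u)).

Lemma parE u : par u = odd (absz (wdeg deg u)).
Proof. by []. Qed.

Lemma odd_abszD (m n : int) : odd (absz (m + n)) = odd (absz m) (+) odd (absz n).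
Proof. by lia. Qed.

Lemma par_cat u v : par (u ++ v) = par u (+) par v.
Proof. by rewrite /par wdeg_cat odd_abszD. Qed.

Lemma par_cons c u : par (c :: u) = par [:: c] (+) par u.
Proof. by rewrite -par_cat. Qed.

Lemma par_nil : par [::] = false.
Proof. by rewrite /par wdeg_nil. Qed.

Lemma ksignE (m n : int) : ksign K m n = (-1) ^+ (odd (absz m) && odd (absz n)).
Proof. by rewrite /ksign -signr_odd abszM oddM. Qed.

Lemma kscale_sign (I : Type) (f : I -> K) (b : bool) : kscale ((-1) ^+ b) f = sgf b f.
Proof. by case: b; rewrite ?kscaleN1r ?kscale1r. Qed.

(** Parity replaces degree: this is all that the Koszul rule sees of a homogeneous series. The zero
    series has both parities. *)
Definition hpar (b : bool) f := forall u, f u != 0 -> par u = b.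

Lemma hpar0 b : hpar b 0.
Proof. by move=> u; rewrite eqxx. Qed.

Lemma hparD b f g : hpar b f -> hpar b g -> hpar b (f + g).
Proof.
move=> hf hg u; have [fu|/hf//] := eqVneq (f u) 0.
by rewrite addfE fu add0r => /hg.
Qed.

Lemma hparN b f : hpar b f -> hpar b (- f).
Proof. by move=> hf u; rewrite oppfE oppr_eq0 => /hf. Qed.

Lemma hparS b k f : hpar b f -> hpar b (kscale k f).
Proof.
by move=> hf u; rewrite /kscale => fu; apply: hf; apply: contraNneq fu => ->; rewrite mulr0.
Qed.

Lemma hpar_sgf b a f : hpar b f -> hpar b (sgf a f).
Proof. by case: a => //=; exact: hparN. Qed.

Lemma hpar_mono u : hpar (par u) (mono u).
Proof. by move=> v; rewrite /Defs.mono; case: (v =P u) => [->//|_] /=; rewrite eqxx. Qed.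

Lemma hpar_mul a b f g : hpar a f -> hpar b g -> hpar (a (+) b) (mulS f g).
Proof.
move=> hf hg u; rewrite /mulS => n0.
have [i fg] : exists i : 'I_(size u).+1, f (take i u) * g (drop i u) != 0.
  apply/existsP; apply: contraNT n0; rewrite negb_exists => /forallP h.
  by rewrite big1// => i _; apply/eqP; move: (h i); rewrite negbK.
have fi : f (take i u) != 0 by apply: contraNneq fg => ->; rewrite mul0r.
have gi : g (drop i u) != 0 by apply: contraNneq fg => ->; rewrite mulr0.
by rewrite -(cat_take_drop i u) par_cat (hf _ fi) (hg _ gi).
Qed.

Definition opar (b : bool) (T : series -> series) :=
  forall a f, hpar a f -> hpar (b (+) a) (T f).

Lemma opar_mulS b p : hpar b p -> opar b (mulS p).
Proof. by move=> hp a f; apply: hpar_mul. Qed.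

End WordSeries.

(** * Series in two words and operators T (x) 1 + 1 (x) T *)

Section TwoVariables.
Variables (K : comAlgType rat) (B : choiceType) (deg : B -> int).
Local Notation series := (seq B -> K).
Local Notation series2 := (seq B * seq B -> K).
Local Notation mono := (@mono K B).
Local Notation par := (par deg).
Local Notation hpar := (@hpar K B deg).
Local Notation opar := (@opar K B deg).
Implicit Types (f g h p q x y : series) (u v w : seq B) (F G : series2) (T U : series -> series).

Lemma delta_tens u v : delta K (u, v) = tens (mono u) (mono v).
Proof.
apply/funext => -[a b]; rewrite /delta /tens /Defs.mono/=.
by rewrite xpair_eqE -natrM mulnb.
Qed.

Lemma clin_tensl g : clin (fun f => tens f g).
Proof.
rewrite (_ : (fun f => _) = fun f z => g z.2 * f z.1); first exact: clin_pullback.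
by apply/funext => f; apply/funext => z; rewrite mulrC.
Qed.

Lemma clin_tensr f : clin (tens f).
Proof. exact: (clin_pullback (fun z => f z.1) (fun z => z.2)). Qed.

Lemma tensNl f g : tens (- f) g = - tens f g.
Proof. exact: (clinN _ (clin_tensl g)). Qed.

Lemma tensNr f g : tens f (- g) = - tens f g.
Proof. exact: (clinN _ (clin_tensr f)). Qed.

Lemma tensDl f g h : tens (f + h) g = tens f g + tens h g.
Proof. exact: (clinD (clin_tensl g)). Qed.

Lemma tensDr f g h : tens f (g + h) = tens f g + tens f h.
Proof. exact: (clinD (clin_tensr f)). Qed.

(** T (x) 1 and 1 (x) T, both without sign; the sign for passing the first tensor factor is added
    separately by [sg2]. *)
Definition op1 T F : series2 := fun z => T (fun u => F (u, z.2)) z.1.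
Definition op2 T F : series2 := fun z => T (fun v => F (z.1, v)) z.2.

Lemma clin_op1 T : clin T -> clin (op1 T).
Proof.
move=> cT; apply: clin_coord => -[u v].
exists (fun F z => T (fun w => 1 * F (w, v)) u) => [|F]; last first.
  by rewrite /op1/=; congr T; apply/funext => w; rewrite mul1r.
apply: (clin_comp (T := fun F w => 1 * F (w, v)) (U := fun f (z : seq B * seq B) => T f u)).
  apply: clin_coord => z; exists (fun f (q : seq B * seq B) => T f u) => //.
  split=> [f g|k f|q]; rewrite ?(clinD cT) ?(clinZ cT)//.
  exact: (clin_fin cT u).
exact: (clin_pullback (fun=> 1) (fun w => (w, v))).
Qed.

Lemma clin_op2 T : clin T -> clin (op2 T).
Proof.
move=> cT; apply: clin_coord => -[u v].
exists (fun F z => T (fun w => 1 * F (u, w)) v) => [|F]; last first.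
  by rewrite /op2/=; congr T; apply/funext => w; rewrite mul1r.
apply: (clin_comp (T := fun F w => 1 * F (u, w)) (U := fun f (z : seq B * seq B) => T f v)).
  split=> [f g|k f|q]; rewrite ?(clinD cT) ?(clinZ cT)//.
  exact: (clin_fin cT v).
exact: (clin_pullback (fun=> 1) (fun w => (u, w))).
Qed.

Lemma op1_tens T f g : clin T -> op1 T (tens f g) = tens (T f) g.
Proof.
move=> cT; apply/funext => -[u v]; rewrite /op1 /tens/=.
rewrite (_ : (fun w => f w * g v) = kscale (g v) f) ?(clinZ cT) /kscale 1?mulrC//.
by apply/funext => w; rewrite mulrC.
Qed.

Lemma op2_tens T f g : clin T -> op2 T (tens f g) = tens f (T g).
Proof.
move=> cT; apply/funext => -[u v]; rewrite /op2 /tens/=.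
by rewrite (_ : (fun w => f u * g w) = kscale (f u) g) ?(clinZ cT).
Qed.

Definition sg2 (b : bool) F : series2 := fun z => (-1) ^+ (b && par z.1) * F z.

Lemma clin_sg2 b : clin (sg2 b).
Proof. exact: (clin_pullback (fun z => (-1) ^+ (b && par z.1)) id). Qed.

Lemma sg2_tens b a f g : hpar a f -> sg2 b (tens f g) = sgf (b && a) (tens f g).
Proof.
move=> hf; rewrite -kscale_sign; apply/funext => -[u v]; rewrite /sg2 /kscale /tens/=.
have [->|/hf->//] := eqVneq (f u) 0; by rewrite mul0r !mulr0.
Qed.

(* T (x) 1 + 1 (x) T for an operator T of parity b. *)
Definition prim (b : bool) T F : series2 := op1 T F + sg2 b (op2 T F).

Lemma primE b T F z : prim b T F z = op1 T F z + sg2 b (op2 T F) z.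
Proof. by []. Qed.

Lemma clin_prim b T : clin T -> clin (prim b T).
Proof.
move=> cT; apply: clin_add; first exact: clin_op1.
by apply: (clin_comp (clin_sg2 b)); apply: clin_op2.
Qed.

Lemma prim_tens b T a f g : clin T -> hpar a f ->
  prim b T (tens f g) = tens (T f) g + sgf (b && a) (tens f (T g)).
Proof. by move=> cT hf; rewrite /prim op1_tens// op2_tens// (sg2_tens _ _ hf). Qed.

Lemma clin_ext2 (J : eqType) (T U : series2 -> J -> K) F : clin T -> clin U ->
  (forall u v, F (u, v) != 0 -> T (tens (mono u) (mono v)) = U (tens (mono u) (mono v))) ->
  T F = U F.
Proof.
by move=> cT cU h; apply: clin_ext => // -[u v] Fuv; rewrite delta_tens h.
Qed.

Lemma clin_sgf (I J : eqType) (T : (I -> K) -> J -> K) b : clin T -> clin (fun F : I -> K => sgf b (T F)).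
Proof. by move=> cT; case: b => //; exact: clin_opp. Qed.

(** T (x) 1 + 1 (x) T is compatible with graded commutators because the mixed terms cancel. This
    gives both the closure of primitive series under brackets and the compatibility of derivations
    with the coproduct. *)
Lemma prim_comm a b T U W F : clin T -> clin U -> opar a T -> opar b U -> clin W ->
  (forall f, W f = T (U f) - sgf (a && b) (U (T f))) ->
  prim a T (prim b U F) = sgf (a && b) (prim b U (prim a T F)) + prim (a (+) b) W F.
Proof.
move=> cT cU hT hU cW WE.
have cpT := clin_prim a cT; have cpU := clin_prim b cU; have cpW := clin_prim (a (+) b) cW.
apply: (@clin_ext2 _ (fun F => prim a T (prim b U F))
  (fun F => sgf (a && b) (prim b U (prim a T F)) + prim (a (+) b) W F)).
- exact: (clin_comp cpT cpU).
- by apply: clin_add => //; apply: clin_sgf; exact: (clin_comp cpU cpT).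
move=> u v _; have hu := @hpar_mono K B deg u.
rewrite !(prim_tens _ _ cT hu) !(prim_tens _ _ cU hu) !(prim_tens _ _ cW hu).
rewrite (clinD cpT) (clinD cpU) (prim_tens _ _ cT (hU _ _ hu)) (prim_tens _ _ cU (hT _ _ hu)).
rewrite !WE.
have e1 c : prim a T (sgf c (tens (mono u) (U (mono v))))
  = sgf c (prim a T (tens (mono u) (U (mono v)))) by case: c => //=; exact: clinN.
have e2 c : prim b U (sgf c (tens (mono u) (T (mono v))))
  = sgf c (prim b U (tens (mono u) (T (mono v)))) by case: c => //=; exact: clinN.
rewrite e1 e2 !(prim_tens _ _ cT hu) !(prim_tens _ _ cU hu).
case: a b (par u) {hT hU cpT cpU cpW hu e1 e2 WE} => -[] [] /=;
  rewrite !(tensDl, tensDr, tensNl, tensNr, opprK); ring.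
Qed.

Lemma clin_mu : clin (@mu K B).
Proof.
rewrite (_ : @mu K B = fun F u => \sum_(i <- index_iota 0 (size u).+1)
  1 * F (take i u, drop i u)).
  exact: (@clin_matrix _ _ _ _ (fun u => index_iota 0 (size u).+1) (fun _ _ => 1)
     (fun u i => (take i u, drop i u))).
apply/funext => F; apply/funext => u; rewrite big_mkord; apply: eq_bigr => i _.
by rewrite mul1r.
Qed.

Lemma mu_tens f g : mu (tens f g) = mulS f g.
Proof. by []. Qed.

End TwoVariables.

(** * Homogeneity *)

Section Homogeneity.
Variables (K : comAlgType rat) (gr : even_grading K).

Lemma grN i x : gr i x -> gr i (- x).
Proof. by move=> h; rewrite -sub0r; apply: grB => //; exact: gr0. Qed.

Lemma grD i x y : gr i x -> gr i y -> gr i (x + y).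
Proof. by move=> hx hy; rewrite -(opprK y); apply: grB => //; exact: grN. Qed.

Lemma gr_sum (X : Type) (s : seq X) (P : pred X) (F : X -> K) i :
  (forall x, P x -> gr i (F x)) -> gr i (\sum_(x <- s | P x) F x).
Proof.
by move=> h; elim/big_rec: _ => [|x y Px hy]; [exact: gr0|apply: grD => //; exact: h].
Qed.

Lemma gr_sign i (b : bool) x : gr i x -> gr i ((-1) ^+ b * x).
Proof. by case: b => /= h; rewrite ?expr0 ?expr1 ?mulN1r ?mul1r//; exact: grN. Qed.

Lemma gr_natr i n x : gr i x -> gr i (x *+ n).
Proof.
by move=> h; elim: n => [|n IHn]; rewrite ?mulr0n ?mulrS; [exact: gr0|exact: grD].
Qed.

Lemma gr_eq i j x : i = j -> gr i x -> gr j x.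
Proof. by move=> ->. Qed.

(* The components of nonzero degree of q * 1 are killed by the denominator of
   q, hence vanish. *)
Lemma gr_rat (q : rat) : gr 0 q%:A.
Proof.
have [c [fc hc ce]] := gr_decomposition gr (q%:A : K).
pose e (i : int) : K := (denq q)%:~R *: c i - (if i == 0 then (numq q)%:~R else 0).
have gint (z : int) : gr 0 (z%:~R : K).
  by case: z => n; [|rewrite NegzE mulrNz; apply: grN]; apply: gr_natr; exact: gr1.
have gscal (z : int) i x : gr i x -> gr i ((z%:~R : rat) *: x).
  move=> h; rewrite scaler_int; case: z => n; first exact: gr_natr.
  by rewrite NegzE mulrNz; apply/grN/gr_natr.
have he i : gr i (e i).
  apply: grB; first exact: gscal.
  by case: eqP => [->|_]; [exact: gint|exact: gr0].
have [s us hs] := finite_suppE fc.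
pose t := undup (0 :: s).
have ht i : c i != 0 -> i \in t by move=> /hs ci; rewrite mem_undup inE ci orbT.
have het i : e i != 0 -> i \in t.
  rewrite /e mem_undup inE; case: (i =P 0) => //= _; rewrite subr0 => ci.
  by apply: hs; apply: contraNneq ci => ->; rewrite scaler0.
have ut : uniq t by exact: undup_uniq.
have se : \sum_(i \in [set: int]) e i = 0.
  rewrite (fsum_seq ut)// /e big_split/= -scaler_sumr -(fsum_seq ut ht) -ce.
  rewrite (bigD1_seq 0) ?mem_undup ?inE//= big1 => [|i /negPf->]; last by rewrite oppr0.
  rewrite addr0 scalerA mulrC.
  rewrite -[X in X * _]divq_num_den mulfVK ?intr_eq0 ?denq_neq0//.
  by rewrite scaler_int subrr.
have e0 := gr_independence (finite_suppP het) he se.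
have c0 i : i != 0 -> c i = 0.
  move=> i0; have := e0 i; rewrite /e (negPf i0) subr0 => /eqP.
  by rewrite scaler_eq0 intr_eq0 (negPf (denq_neq0 q))/= => /eqP.
have sc i : c i != 0 -> i \in [:: 0 : int].
  by move=> ci; rewrite inE; apply: contraNT ci => /c0 ->.
by rewrite ce (fsum_seq _ sc)// big_seq1; exact: hc.
Qed.

Lemma gr_ratscale (q : rat) i x : gr i x -> gr i (q *: x).
Proof. by move=> h; rewrite -mulr_algl -[i]add0r; apply: grM => //; exact: gr_rat. Qed.

Section Homog.
Variables (I : eqType) (dg : I -> int).

Lemma homog_submodule : is_submodule gr (homog gr dg).
Proof.
split=> [d i|d f g hf hg i|i d k f hk hf j]; first exact: gr0.
  by rewrite addfE; apply: grD; [exact: hf|exact: hg].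
by apply: (gr_eq _ (grM hk (hf j))); lia.
Qed.

Lemma homogN d f : homog gr dg d f -> homog gr dg d (- f).
Proof. by move=> h i; apply: grN; exact: h. Qed.

Lemma homogD d f g : homog gr dg d f -> homog gr dg d g -> homog gr dg d (f + g).
Proof. exact: (subD homog_submodule). Qed.

Lemma homog_eq d d' f : d = d' -> homog gr dg d f -> homog gr dg d' f.
Proof. by move=> ->. Qed.

Lemma homog_infsum (X : choiceType) (x : X -> I -> K) d : summable x ->
  (forall j, homog gr dg d (x j)) -> homog gr dg d (infsum x).
Proof.
move=> sx hx i; have [s us hs] := finite_suppE (sx i).
by rewrite (infsumE us)//; apply: gr_sum => j _; exact: hx.
Qed.
End Homog.

Lemma homog_clin (I J : eqType) (dg : I -> int) (dg' : J -> int) n (T : (I -> K) -> J -> K) d f :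
  clin T -> (forall i, homog gr dg' (dg i + n) (T (delta K i))) ->
  homog gr dg d f -> homog gr dg' (d + n) (T f).
Proof.
move=> cT hT hf j; have [s ->] := clin_approx f j cT.
by apply: gr_sum => i _; apply: (gr_eq _ (grM (hf i) (hT i j))); lia.
Qed.

Variables (B : choiceType) (deg : B -> int).
Local Notation That := (That gr deg).
Local Notation hpar := (@hpar K B deg).
Local Notation par := (par deg).

Lemma That_mono u : That (wdeg deg u) (mono K u).
Proof.
move=> v; rewrite /mono; case: (v =P u) => [->|_]; last exact: gr0.
by rewrite subrr; exact: gr1.
Qed.

Lemma That_mulS p q f g : That p f -> That q g -> That (p + q) (mulS f g).
Proof.
move=> hf hg u; apply: gr_sum => i _.
apply: (gr_eq _ (grM (hf (take i u)) (hg (drop i u)))).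
by have := wdeg_cat deg (take i u) (drop i u); rewrite cat_take_drop => ->; lia.
Qed.

Lemma That_sgf d b f : That d f -> That d (sgf b f).
Proof. by case: b => //; exact: homogN. Qed.

(** At a word of the other parity the coefficient would have odd degree, and such scalars vanish. *)
Lemma That_par d f : That d f -> hpar (odd (absz d)) f.
Proof.
move=> hf u fu; apply/eqP; apply: contraNT fu => n.
apply/eqP; apply: (gr_even (hf u)).
by move: n; rewrite !parE; lia.
Qed.

End Homogeneity.

(** * The coproduct and primitive series *)

Section Coproduct.
Variables (K : comAlgType rat) (B : choiceType) (deg : B -> int).
Local Notation series := (seq B -> K).
Local Notation series2 := (seq B * seq B -> K).
Local Notation mono := (@mono K B).
Local Notation par := (par deg).
Local Notation hpar := (@hpar K B deg).
Local Notation opar := (@opar K B deg).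
Local Notation prim := (@prim K B deg).
Local Notation Delta := (@Delta K B deg).
Local Notation Delta_word := (@Delta_word K B deg).
Implicit Types (f g h p q x y : series) (u v w : seq B) (F G : series2) (T U : series -> series).

Lemma sum_mono_take (a : nat -> K) u :
  \sum_(i < (size u).+1) a i * mono [::] (take i u) = a 0%N.
Proof.
rewrite big_ord_recl take0 /Defs.mono eqxx mulr1 big1 ?addr0// => i _.
by case: u i => [|c u] i; [case: i|rewrite /= mulr0].
Qed.

(** In the double sum over cuts only those removing c from the front of one of the two words
    survive. Removing it from the second word carries the sign of t_c passing the whole first
    word. *)
Lemma mul2_Delta_gen c F :
  mul2 deg (Delta_gen K c) F = prim (par [:: c]) (mulS (mono [:: c])) F.
Proof.
apply/funext => -[u v]; rewrite /mul2/=.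
transitivity (\sum_(i < (size u).+1) (mono [:: c] (take i u) * F (drop i u, v)
   + mono [::] (take i u) * (\sum_(j < (size v).+1) (-1) ^+ (par [:: c] && par u)
      * (mono [:: c] (take j v) * F (u, drop j v))))).
  apply: eq_bigr => i _.
  rewrite [X in X + _](_ : _ = \sum_(j < (size v).+1)
     (ksign K (wdeg deg (take j v)) (wdeg deg (drop i u)) *
       (mono [:: c] (take i u) * F (drop i u, drop j v))) * mono [::] (take j v)); last first.
    rewrite (sum_mono_take (fun j => ksign K (wdeg deg (take j v)) (wdeg deg (drop i u)) *
       (mono [:: c] (take i u) * F (drop i u, drop j v)))) take0 drop0 wdeg_nil.
    by rewrite /ksign mul0r mul1r.
  rewrite mulr_sumr -big_split; apply: eq_bigr => j _ /=.
  rewrite /Delta_gen addfE /tens/=.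
  rewrite mulrDl mulrDr; congr (_ + _); first by ring.
  rewrite /Defs.mono; case: (take i u =P [::]) => [iu|_]; last by rewrite !mul0r mulr0.
  have -> : drop i u = u by rewrite -[RHS](cat_take_drop i) iu.
  rewrite !mul1r; case: (take j v =P [:: c]) => [->|_]; last by rewrite !mul0r !mulr0.
  by rewrite ksignE.
rewrite big_split/=; congr (_ + _).
under eq_bigr do rewrite mulrC.
by rewrite (sum_mono_take (fun=> _)) -mulr_sumr.
Qed.

Lemma Delta_word_cons c u :
  Delta_word (c :: u) = prim (par [:: c]) (mulS (mono [:: c])) (Delta_word u).
Proof. exact: mul2_Delta_gen. Qed.

(** A word has finitely many rearrangements, so this bound is what makes the coproduct
    continuous. *)
Lemma Delta_word_supp u z : Delta_word u z != 0 -> perm_eq u (z.1 ++ z.2).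
Proof.
elim: u z => [|c u IHu] [a b].
  rewrite /= /tens; case: a => [|? ?]; last by rewrite mul0r eqxx.
  by case: b => [|? ?] //; rewrite mulr0 eqxx.
rewrite Delta_word_cons primE /op1 /sg2 /op2/=.
have [/eqP|h _] := eqVneq (mulS (mono [:: c]) (fun w => Delta_word u (w, b)) a) 0.
  move=> /eqP->; rewrite add0r; case: b => [|d b]; first by rewrite mulS_letter_nil mulr0 eqxx.
  rewrite mulS_letter; case: (d =P c) => [->|_]; last by rewrite mul0r mulr0 eqxx.
  rewrite mul1r => h.
  have /IHu/= : Delta_word u (a, b) != 0 by apply: contraNneq h => ->; rewrite mulr0.
  by rewrite perm_sym -[a ++ c :: b]/(a ++ [:: c] ++ b) (perm_sym (c :: u)) perm_catCA perm_cons.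
case: a h => [|d a]; first by rewrite mulS_letter_nil eqxx.
rewrite mulS_letter; case: (d =P c) => [->|_]; last by rewrite mul0r eqxx.
by rewrite mul1r => /IHu; rewrite perm_cons.
Qed.

Lemma Delta_colfin : colfin Delta_word.
Proof.
by move=> z; exists (permutations (z.1 ++ z.2)) => u /Delta_word_supp; rewrite mem_permutations.
Qed.

Lemma clin_Delta : clin Delta.
Proof. exact: (clin_extension Delta_colfin). Qed.

Lemma Delta_letter c x : Delta (mulS (mono [:: c]) x)
  = prim (par [:: c]) (mulS (mono [:: c])) (Delta x).
Proof.
have cm := @clin_mulS K B (mono [:: c]); have cD := clin_Delta.
apply: (@clin_ext _ _ _ (fun x => Delta (mulS (mono [:: c]) x))
  (fun x => prim (par [:: c]) (mulS (mono [:: c])) (Delta x))).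
- exact: (clin_comp cD cm).
- by apply: (clin_comp _ cD); exact: clin_prim.
by move=> u _; rewrite -mono_cons !Delta_mono Delta_word_cons.
Qed.

(** Continuity in the factor p, rather than in F, carries primitivity over to infinite sums of Lie
    monomials. *)
Lemma clin_prim_mulS b F : clin (fun p => prim b (mulS p) F).
Proof.
apply: clin_add.
  apply: clin_coord => -[u v].
  by exists (fun p z => mulS p (fun w => F (w, v)) u) => //;
    split=> [f g|k f|z]; rewrite ?(clinD (clin_mulSl _)) ?(clinZ (clin_mulSl _))//;
    exact: (clin_fin (clin_mulSl _) u).
apply: (clin_comp (T := fun p => op2 (mulS p) F) (clin_sg2 K deg b)).
apply: clin_coord => -[u v].
by exists (fun p z => mulS p (fun w => F (u, w)) v) => //;
  split=> [f g|k f|z]; rewrite ?(clinD (clin_mulSl _)) ?(clinZ (clin_mulSl _))//;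
  exact: (clin_fin (clin_mulSl _) v).
Qed.

(* Left multiplication by p on series corresponds under Delta to left
   multiplication by p (x) 1 + 1 (x) p, i.e., p is primitive. *)
Definition primitive (b : bool) p :=
  hpar b p /\ forall x, Delta (mulS p x) = prim b (mulS p) (Delta x).

Lemma primitive_letter c : primitive (par [:: c]) (mono [:: c]).
Proof. by split; [exact: hpar_mono|exact: Delta_letter]. Qed.

Definition sbrk (a b : bool) p q : series := mulS p q - sgf (a && b) (mulS q p).

(** Left multiplication by a bracket is the graded commutator of the two left multiplications, so
    [prim_comm] applies. *)
Lemma primitive_brk a b p q : primitive a p -> primitive b q ->
  primitive (a (+) b) (sbrk a b p q).
Proof.
move=> [hp Pp] [hq Pq]; split.
  apply: hparD; first exact: hpar_mul.
  by apply/hparN/hpar_sgf; rewrite addbC; exact: hpar_mul.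
move=> x; have cp := @clin_mulS K B p; have cq := @clin_mulS K B q.
have e y : mulS (sbrk a b p q) y = mulS p (mulS q y) - sgf (a && b) (mulS q (mulS p y)).
  by rewrite -!mulSA /sbrk mulSDl mulSNl; case: (a && b); rewrite //= mulSNl.
have := prim_comm (Delta x) cp cq (opar_mulS hp) (opar_mulS hq) (clin_mulS _) e.
rewrite -!(Pp, Pq) => h.
rewrite e; case: (a && b) h => /= h.
  by rewrite opprK (clinD clin_Delta) h addrAC addNr add0r.
by rewrite (clinB _ _ clin_Delta) h addrAC subrr add0r.
Qed.

Lemma primitive_infsum (X : choiceType) (x : X -> series) b : summable x ->
  (forall j, primitive b (x j)) -> primitive b (infsum x).
Proof.
move=> sx hx; split.
  move=> u; have [s us hs] := finite_suppE (sx u).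
  rewrite (infsumE us)// => n0.
  have [/hasP[j _ xj]|/hasPn n] := boolP (has (fun j => x j u != 0) s).
    by have [h _] := hx j; exact: h.
  by move: n0; rewrite big_seq big1 ?eqxx// => j /n; rewrite negbK => /eqP.
move=> y; apply: (@clin_infsum_ext _ _ _ _ (fun p => Delta (mulS p y))
   (fun p => prim b (mulS p) (Delta y))) => //.
- exact: (clin_comp clin_Delta (clin_mulSl y)).
- exact: clin_prim_mulS.
by move=> j; have [_] := hx j.
Qed.

(** Covers the elements of W, which are possibly infinite combinations of letters. *)
Lemma primitive_ext b p : hpar b p ->
  (forall u, p u != 0 -> exists c, u = [:: c]) -> primitive b p.
Proof.
move=> hp h; split=> // y.
apply: (@clin_ext _ _ _ (fun p => Delta (mulS p y)) (fun p => prim b (mulS p) (Delta y))).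
- exact: (clin_comp clin_Delta (clin_mulSl y)).
- exact: clin_prim_mulS.
by move=> u pu; rewrite -(hp _ pu); have [c ->] := h _ pu; exact: Delta_letter.
Qed.

Record superder (n : bool) (D : series -> series) : Prop := Deriv {
  der_clin : clin D;
  der_par : opar n D;
  der_leib : forall a f g, hpar a f ->
    D (mulS f g) = mulS (D f) g + sgf (n && a) (mulS f (D g))
}.

Lemma hpar_mono_nil : hpar false (mono [::]).
Proof. by rewrite -(par_nil deg); exact: hpar_mono. Qed.

Lemma der_mono_nil n D : superder n D -> D (mono [::]) = 0.
Proof.
move=> dD; have := der_leib dD (mono [::]) hpar_mono_nil.
rewrite andbF /= !mul_mono_nil mulS_nil => /eqP.
by rewrite -subr_eq0 opprD addrA subrr sub0r oppr_eq0 => /eqP.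
Qed.

(** Induction on words: moving D past the first letter t_c leaves left multiplication by D t_c,
    which the coproduct respects by the primitivity hypothesis. *)
Lemma Delta_der n D f : superder n D ->
  (forall c, primitive (n (+) par [:: c]) (D (mono [:: c]))) ->
  Delta (D f) = prim n D (Delta f).
Proof.
move=> dD hD; have cD := der_clin dD; have cDe := clin_Delta.
apply: (@clin_ext _ _ _ (fun f => Delta (D f)) (fun f => prim n D (Delta f))).
- exact: (clin_comp cDe cD).
- exact: (clin_comp (clin_prim deg n cD) cDe).
move=> u _; rewrite -[delta K u]/(mono u); elim: u => [|c u IHu].
  rewrite (der_mono_nil dD) (clin0 cDe) Delta_mono /=.
  rewrite (prim_tens _ _ cD hpar_mono_nil) (der_mono_nil dD) andbF/=.
  by rewrite (clin0 (clin_tensl _)) (clin0 (clin_tensr _)) addr0.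
have hc := @hpar_mono K B deg [:: c].
have cc := @clin_mulS K B (mono [:: c]).
rewrite mono_cons (der_leib dD _ hc) (clinD cDe).
have [_ ->] := hD c; rewrite Delta_letter.
(* By the Leibniz rule the graded commutator of D with left multiplication by t_c is left
   multiplication by D t_c. *)
rewrite (prim_comm (W := mulS (D (mono [:: c]))) _ cD cc (der_par dD) (opar_mulS hc) (clin_mulS _)).
  rewrite addrC; congr (_ + _).
  rewrite -IHu -Delta_letter; case: (n && _) => //=; exact: clinN.
by move=> g; rewrite (der_leib dD _ hc) addrK.
Qed.

Lemma mu_der n D F : superder n D -> D (mu F) = mu (prim n D F).
Proof.
move=> dD; have cD := der_clin dD; have cm := @clin_mu K B.
apply: (@clin_ext2 _ _ _ (fun F => D (mu F)) (fun F => mu (prim n D F))).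
- exact: (clin_comp cD cm).
- exact: (clin_comp cm (clin_prim deg n cD)).
move=> u v _; have hu := @hpar_mono K B deg u.
rewrite mu_tens (der_leib dD _ hu) (prim_tens _ _ cD hu) (clinD cm) mu_tens.
by congr (_ + _); case: (n && _); rewrite //= (clinN _ cm).
Qed.

Lemma shuf_der n D f : superder n D ->
  (forall c, primitive (n (+) par [:: c]) (D (mono [:: c]))) ->
  shuf deg (D f) = D (shuf deg f).
Proof. by move=> dD hD; rewrite /shuf (Delta_der f dD hD) (mu_der _ dD). Qed.

Lemma clin_shuf : clin (@shuf K B deg).
Proof. exact: (clin_comp (@clin_mu K B) clin_Delta). Qed.

Lemma shuf_mono_supp u v : shuf deg (mono u) v != 0 -> perm_eq u v.
Proof.
rewrite /shuf Delta_mono /mu => n0.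
have [i fi] : exists i : 'I_(size v).+1, Delta_word u (take i v, drop i v) != 0.
  apply/existsP; apply: contraNT n0; rewrite negb_exists => /forallP h.
  by rewrite big1// => i _; apply/eqP; move: (h i); rewrite negbK.
by move: (Delta_word_supp fi); rewrite cat_take_drop.
Qed.

Lemma shuf_par : opar false (@shuf K B deg).
Proof.
move=> b f hf u; apply: contraNeq => ub.
have -> // : shuf deg f u = 0.
have [s ->] := clin_approx f u clin_shuf; rewrite big1// => v _.
have [->|fv] := eqVneq (f v) 0; first by rewrite mul0r.
have [->|/shuf_mono_supp vu] := eqVneq (shuf deg (delta K v) u) 0; first by rewrite mulr0.
by move: ub; rewrite -(hf _ fv) !parE (wdeg_perm deg vu) eqxx.
Qed.

(** The sign is placed on each coefficient of f, so that bracketing with p is one linear operator on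
    all series instead of one for each parity of f. *)
Definition sad (a : bool) p f : series :=
  mulS p f - mulS (fun u => (-1) ^+ (a && par u) * f u) p.

Lemma sgn_hpar (a : bool) b f : hpar b f ->
  (fun u => (-1) ^+ (a && par u) * f u) = sgf (a && b) f.
Proof.
move=> hf; rewrite -kscale_sign; apply/funext => u; rewrite /kscale.
by have [->|/hf->] := eqVneq (f u) 0; rewrite ?mulr0.
Qed.

Lemma sad_hpar a b p f : hpar b f -> sad a p f = sbrk a b p f.
Proof.
by move=> hf; rewrite /sad (sgn_hpar _ hf) /sbrk; case: (a && b); rewrite //= mulSNl.
Qed.

Lemma hpar_sbrk a b p q : hpar a p -> hpar b q -> hpar (a (+) b) (sbrk a b p q).
Proof.
move=> hp hq; apply: hparD; first exact: hpar_mul.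
by apply/hparN/hpar_sgf; rewrite addbC; exact: hpar_mul.
Qed.

Lemma sad_deriv a p : hpar a p -> superder a (sad a p).
Proof.
move=> hp; split.
- apply: clin_sub; first exact: clin_mulS.
  apply: (clin_comp (clin_mulSl p)).
  exact: (clin_pullback (fun u => (-1) ^+ (a && par u)) id).
- by move=> b f hf; rewrite (sad_hpar _ _ hf); exact: hpar_sbrk.
move=> b f g hf; rewrite (sad_hpar _ _ hf) /sbrk /sad.
rewrite (_ : (fun u => _ * mulS f g u) =
   mulS (sgf (a && b) f) (fun u => (-1) ^+ (a && par u) * g u)); last first.
  rewrite -(sgn_hpar a hf); apply/funext => u; rewrite /mulS mulr_sumr.
  apply: eq_bigr => i _; rewrite mulrACA -signr_addb -andb_addr -par_cat.
  by rewrite cat_take_drop.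
by case: (a && b) => /=; rewrite !(mulSDl, mulSDr, mulSNl, mulSNr, opprK) !mulSA; ring.
Qed.

(** Bracketing with p is a derivation whose values on letters are brackets of primitive series, so
    [shuf_der] applies to it. *)
Lemma shuf_sbrk a b p f : primitive a p -> hpar b f ->
  shuf deg (sbrk a b p f) = sbrk a b p (shuf deg f).
Proof.
move=> Pp hf; have [hp _] := Pp; rewrite -(sad_hpar _ _ hf) (shuf_der _ (sad_deriv hp)).
  exact/sad_hpar/(shuf_par hf).
move=> c; rewrite (sad_hpar _ _ (@hpar_mono K B deg [:: c])).
exact/primitive_brk/primitive_letter.
Qed.

End Coproduct.

(** * Lie series are primitive *)

Section LiePrimitive.
Variables (K : comAlgType rat) (gr : even_grading K) (B : choiceType) (deg : B -> int).
Local Notation lie_monomial := (lie_monomial gr deg).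
Local Notation That := (That gr deg).

Lemma brkE m n p q : brk m n p q = @sbrk K B (odd (absz m)) (odd (absz n)) p q.
Proof. by rewrite /brk ksignE kscale_sign. Qed.

Lemma lie_monomial_That d p : lie_monomial d p -> That d p.
Proof.
elim=> {d p} [d w []//|d e p q _ hp _ hq]; rewrite brkE.
apply: homogD; first exact: That_mulS.
by apply/homogN/That_sgf/(homog_eq (addrC _ _))/That_mulS.
Qed.

Lemma lie_monomial_primitive d p : lie_monomial d p -> primitive deg (odd (absz d)) p.
Proof.
elim=> {d p} [d w [hw w1]|d e p q _ hp _ hq].
  apply: (primitive_ext (That_par hw)) => u wu.
  have : size u = 1%N by apply/eqP; apply: contraNT wu => /w1/eqP.
  by case: u {wu} => [|c []]//= _; exists c.
by rewrite brkE odd_abszD; exact: primitive_brk.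
Qed.

Lemma Lhat_That d p : Lhat gr deg d p -> That d p.
Proof.
move=> [J [x [hx sx ->]]]; apply: homog_infsum => // j.
exact: lie_monomial_That.
Qed.

Lemma Lhat_primitive d p : Lhat gr deg d p -> primitive deg (odd (absz d)) p.
Proof.
move=> [J [x [hx sx ->]]]; apply: primitive_infsum => // j.
exact: lie_monomial_primitive.
Qed.

Lemma lie_monomial_Lhat d p : lie_monomial d p -> Lhat gr deg d p.
Proof.
move=> hp; exists unit, (fun=> p); split=> //.
  by move=> u; exact: (@finite_suppP _ _ _ [:: tt]) => -[].
by apply/funext => u; rewrite (@infsumE _ _ _ _ _ [:: tt]) ?big_seq1// => -[].
Qed.

Lemma letter_lie c : lie_monomial (1 - deg c) (mono K [:: c]).
Proof.
apply: Lie_gen; split.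
  by have := That_mono gr deg [:: c]; rewrite wdeg_cons wdeg_nil addr0.
by move=> u; rewrite /mono; case: (u =P [:: c]) => [->|].
Qed.

End LiePrimitive.

(** * Eigenvectors of the modified shuffle operator *)

Section Spectral.
Variables (K : comAlgType rat) (gr : even_grading K) (B : choiceType) (deg : B -> int).
Local Notation series := (seq B -> K).
Local Notation series2 := (seq B * seq B -> K).
Local Notation mono := (@mono K B).
Local Notation par := (par deg).
Local Notation hpar := (@hpar K B deg).
Local Notation prim := (@prim K B deg).
Local Notation primitive := (@primitive K B deg).
Local Notation Delta := (@Delta K B deg).
Local Notation shuf := (@shuf K B deg).
Local Notation lie_monomial := (lie_monomial gr deg).
Local Notation idem_comp := (@idem_comp K B deg).
Local Notation idem := (@idem K B deg).
Implicit Types (f g h p q x y : series) (u v w : seq B) (F G : series2) (T U : series -> series).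

(** The part of parity b of F_k in the overview. The unit belongs to every level, so k is only an
    upper bound for the number of Lie factors. Sums are finite, which suffices for words. *)
Inductive lie_span : nat -> bool -> series -> Prop :=
| LS_zero k b : lie_span k b 0
| LS_one k : lie_span k false (mono [::])
| LS_add k b f g : lie_span k b f -> lie_span k b g -> lie_span k b (f + g)
| LS_scale k b (a : K) f : lie_span k b f -> lie_span k b (kscale a f)
| LS_lie k d b p f : lie_monomial d p -> lie_span k b f ->
    lie_span k.+1 (odd (absz d) (+) b) (mulS p f).

Inductive tens_span : nat -> bool -> series2 -> Prop :=
| TS_zero k b : tens_span k b 0
| TS_add k b F G : tens_span k b F -> tens_span k b G -> tens_span k b (F + G)
| TS_scale k b (a : K) F : tens_span k b F -> tens_span k b (kscale a F)
| TS_tens i j a b f g : lie_span i a f -> lie_span j b g ->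
    tens_span (i + j) (a (+) b) (tens f g).

Lemma LS_opp k b f : lie_span k b f -> lie_span k b (- f).
Proof. by rewrite -kscaleN1r; exact: LS_scale. Qed.

Lemma LS_sgf k b a f : lie_span k b f -> lie_span k b (sgf a f).
Proof. by case: a => //; exact: LS_opp. Qed.

Lemma TS_sgf k b a F : tens_span k b F -> tens_span k b (sgf a F).
Proof. by case: a => //; rewrite /= -kscaleN1r; exact: TS_scale. Qed.

Lemma LS_weaken k j b f : (k <= j)%N -> lie_span k b f -> lie_span j b f.
Proof.
move=> + h; elim: h j => {k b f}; try by move=> *; constructor; eauto.
move=> k d b p f hp _ IH [//|j] kj; apply: LS_lie => //; exact: IH.
Qed.

Lemma LS_sum k b n (f : nat -> series) : (forall i, (i < n)%N -> lie_span k b (f i)) ->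
  lie_span k b (\sum_(i < n) f i).
Proof.
elim: n => [|n IHn] h; first by rewrite big_ord0; exact: LS_zero.
rewrite big_ord_recr /=; apply: LS_add; last exact: h.
by apply: IHn => i ni; apply: h; rewrite ltnS ltnW.
Qed.

Lemma LS_hpar k b f : lie_span k b f -> hpar b f.
Proof.
elim=> {k b f} [k b|k|k b f g _ hf _ hg|k b a f _ hf|k d b p f hp _ hf].
- exact: hpar0.
- exact: hpar_mono_nil.
- exact: hparD.
- exact: hparS.
- apply: hpar_mul => //; by have [] := lie_monomial_primitive hp.
Qed.

Lemma LS_mul i j a b f g : lie_span i a f -> lie_span j b g ->
  lie_span (i + j) (a (+) b) (mulS f g).
Proof.
move=> hf hg; elim: hf => {i a f} [k a|k|k a f f' _ hf _ hf'|k a c f _ hf|k d a p f hp _ hf].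
- by rewrite (clin0 (clin_mulSl g)); exact: LS_zero.
- by rewrite mul_mono_nil; apply: LS_weaken hg; rewrite leq_addl.
- by rewrite mulSDl; exact: LS_add.
- by rewrite (clinZ (clin_mulSl g)); exact: LS_scale.
- by rewrite mulSA addSn -addbA; exact: LS_lie.
Qed.

(** Bracketing with p acts as a derivation: in each term it replaces one Lie factor by another Lie
    monomial, so the number of factors does not grow. *)
Lemma LS_brk k b d p f : lie_monomial d p -> lie_span k b f ->
  lie_span k (odd (absz d) (+) b) (sbrk (odd (absz d)) b p f).
Proof.
move=> hp; set a := odd _; have Pp := lie_monomial_primitive hp.
elim=> {k b f} [k b|k|k b f g _ hf _ hg|k b c f _ hf|k e b q f hq hf0 hf].
- rewrite /sbrk (clin0 (clin_mulS p)) (clin0 (clin_mulSl p)).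
  by case: (a && b); rewrite /= ?oppr0 addr0; exact: LS_zero.
- by rewrite /sbrk andbF mul_mono_nil mulS_nil subrr; exact: LS_zero.
- have -> : sbrk a b p (f + g) = sbrk a b p f + sbrk a b p g.
    by rewrite /sbrk; case: (a && b) => /=; rewrite !(mulSDl, mulSDr); ring.
  exact: LS_add.
- have -> : sbrk a b p (kscale c f) = kscale c (sbrk a b p f).
    rewrite /sbrk (clinZ (clin_mulS p)) (clinZ (clin_mulSl p)).
    by apply/funext => u; case: (a && b); rewrite /= /kscale /= !addfE !oppfE; ring.
  exact: LS_scale.
have -> : sbrk a (odd (absz e) (+) b) p (mulS q f)
  = mulS (sbrk a (odd (absz e)) p q) f + sgf (a && odd (absz e)) (mulS q (sbrk a b p f)).
  rewrite /sbrk; case: (a); case: (odd _); case: b {hf0 hf} => /=;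
    by rewrite !(mulSDl, mulSDr, mulSNl, mulSNr, opprK) !mulSA; ring.
apply: LS_add.
  rewrite addbA -odd_abszD -brkE; apply: LS_lie => //; exact: Lie_brk.
by apply: LS_sgf; rewrite addbCA; exact: LS_lie.
Qed.

Lemma TS_prim k b d p F : lie_monomial d p -> tens_span k b F ->
  tens_span k.+1 (odd (absz d) (+) b) (prim (odd (absz d)) (mulS p) F).
Proof.
move=> hp; set a := odd _; have cp := @clin_mulS K B p.
have cP := clin_prim deg a cp.
elim=> {k b F} [k b|k b F G _ hF _ hG|k b c F _ hF|i j b b' f g hf hg].
- by rewrite (clin0 cP); exact: TS_zero.
- by rewrite (clinD cP); exact: TS_add.
- by rewrite (clinZ cP); exact: TS_scale.
rewrite (prim_tens _ _ cp (LS_hpar hf)); apply: TS_add.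
  by rewrite addbA -addSn; apply: TS_tens => //; exact: LS_lie.
by apply: TS_sgf; rewrite addbCA -addnS; apply: TS_tens => //; exact: LS_lie.
Qed.

(** Each Lie factor is primitive and goes to one of the two sides, so the total number of factors is
    kept. *)
Lemma TS_Delta k b f : lie_span k b f -> tens_span k b (Delta f).
Proof.
have cD := @clin_Delta K B deg.
elim=> {k b f} [k b|k|k b f g _ hf _ hg|k b c f _ hf|k d b p f hp _ hf].
- by rewrite (clin0 cD); exact: TS_zero.
- rewrite Delta_mono -[k]addn0 -[false]/(false (+) false).
  by apply: TS_tens; exact: LS_one.
- by rewrite (clinD cD); exact: TS_add.
- by rewrite (clinZ cD); exact: TS_scale.
by have [_ ->] := lie_monomial_primitive hp; exact: TS_prim.
Qed.

(* f' p f'' differs from p f' f'' by [p, f'] f'', which needs no additional factor. *)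
Lemma mu_prim_lie_span k b d p F : lie_monomial d p -> tens_span k b F ->
  lie_span k (odd (absz d) (+) b)
    (mu (prim (odd (absz d)) (mulS p) F) - (mulS p (mu F) + mulS p (mu F))).
Proof.
move=> hp; set a := odd _; have cp := @clin_mulS K B p; have cm := @clin_mu K B.
pose T F := mu (prim a (mulS p) F) - (mulS p (mu F) + mulS p (mu F)).
have cT : clin T.
  apply: clin_sub; first exact: (clin_comp cm (clin_prim deg a cp)).
  by apply: clin_add; exact: (clin_comp cp cm).
rewrite -/(T _); elim=> {k b F} [k b|k b F G _ hF _ hG|k b c F _ hF|i j b b' f g hf hg].
- by rewrite (clin0 cT); exact: LS_zero.
- by rewrite -/(T _) (clinD cT); exact: LS_add.
- by rewrite -/(T _) (clinZ cT); exact: LS_scale.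
have -> : T (tens f g) = - mulS (sbrk a b p f) g.
  rewrite /T (prim_tens _ _ cp (LS_hpar hf)) (clinD cm) /sbrk.
  by case: (a && b); rewrite /= ?(clinN _ cm) !mu_tens !(mulSDl, mulSNl, opprK) !mulSA; ring.
apply: LS_opp; rewrite addbA; apply: LS_mul => //; exact: LS_brk.
Qed.

Definition eig (k : nat) : K := (lam k)%:A.

Lemma eig0 : eig 0 = 1.
Proof. by rewrite /eig /lam expr0 scale1r. Qed.

Lemma eigS k : eig k.+1 = eig k + eig k.
Proof. by rewrite /eig /lam exprS -scalerDl; congr (_ *: _); ring. Qed.

Lemma shuf_mono_nil : shuf (mono [::]) = mono [::].
Proof. by rewrite /Defs.shuf Delta_mono mu_tens mul_mono_nil. Qed.

(** The case k = 0 says that s - 2^0 maps F_0 to zero, which plays the part of F_(-1). *)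
Lemma shuf_lie_span k b f : lie_span k b f ->
  if k is k'.+1 then lie_span k' b (shuf f - kscale (eig k) f) else shuf f = f.
Proof.
have cs := @clin_shuf K B deg.
have cT j : clin (fun f => shuf f - kscale (eig j) f).
  by apply: clin_sub => //; apply: clin_scale; exact: clin_id.
elim=> {k b f} [k b|k|k b f g _ hf _ hg|k b c f _ hf|k d b p f hp hf IHf].
- by case: k => [|k]; rewrite (clin0 cs)// kscaler0 subr0; exact: LS_zero.
- case: k => [|k]; rewrite shuf_mono_nil//; apply: LS_add; first exact: LS_one.
  by apply/LS_opp/LS_scale/LS_one.
- by case: k hf hg => [|k] hf hg; rewrite (clinD cs) ?hf ?hg// -(clinD cs) (clinD (cT k.+1)); exact: LS_add.
- by case: k hf => [|k] hf; rewrite (clinZ cs) ?hf// -(clinZ cs) (clinZ (cT k.+1)); exact: LS_scale.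
have [_ Pp] := lie_monomial_primitive hp.
have hm := mu_prim_lie_span hp (TS_Delta hf).
rewrite -Pp -/(shuf _) in hm.
(* With 2^(k+1) = 2 * 2^k, the left side is the error s(p f) - 2 p s(f), controlled by [hm], plus
   twice p (s f - 2^k f), controlled by induction. *)
have -> : shuf (mulS p f) - kscale (eig k.+1) (mulS p f)
  = (shuf (mulS p f) - (mulS p (shuf f) + mulS p (shuf f)))
    + mulS p (shuf f - kscale (eig k) f) + mulS p (shuf f - kscale (eig k) f).
  rewrite mulSDr mulSNr (clinZ (clin_mulS p)) eigS; apply/funext => u.
  by rewrite !(addfE, oppfE) /kscale; ring.
have hp' : lie_span k (odd (absz d) (+) b) (mulS p (shuf f - kscale (eig k) f)).
  case: k {hm hf} IHf => [->|k hk]; last exact: LS_lie.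
  by rewrite eig0 kscale1r subrr (clin0 (clin_mulS p)); exact: LS_zero.
by do 2 (apply: LS_add => //).
Qed.

Lemma lam_inj i j : lam i = lam j -> i = j.
Proof.
rewrite /lam => /eqP; rewrite -!natrX Num.Theory.eqr_nat => /eqP e.
by apply/eqP; rewrite -(eqn_exp2l i j (isT : 1 < 2)%N) e.
Qed.

(** By induction (s - 2^(k+1)) f is a sum of eigenvectors z_j with j <= k. On z_j the operator s -
    2^(k+1) is the invertible rational 2^j - 2^(k+1), so subtracting the z_j divided by these
    numbers from f leaves an eigenvector for 2^(k+1). *)
Lemma eig_decomposition k b f : lie_span k b f -> exists y : nat -> series,
  f = \sum_(j < k.+1) y j /\
  forall j, (j <= k)%N -> shuf (y j) = kscale (eig j) (y j) /\ lie_span j b (y j).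
Proof.
have cs := @clin_shuf K B deg.
elim: k f => [|k IHk] f hf.
  exists (fun=> f); rewrite big_ord_recl big_ord0 addr0; split=> // j.
  by rewrite leqn0 => /eqP->; rewrite (shuf_lie_span hf) eig0 kscale1r.
have [z [ze hz]] := IHk _ (shuf_lie_span hf).
pose c j : K := (lam j - lam k.+1)^-1%:A.
have cE j : (j <= k)%N -> c j * (eig j - eig k.+1) = 1.
  move=> jk; rewrite /c /eig -scalerBl -scalerAl mul1r scalerA mulVf ?scale1r//.
  by rewrite subr_eq0; apply: contraTneq jk => /lam_inj->; rewrite ltnn.
pose y' := f - \sum_(j < k.+1) kscale (c j) (z j).
exists (fun j => if (j <= k)%N then kscale (c j) (z j) else y').
rewrite big_ord_recr /= ltnn; split.
  rewrite (eq_bigr (fun j : 'I_k.+1 => kscale (c j) (z j))); first by rewrite addrC subrK.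
  by move=> j _; rewrite -ltnS ltn_ord.
move=> j jk1; case: leqP => [jk|kj].
  have [e l] := hz _ jk; split; last exact: LS_scale.
  by rewrite (clinZ cs) e !kscaleA mulrC.
have -> : j = k.+1 by apply/eqP; rewrite eqn_leq jk1.
split; last first.
  apply: LS_add => //; apply/LS_opp/(@LS_sum _ _ _ (fun j => kscale (c j) (z j))) => i ik.
  by apply: LS_scale; have [_] := hz _ ik; apply: LS_weaken; rewrite ltnW.
have -> : shuf y' = shuf f - \sum_(i < k.+1) kscale (c i * eig i) (z i).
  rewrite /y' (clinB _ _ cs) (clin_sum _ _ _ cs); congr (_ - _); apply: eq_bigr => i _.
  by have [e _] := hz i (ltn_ord i); rewrite (clinZ cs) e kscaleA.
apply/funext => u; rewrite /kscale /y' !(addfE, oppfE) !fct_sumE.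
rewrite mulrBr mulr_sumr; apply/eqP; rewrite -subr_eq0 opprD opprK addrACA.
have -> : shuf f u - eig k.+1 * f u = \sum_(i < k.+1) z i u.
  transitivity ((\sum_(i < k.+1) z i) u); first by rewrite -ze.
  by rewrite fct_sumE.
rewrite -sumrN -!big_split/= big1// => i _.
have := cE i (ltn_ord i); rewrite /kscale => e.
transitivity (z i u * (1 - c i * (eig i - eig k.+1))); first by ring.
by rewrite e subrr mulr0.
Qed.

Lemma LS_word u : lie_span (size u) (par u) (mono u).
Proof.
elim: u => [|c u IHu]; first by rewrite par_nil; exact: LS_one.
have h := LS_lie (letter_lie gr deg c) IHu.
by rewrite mono_cons par_cons (_ : par [:: c] = odd (absz (1 - deg c))) // !parE wdeg_cons wdeg_nil addr0.
Qed.

(** F_0 consists of constants. This is why the eigenvalue 2^0 does not occur in positive word length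
    and the product in (i) starts at i = 1. *)
Lemma LS0_const b f u : lie_span 0 b f -> u != [::] -> f u = 0.
Proof.
move=> + u0; move e : 0%N => k h; elim: h e => {k b f}//.
- by move=> k _; rewrite /Defs.mono (negPf u0).
- by move=> k b f g _ hf _ hg e; rewrite addfE hf// hg// addr0.
- by move=> k b a f _ hf e; rewrite /kscale hf// mulr0.
Qed.

Local Notation part := (@part K B).

Lemma clin_part n : clin (part n).
Proof.
rewrite (_ : part n = fun f u => (size u == n)%:R * f u); first exact: clin_pullback.
by apply/funext => f; apply/funext => u; rewrite /Defs.part; case: ifP; rewrite ?mul1r ?mul0r.
Qed.

Lemma part_mono n u : part n (mono u) = if size u == n then mono u else 0.
Proof.
apply/funext => v; rewrite /Defs.part /Defs.mono.
case: (v =P u) => [->|vu]; first by case: ifP; rewrite // eqxx.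
by case: ifP => _; case: ifP => _ //; case: (v =P u).
Qed.

Lemma part_shuf n f : part n (shuf f) = shuf (part n f).
Proof.
have cs := @clin_shuf K B deg; have cp := clin_part n.
apply: (@clin_ext _ _ _ (fun f => part n (shuf f)) (fun f => shuf (part n f))).
- exact: (clin_comp cp cs).
- exact: (clin_comp cs cp).
move=> u _; rewrite -[delta K u]/(mono u) part_mono; apply/funext => v.
rewrite /Defs.part; have [e|/shuf_mono_supp h] := eqVneq (shuf (mono u) v) 0.
  by case: (size u == n); rewrite ?e ?(clin0 cs); case: ifP.
by rewrite (perm_size h); case: ifP => // _; rewrite (clin0 cs).
Qed.

(** As s only rearranges letters, the eigencomponents may be cut down to the length of u. The one
    for 2^0 lies in F_0, hence is constant and disappears when u is not empty. *)
Lemma word_decomposition u : exists y : nat -> series,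
  [/\ mono u = \sum_(j < (size u).+1) y j,
      forall j, (j <= size u)%N -> shuf (y j) = lam j *: y j,
      forall j, part (size u) (y j) = y j
    & (0 < size u)%N -> y 0%N = 0].
Proof.
have [y [ye hy]] := eig_decomposition (LS_word u).
exists (fun j => part (size u) (y j)); split.
- rewrite -(clin_sum _ _ _ (clin_part _)) -ye part_mono eqxx//.
- move=> j ju; have [e _] := hy _ ju; rewrite -part_shuf e (clinZ (clin_part _)).
  by rewrite ratscaleE.
- by move=> j; apply/funext => v; rewrite /Defs.part; case: (size v == size u).
move=> u0; apply/funext => v; rewrite /Defs.part; case: ifP => // /eqP vu.
by apply: (LS0_const (hy _ (leq0n _)).2); rewrite -size_eq0 vu -lt0n.
Qed.

Definition idem_poly (rs : seq nat) f := foldr (fun r g => shuf g - lam r *: g) f rs.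

Lemma clin_idem_poly rs : clin (idem_poly rs).
Proof.
elim: rs => [|r rs IHrs]; first exact: clin_id.
by apply: clin_sub; [exact: (clin_comp (@clin_shuf K B deg))|exact: clin_ratscale].
Qed.

Lemma idem_poly_eig rs j f : shuf f = lam j *: f ->
  idem_poly rs f = (\prod_(r <- rs) (lam j - lam r)) *: f.
Proof.
move=> hf; elim: rs => [|r rs IHrs]; first by rewrite big_nil scale1r.
rewrite /= -/(idem_poly rs f) IHrs big_cons.
by rewrite (clin_rat _ _ (@clin_shuf K B deg)) hf mulrBl scalerBl !scalerA [_ * lam j]mulrC.
Qed.

Lemma idem_compE n i f : (i <= n)%N -> idem_comp n i f =
  (\prod_(0 <= r < n.+1 | r != i) (lam i - lam r))^-1
    *: idem_poly [seq r <- iota 0 n.+1 | r != i] f.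
Proof. by rewrite /Defs.idem_comp => ->. Qed.

Lemma clin_idem_comp n i : clin (idem_comp n i).
Proof.
have [le_in|lt_ni] := leqP i n.
  rewrite (_ : idem_comp n i = fun f =>
    (\prod_(0 <= r < n.+1 | r != i) (lam i - lam r))^-1
      *: idem_poly [seq r <- iota 0 n.+1 | r != i] f); last first.
    by apply/funext => f; exact: idem_compE.
  exact/clin_ratscale/clin_idem_poly.
rewrite (_ : idem_comp n i = fun=> 0); first exact: clin_zero.
by apply/funext => f; rewrite /Defs.idem_comp leqNgt lt_ni.
Qed.

Lemma idem_norm_neq0 n i : \prod_(0 <= r < n.+1 | r != i) (lam i - lam r) != 0.
Proof.
rewrite prodf_seq_neq0; apply/allP => r _; apply/implyP => ri.
by rewrite subr_eq0; apply: contraNneq ri => /lam_inj->.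
Qed.

(** Lagrange interpolation at the nodes 2^r, r <= n: on an eigenvector for 2^j the numerator becomes
    a scalar, which for j different from i contains the factor with r = j. *)
Lemma idem_comp_eig n i j f : (j <= n)%N -> shuf f = lam j *: f ->
  idem_comp n i f = if i == j then f else 0.
Proof.
move=> jn hf; case: (leqP i n) => [le_in|lt_ni]; last first.
  rewrite /Defs.idem_comp leqNgt lt_ni /=; case: eqP => // e.
  by move: jn; rewrite -e leqNgt lt_ni.
rewrite idem_compE// (idem_poly_eig _ hf) big_filter scalerA.
case: eqP => [->|/eqP ij].
  by rewrite mulVf ?scale1r//; exact: idem_norm_neq0.
rewrite [X in _ * X](_ : _ = 0) ?mulr0 ?scale0r//; apply/eqP.
rewrite prodf_seq_eq0; apply/hasP; exists j; first by rewrite mem_iota.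
by rewrite eq_sym ij subrr eqxx.
Qed.

Definition idem_part n i f := idem_comp n i (part n f).

Lemma clin_idem_part n i : clin (idem_part n i).
Proof. exact: (clin_comp (clin_idem_comp n i) (clin_part n)). Qed.

(** On a word of length n the operator selects the i-th term of [word_decomposition], or gives 0 if
    i > n; on words of other lengths it gives 0. *)
Lemma idem_part_mono n i u : exists2 x, idem_part n i (mono u) = x &
  [/\ shuf x = lam i *: x, part n x = x & (0 < n)%N -> i = 0%N -> x = 0].
Proof.
eexists; first by reflexivity.
rewrite /idem_part part_mono; case: (size u =P n) => [<-|_]; last first.
  rewrite (clin0 (clin_idem_comp n i)) (clin0 (@clin_shuf K B deg)) scaler0.
  by rewrite (clin0 (clin_part n)).
have [y [ye hy py y0]] := word_decomposition u.
rewrite ye (clin_sum _ _ _ (clin_idem_comp _ _)).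
rewrite (eq_bigr (fun j : 'I_(size u).+1 => if i == j :> nat then y j else 0)); last first.
  by move=> j _; apply: idem_comp_eig; [rewrite -ltnS|apply: hy; rewrite -ltnS].
rewrite -big_mkcond/=; have [le_in|lt_ni] := leqP i (size u).
  rewrite (big_pred1 (Ordinal (le_in : i < (size u).+1)%N)); last first.
    by move=> j; rewrite /= -val_eqE /= eq_sym.
  by rewrite /= hy// py; split=> // u0 i0; rewrite i0 y0.
rewrite big_pred0; last first.
  by move=> j; apply/eqP => e; move: (ltn_ord j); rewrite -e ltnS leqNgt lt_ni.
by rewrite (clin0 (@clin_shuf K B deg)) scaler0 (clin0 (clin_part _)).
Qed.

Lemma shuf_idem_part n i f : shuf (idem_part n i f) = lam i *: idem_part n i f.
Proof.
apply: (@clin_ext _ _ _ (fun f => shuf (idem_part n i f)) (fun f => lam i *: idem_part n i f)).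
- exact: (clin_comp (@clin_shuf K B deg) (clin_idem_part n i)).
- exact/clin_ratscale/clin_idem_part.
by move=> u _; have [x e [h _ _]] := idem_part_mono n i u; rewrite [idem_part _ _ _]e.
Qed.

Lemma part_idem_part n i f : part n (idem_part n i f) = idem_part n i f.
Proof.
apply: (@clin_ext _ _ _ (fun f => part n (idem_part n i f)) (fun f => idem_part n i f)).
- exact: (clin_comp (clin_part n) (clin_idem_part n i)).
- exact/clin_idem_part.
by move=> u _; have [x e [_ h _]] := idem_part_mono n i u; rewrite [idem_part _ _ _]e.
Qed.

Lemma idem_part0 n f : (0 < n)%N -> idem_part n 0 f = 0.
Proof.
move=> n0; apply: (clin_ext0 (clin_idem_part n 0)) => u _.
by have [x e [_ _ h]] := idem_part_mono n 0 u; rewrite [idem_part _ _ _]e h.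
Qed.

Lemma idem_part_sum n f : \sum_(i < n.+1) idem_part n i f = part n f.
Proof.
apply: (@clin_ext _ _ _ (fun f => \sum_(i < n.+1) idem_part n i f) (part n)).
- by apply: clin_bigsum => i; exact: clin_idem_part.
- exact: clin_part.
move=> u _; rewrite /idem_part -[delta K u]/(mono u) part_mono.
case: (size u =P n) => [<-|_]; last by rewrite big1// => i _; rewrite (clin0 (clin_idem_comp n i)).
have [y [ye hy py y0]] := word_decomposition u.
rewrite [in RHS]ye; apply: eq_bigr => i _.
rewrite ye (clin_sum _ _ _ (clin_idem_comp _ _)) (bigD1 i)//= big1 => [|j ji].
  by rewrite addr0 (idem_comp_eig _ (j := i)) ?eqxx// ?hy// -ltnS.
have js : (j <= size u)%N by rewrite -ltnS.
by rewrite (idem_comp_eig _ js) ?hy//; case: eqP => // /val_inj e; rewrite e eqxx in ji.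
Qed.

Lemma idemE i f u : idem i f u = idem_part (size u) i f u.
Proof. by []. Qed.

Lemma clin_idem i : clin (idem i).
Proof.
by apply: clin_coord => u; exists (idem_part (size u) i) => //; exact: clin_idem_part.
Qed.

Lemma part_idem n i f : part n (idem i f) = idem_part n i f.
Proof.
apply/funext => u; rewrite -part_idem_part /Defs.part; case: eqP => // <-.
by rewrite idemE.
Qed.

Lemma part_ext f g : (forall n, part n f = part n g) -> f = g.
Proof.
move=> h; apply/funext => u; have /(congr1 (fun f => f u)) := h (size u).
by rewrite /Defs.part eqxx.
Qed.

Lemma shuf_idem i f : shuf (idem i f) = lam i *: idem i f.
Proof.
apply: part_ext => n; rewrite part_shuf part_idem shuf_idem_part.
by rewrite (clin_rat _ _ (clin_part n)) part_idem.
Qed.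

Lemma idem_big i f u : (size u < i)%N -> idem i f u = 0.
Proof. by move=> iu; rewrite idemE /idem_part /Defs.idem_comp leqNgt iu. Qed.

Lemma idem_sum f u : \sum_(i < (size u).+1) idem i f u = f u.
Proof. 
have := congr1 (fun f => f u) (idem_part_sum (size u) f).
by rewrite fct_sumE /Defs.part eqxx.
Qed.

Lemma idem0 f u : u != [::] -> idem 0 f u = 0.
Proof. by move=> u0; rewrite idemE idem_part0// lt0n size_eq0. Qed.

Lemma idem_eig i j f : shuf f = lam j *: f -> idem i f = if i == j then f else 0.
Proof.
move=> hf; have hn n : shuf (part n f) = lam j *: part n f.
  by rewrite -part_shuf hf (clin_rat _ _ (clin_part n)).
apply: part_ext => n; rewrite part_idem /idem_part.
have [jn|nj] := leqP j n.
  by rewrite (idem_comp_eig _ jn (hn n)); case: eqP => // _; rewrite (clin0 (clin_part n)).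
(* Here n < j, so 2^j is not a node and e_n(0) multiplies the component by a nonzero rational q.
   Since e_n(0) has values in the eigenspace for 2^0, the component belongs to both 2^0 and 2^j and
   vanishes. *)
have p0 : part n f = 0.
  have := shuf_idem_part n 0 f; rewrite /idem_part idem_compE// (idem_poly_eig _ (hn n)) scalerA.
  set q := _ * _; have q0 : q != 0.
    rewrite mulf_neq0 ?invr_eq0 ?idem_norm_neq0// prodf_seq_neq0; apply/allP => r.
    rewrite mem_filter mem_iota add0n => /and3P[_ _ rn]; apply/implyP => _.
    by rewrite subr_eq0; apply: contraTneq nj => /lam_inj->; rewrite -leqNgt -ltnS.
  rewrite (clin_rat _ _ (@clin_shuf K B deg)) hn !scalerA => /eqP.
  rewrite -subr_eq0 -scalerBl scaler_eq0 -[lam 0 * q]mulrC -mulrBr mulf_eq0 (negPf q0)/=.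
  rewrite subr_eq0 -[1]/(lam 0) => /orP[/eqP/lam_inj j0|/eqP//].
  by rewrite j0 ltn0 in nj.
by rewrite p0 (clin0 (clin_idem_comp n i)); case: eqP; rewrite ?p0 ?(clin0 (clin_part n)).
Qed.

Lemma homog_ratscale (q : rat) d f : That gr deg d f -> That gr deg d (q *: f).
Proof. by move=> hf u; apply: gr_ratscale; exact: hf. Qed.

End Spectral.

(** * The extended vector field *)

Section Extend.
Variables (K : comAlgType rat) (gr : even_grading K) (B : choiceType) (deg : B -> int).
Local Notation series := (seq B -> K).
Local Notation mono := (@mono K B).
Local Notation par := (par deg).
Local Notation hpar := (@hpar K B deg).
Local Notation That := (That gr deg).
Local Notation Lhat := (Lhat gr deg).
Implicit Types (f g h p q x y : series) (u v w : seq B).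

Lemma lie_monomial_at_nil d p : lie_monomial gr deg d p -> p [::] = 0.
Proof.
elim=> {d p} [d w [_ h]|d e p q _ hp _ hq]; first exact: h.
by rewrite /brk subfE /kscale !mulS_at_nil hp hq !mul0r mulr0 subrr.
Qed.

Lemma Lhat_at_nil d p : Lhat d p -> p [::] = 0.
Proof.
move=> [J [x [hx _ ->]]]; rewrite (@infsumE _ _ _ _ _ [::]) ?big_nil// => j.
by rewrite (lie_monomial_at_nil (hx j)) eqxx.
Qed.

Lemma opar_mono n (T : series -> series) : clin T ->
  (forall u, hpar (n (+) par u) (T (mono u))) -> opar deg n T.
Proof.
move=> cT h b f hf u; apply: contraNeq => nb.
have -> // : T f u = 0.
have [s ->] := clin_approx f u cT; rewrite big1// => v _.
have [->|/hf vb] := eqVneq (f v) 0; first by rewrite mul0r.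
have [->|/h] := eqVneq (T (delta K v) u) 0; first by rewrite mulr0.
by rewrite vb => e; rewrite e eqxx in nb.
Qed.

Variables (m M : series -> series).
Hypotheses (Cm : is_Cinfty gr deg m) (mM : is_extension gr deg m M).

Let MV := mM.1.

(* M is only constrained on homogeneous series; vext is linear everywhere. *)
Definition vext : series -> series := ext (fun v => M (mono v)).

(** The finite set given by continuity of M at u serves all degrees at once, so it contains every
    word v for which M t_v is nonzero at u. *)
Lemma vext_colfin : colfin (fun v => M (mono v)).
Proof.
move=> u; have [F hF] := vf_continuous MV u; exists F => v; apply: contraNT => vF.
apply/eqP; apply: (hF _ _ (That_mono gr deg v)) => w wF.
by rewrite /Defs.mono; case: (w =P v) => // e; rewrite e (negPf vF) in wF.
Qed.

Lemma clin_vext : clin vext.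
Proof. exact: (clin_extension vext_colfin). Qed.

Lemma vext_mono v : vext (mono v) = M (mono v).
Proof. exact: ext_delta. Qed.

Lemma ext_That0 : M 0 = 0.
Proof.
have h := sub0 (homog_submodule gr (wdeg deg)) 0.
have := vfD MV h h; rewrite addr0 => /eqP; rewrite -subr_eq0 opprD addrA subrr sub0r.
by rewrite oppr_eq0 => /eqP.
Qed.

(** M is additive only within one degree. The truncation of f is a finite sum of terms f_v t_v, each
    again of degree d, and the remainder vanishes on the finite set that controls the coordinate
    u. *)
Lemma vextE d f : That d f -> M f = vext f.
Proof.
move=> hf; apply/funext => u; have [F hF] := vf_continuous MV u.
have sub := homog_submodule gr (wdeg deg).
pose t v := kscale (f v) (mono v).
have ht v : That d (t v).
  by apply: (homog_eq _ (subZ sub (hf v) (That_mono gr deg v))); lia.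
have [T1 T2] : That d (\sum_(v <- undup F) t v) /\
    M (\sum_(v <- undup F) t v) = \sum_(v <- undup F) M (t v).
  elim: (undup F) => [|v s [h1 h2]]; first by rewrite !big_nil ext_That0; split=> //; exact: (sub0 sub).
  by rewrite !big_cons (vfD MV (ht v) h1) h2; split=> //; exact: (subD sub (ht v) h1).
pose g := f - \sum_(v <- undup F) t v.
have hg : That d g by apply: homogD => //; exact: homogN.
have g0 : M g u = 0.
  apply: (hF _ _ hg) => w wF; rewrite /g subfE fct_sumE (bigD1_seq w) ?mem_undup ?undup_uniq//=.
  rewrite /t /kscale /Defs.mono eqxx mulr1 big1 ?addr0 ?subrr// => k kw.
  by rewrite eq_sym (negPf kw) mulr0.
have -> : f = g + \sum_(v <- undup F) t v by rewrite subrK.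
rewrite (vfD MV hg T1) addfE g0 add0r T2.
have cv := clin_vext; rewrite (clinD cv) addfE (clin_sum _ _ _ cv) !fct_sumE.
have -> : vext g u = 0.
  rewrite /vext /ext (@fsum_seq _ _ _ (undup F)) ?undup_uniq//.
    rewrite big_seq big1// => w; rewrite mem_undup => wF.
    rewrite /g subfE fct_sumE (bigD1_seq w) ?mem_undup ?undup_uniq//=.
    rewrite /t /kscale /Defs.mono eqxx mulr1 big1 ?addr0 ?subrr ?mul0r// => k kw.
    by rewrite eq_sym (negPf kw) mulr0.
  move=> v; rewrite mem_undup; apply: contraNT => vF.
  rewrite (_ : M (mono v) u = 0) ?mulr0//; apply: (hF _ _ (That_mono gr deg v)) => w wF.
  by rewrite /Defs.mono; case: (w =P v) => // e; rewrite e (negPf vF) in wF.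
rewrite add0r; apply: eq_bigr => v _.
by rewrite /t (clinZ cv) vext_mono (vfZ MV (hf v) (That_mono gr deg v)).
Qed.

Lemma vext_That d f : That d f -> That (d + 1) (vext f).
Proof. by move=> hf; rewrite -(vextE hf); exact: (vf_deg MV). Qed.

Lemma vext_deriv : superder deg true vext.
Proof.
have cv := clin_vext; split=> //.
  apply: opar_mono => // u; rewrite [true (+) _](_ : _ = odd (absz (wdeg deg u + 1))).
    exact/That_par/vext_That/That_mono.
  by rewrite odd_abszD !parE addbT.
move=> a f g hf.
apply: (@clin_ext _ _ _ (fun f => vext (mulS f g))
  (fun f => mulS (vext f) g + sgf a (mulS f (vext g)))).
- exact: (clin_comp cv (clin_mulSl g)).
- apply: clin_add; first exact: (clin_comp (clin_mulSl g) cv).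
  exact/clin_sgf/clin_mulSl.
move=> u /hf ua; rewrite -[delta K u]/(mono u).
apply: (@clin_ext _ _ _ (fun g => vext (mulS (mono u) g))
  (fun g => mulS (vext (mono u)) g + sgf a (mulS (mono u) (vext g)))).
- exact: (clin_comp cv (clin_mulS _)).
- by apply: clin_add; [exact: clin_mulS|apply/clin_sgf/(clin_comp (clin_mulS _) cv)].
move=> v _; rewrite -[delta K v]/(mono v) -mono_cat !vext_mono mono_cat.
rewrite (vf_leibniz MV (That_mono gr deg u) (That_mono gr deg v)).
by rewrite ksignE kscale_sign -/(par u) ua.
Qed.

(** Here the C_infinity condition enters, as opposed to the A_infinity one: m maps Lie series to Lie
    series. *)
Lemma vext_letter c : Lhat (1 - deg c + 1) (vext (mono [:: c])).
Proof.
have hc := lie_monomial_Lhat (letter_lie gr deg c).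
by rewrite vext_mono (mM.2 _ _ hc); exact: (vf_deg Cm.1 hc).
Qed.

Lemma vext_letter_primitive c : primitive deg (true (+) par [:: c]) (vext (mono [:: c])).
Proof.
have := Lhat_primitive (vext_letter c); rewrite odd_abszD addbT.
by rewrite !parE wdeg_cons wdeg_nil addr0.
Qed.

Lemma vext_at_nil f : vext f [::] = 0.
Proof.
have [s ->] := clin_approx f [::] clin_vext; rewrite big1// => u _.
rewrite -[delta K u]/(mono u); case: u => [|c u].
  by rewrite (der_mono_nil vext_deriv) mulr0.
rewrite mono_cons (der_leib vext_deriv _ (@hpar_mono K B deg [:: c])) addfE.
rewrite mulS_at_nil (Lhat_at_nil (vext_letter c)) mul0r add0r.
by case: (true && _); rewrite /= ?oppfE mulS_letter_nil ?oppr0 mulr0.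
Qed.

(** The hypothesis gives this on Lie series, in particular on letters. It passes to words because
    the two mixed terms in the square of an odd derivation cancel. *)
Lemma vext_sq f : vext (vext f) = 0.
Proof.
have cv := clin_vext; have dv := vext_deriv.
apply: (clin_ext0 (clin_comp cv cv)) => u _; rewrite -[delta K u]/(mono u).
elim: u => [|c u IHu]; first by rewrite (der_mono_nil dv) (clin0 cv).
have hc := @hpar_mono K B deg [:: c].
have cc : vext (vext (mono [:: c])) = 0.
  have hL := lie_monomial_Lhat (letter_lie gr deg c).
  have hL' := vext_letter c.
  rewrite -(vextE (Lhat_That hL')) (mM.2 _ _ hL') vext_mono (mM.2 _ _ hL).
  exact: (Cm.2 _ _ hL).
rewrite mono_cons (der_leib dv _ hc) (clinD cv) (der_leib dv _ (der_par dv hc)).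
have -> : vext (sgf (true && par [:: c]) (mulS (mono [:: c]) (vext (mono u))))
  = sgf (true && par [:: c]) (vext (mulS (mono [:: c]) (vext (mono u)))).
  by case: (true && _) => //=; exact: clinN.
rewrite (der_leib dv _ hc) IHu cc (clin0 (clin_mulSl _)) (clin0 (clin_mulS _)).
by case: (par [:: c]) => /=; rewrite ?oppr0 ?add0r ?addr0 ?subrr ?addNr.
Qed.

Lemma shuf_vext f : shuf deg (vext f) = vext (shuf deg f).
Proof. exact: (shuf_der _ vext_deriv vext_letter_primitive). Qed.

End Extend.

(** * One-forms modulo commutators *)

Section CyclicRotation.
Variables (K : comAlgType rat) (B : choiceType) (deg : B -> int).
Local Notation series := (seq B -> K).
Local Notation series2 := (seq B * seq B -> K).
Local Notation mono := (@mono K B).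
Local Notation par := (par deg).
Local Notation hpar := (@hpar K B deg).
Local Notation prim := (@prim K B deg).
Local Notation shuf := (@shuf K B deg).
Implicit Types (f g h p q x y : series) (u v w : seq B) (F G : series2) (T U : series -> series).

Lemma hpar_letter c : hpar (par [:: c]) (mono [:: c]).
Proof. exact: hpar_mono. Qed.

(** Represents d(t_v).t_u under [Theta]. By the Leibniz rule d(t_c t_v').t_u = dt_c.t_v' t_u + t_c
    d(t_v').t_u, and modulo commutators t_c moves to the far right of the last term, past a form of
    parity |v'| + |u|. *)
Fixpoint cyc_word v u : series :=
  if v is c :: v' then
    mono (c :: v' ++ u)
    + sgf (par [:: c] && (par v' (+) par u)) (cyc_word v' (u ++ [:: c]))
  else 0.

Lemma cyc_word_supp v u w : cyc_word v u w != 0 -> perm_eq (v ++ u) w.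
Proof.
elim: v u => [|c v IHv] u /=; first by rewrite eqxx.
rewrite addfE {1}/Defs.mono; case: (w =P _) => [->//|_]; rewrite add0r.
have -> (b : bool) f : (sgf b f w != 0) = (f w != 0).
  by case: b; rewrite //= oppfE oppr_eq0.
by move=> /IHv; rewrite catA cats1 perm_rcons.
Qed.

(** A pair of words is given by its concatenation and a cut, so those rearranging to w are finite in
    number. *)
Lemma pair_colfin (phi : seq B * seq B -> series) :
  (forall z w, phi z w != 0 -> perm_eq (z.1 ++ z.2) w) -> colfin phi.
Proof.
move=> h w; exists [seq (take i t, drop i t) | t <- permutations w, i <- iota 0 (size w).+1].
move=> [u v] /h uvw; rewrite /= in uvw; apply/allpairsPdep; exists (u ++ v), (size u); split.
- by rewrite mem_permutations.
- by rewrite mem_iota add0n ltnS -(perm_size uvw) size_cat leq0n leq_addr.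
by rewrite take_size_cat// drop_size_cat.
Qed.

Lemma cyc_colfin : colfin (fun z => cyc_word z.1 z.2).
Proof. by apply: pair_colfin => z w; exact: cyc_word_supp. Qed.

(* The linear extension of p (x) y |-> Theta^-1 (dp . y). *)
Definition cyc : series2 -> series := ext (fun z => cyc_word z.1 z.2).

Lemma clin_cyc : clin cyc.
Proof. exact: (clin_extension cyc_colfin). Qed.

Lemma cyc_mono v u : cyc (tens (mono v) (mono u)) = cyc_word v u.
Proof. by rewrite -delta_tens /cyc (ext_delta (fun z => cyc_word z.1 z.2)). Qed.

Lemma clin_cycl y : clin (fun p => cyc (tens p y)).
Proof. exact: (clin_comp clin_cyc (clin_tensl y)). Qed.

Lemma clin_cycr p : clin (fun y => cyc (tens p y)).
Proof. exact: (clin_comp clin_cyc (clin_tensr p)). Qed.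

Lemma cyc_letter c y : cyc (tens (mono [:: c]) y) = mulS (mono [:: c]) y.
Proof.
apply: (@clin_ext _ _ _ (fun y => cyc (tens (mono [:: c]) y)) (mulS (mono [:: c]))).
- exact: clin_cycr.
- exact: clin_mulS.
move=> u _; rewrite -[delta K u]/(mono u) cyc_mono /= -mono_cons.
by case: (_ && _); rewrite /= ?oppr0 addr0.
Qed.

Lemma cyc_mono_nil y : cyc (tens (mono [::]) y) = 0.
Proof.
by apply: (clin_ext0 (clin_cycr _)) => u _; rewrite -[delta K u]/(mono u) cyc_mono.
Qed.

Lemma cyc_word_cat v1 v2 u : cyc_word (v1 ++ v2) u = cyc_word v1 (v2 ++ u)
  + sgf (par v1 && (par v2 (+) par u)) (cyc_word v2 (u ++ v1)).
Proof.
elim: v1 u => [|c v1 IHv1] u; first by rewrite par_nil /= cats0 add0r.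
rewrite /= IHv1 (par_cons deg c v1) !par_cat -!catA /=.
case: (par [:: c]); case: (par v1); case: (par v2); case: (par u) => /=; ring.
Qed.

(** The Leibniz rule d(pq).y = dp.qy + p dq.y, where in the last term p is carried cyclically behind
    y. *)
Lemma cyc_mul a b e p q y : hpar a p -> hpar b q -> hpar e y ->
  cyc (tens (mulS p q) y) = cyc (tens p (mulS q y))
    + sgf (a && (b (+) e)) (cyc (tens q (mulS y p))).
Proof.
move=> hp hq hy.
apply: (@clin_ext _ _ _ (fun p => cyc (tens (mulS p q) y)) (fun p =>
  cyc (tens p (mulS q y)) + sgf (a && (b (+) e)) (cyc (tens q (mulS y p))))).
- exact: (clin_comp (clin_cycl y) (clin_mulSl q)).
- by apply: clin_add; [exact: clin_cycl|apply/clin_sgf/(clin_comp (clin_cycr q) (clin_mulS y))].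
move=> u /hp <-; rewrite -[delta K u]/(mono u).
apply: (@clin_ext _ _ _ (fun q => cyc (tens (mulS (mono u) q) y)) (fun q =>
  cyc (tens (mono u) (mulS q y)) + sgf (par u && (b (+) e)) (cyc (tens q (mulS y (mono u)))))).
- exact: (clin_comp (clin_cycl y) (clin_mulS _)).
- by apply: clin_add; [exact: (clin_comp (clin_cycr _) (clin_mulSl y))|apply/clin_sgf/clin_cycl].
move=> v /hq <-; rewrite -[delta K v]/(mono v).
apply: (@clin_ext _ _ _ (fun y => cyc (tens (mulS (mono u) (mono v)) y)) (fun y =>
  cyc (tens (mono u) (mulS (mono v) y))
  + sgf (par u && (par v (+) e)) (cyc (tens (mono v) (mulS y (mono u)))))).
- exact: clin_cycr.
- apply: clin_add; first exact: (clin_comp (clin_cycr _) (clin_mulS _)).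
  exact/clin_sgf/(clin_comp (clin_cycr _) (clin_mulSl _)).
move=> w /hy <-; rewrite -[delta K w]/(mono w) -!mono_cat !cyc_mono.
exact: cyc_word_cat.
Qed.

(* The linear extension of x dy |-> Theta^-1 (x dy), where
   x dy = (-1)^(|x||y|) dy . x modulo commutators. *)
Definition untheta : series2 -> series :=
  ext (fun z => sgf (par z.1 && par z.2) (cyc_word z.2 z.1)).

Lemma untheta_colfin : colfin (fun z => sgf (par z.1 && par z.2) (cyc_word z.2 z.1)).
Proof.
apply: pair_colfin => z w h; rewrite perm_catC; apply: cyc_word_supp.
by apply: contra_neq h; case: (_ && _); rewrite //= oppfE => ->; rewrite oppr0.
Qed.

Lemma untheta_delta u v :
  untheta (delta K (u, v)) = sgf (par u && par v) (cyc_word v u).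
Proof. exact: (ext_delta (fun z => sgf (par z.1 && par z.2) (cyc_word z.2 z.1))). Qed.

Lemma clin_untheta : clin untheta.
Proof. exact: (clin_extension untheta_colfin). Qed.

Lemma untheta_tens a b x y : hpar a x -> hpar b y ->
  untheta (tens x y) = sgf (a && b) (cyc (tens y x)).
Proof.
move=> hx hy.
apply: (@clin_ext _ _ _ (fun x => untheta (tens x y)) (fun x => sgf (a && b) (cyc (tens y x)))).
- exact: (clin_comp clin_untheta (clin_tensl y)).
- exact/clin_sgf/clin_cycr.
move=> u /hx <-; rewrite -[delta K u]/(mono u).
apply: (@clin_ext _ _ _ (fun y => untheta (tens (mono u) y))
  (fun y => sgf (par u && b) (cyc (tens y (mono u))))).
- exact: (clin_comp clin_untheta (clin_tensr _)).
- exact/clin_sgf/clin_cycl.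
move=> v /hy <-; rewrite -[delta K v]/(mono v) cyc_mono -delta_tens.
exact: untheta_delta.
Qed.

Lemma clin_at_nil (T : series2 -> series) : clin T ->
  (forall z, T (delta K z) [::] = 0) -> forall F, T F [::] = 0.
Proof.
by move=> cT h F; have [s ->] := clin_approx F [::] cT; rewrite big1// => i _; rewrite h mulr0.
Qed.

Lemma untheta_at_nil F : untheta F [::] = 0.
Proof.
apply: (clin_at_nil clin_untheta) => -[u v]; rewrite delta_tens.
rewrite (untheta_tens (@hpar_mono K B deg u) (@hpar_mono K B deg v)) cyc_mono.
have [e|/cyc_word_supp] := eqVneq (cyc_word v u [::]) 0.
  by case: (_ && _); rewrite /= ?oppfE e ?oppr0.
by case: v => [|c v] /perm_size//=; case: (_ && _); rewrite /= ?oppfE ?oppr0.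
Qed.

(* One-forms are functions vanishing where the second word is empty, because
   d(1) = 0. *)
Definition mod_d1 F : series2 := fun z => if z.2 is [::] then 0 else F z.

Lemma clin_mod_d1 : clin mod_d1.
Proof.
rewrite (_ : mod_d1 = fun F z => (z.2 != [::])%:R * F z).
  exact: (clin_pullback (fun z => (z.2 != [::])%:R) id).
by apply/funext => F; apply/funext => -[u [|c v]]; rewrite /mod_d1 /= ?mul0r ?mul1r.
Qed.

Lemma mod_d1_delta u v : mod_d1 (delta K (u, v)) = if v is [::] then 0 else delta K (u, v).
Proof.
apply/funext => -[a [|c b]]; rewrite /mod_d1 /delta /=.
  by case: v => [|d v] //; rewrite xpair_eqE andbF.
by case: v => [|d v] //; rewrite xpair_eqE andbF.
Qed.

Lemma clin_mod_d1_ext (J : eqType) (T : series2 -> J -> K) F : clin T ->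
  (forall u, T (tens (mono u) (mono [::])) = 0) -> T (mod_d1 F) = T F.
Proof.
move=> cT h; apply: (@clin_ext _ _ _ (fun F => T (mod_d1 F)) T) => //.
  exact: (clin_comp cT clin_mod_d1).
move=> [u v] _; rewrite mod_d1_delta; case: v => [|c v] //.
by rewrite (clin0 cT) delta_tens h.
Qed.

Lemma untheta_mod_d1 F : untheta (mod_d1 F) = untheta F.
Proof.
apply: (clin_mod_d1_ext _ clin_untheta) => u.
rewrite (untheta_tens (@hpar_mono K B deg u) (hpar_mono_nil _)) cyc_mono_nil.
by case: (_ && _); rewrite /= ?oppr0.
Qed.

Lemma form1E x y : form1 x y = mod_d1 (tens x y).
Proof. by []. Qed.

Lemma clin_Theta : clin (@Theta K B).
Proof.
rewrite (_ : @Theta K B = fun f => mod_d1 ((fun z => (z.1 == [::])%:R * f z.2)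
   - (fun z => (size z.1 == 1%N)%:R * f (z.1 ++ z.2)))).
  apply: (clin_comp clin_mod_d1); apply: clin_sub.
    exact: (clin_pullback (fun z => (z.1 == [::])%:R) (fun z => z.2)).
  exact: (clin_pullback (fun z => (size z.1 == 1%N)%:R) (fun z => z.1 ++ z.2)).
apply/funext => f; apply/funext => -[u [|c v]]//; rewrite /Theta /mod_d1 /= subfE /=.
case: u => [|d [|d' u]] /=; first by rewrite mul1r mul0r subr0.
  by rewrite mul0r mul1r sub0r.
by rewrite !mul0r subr0.
Qed.

Lemma Theta_letter c y : Theta (mulS (mono [:: c]) y)
  = mod_d1 (tens (mono [::]) (mulS (mono [:: c]) y) - tens (mono [:: c]) y).
Proof.
apply/funext => -[u [|d v]]//; rewrite /Theta /mod_d1 /= subfE /tens /=.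
case: u => [|e [|e' u]] /=.
- by rewrite /Defs.mono eqxx mul1r [([::] == _)]/= mul0r subr0.
- by rewrite mulS_letter /Defs.mono eqseq_cons eqxx andbT mul0r sub0r.
- by rewrite /Defs.mono eqseq_cons andbF !mul0r subr0.
Qed.

(** dt_c.t_u is d(t_c t_u) - t_c d(t_u). The first form contributes t_c t_u and a rotated term, and
    the second form cancels the rotated term. *)
Lemma untheta_Theta f : f [::] = 0 -> untheta (Theta f) = f.
Proof.
move=> f0; apply: (@clin_ext _ _ _ (fun f => untheta (Theta f)) (fun f => f)).
- exact: (clin_comp clin_untheta clin_Theta).
- exact: clin_id.
case=> [|c u _]; first by rewrite f0 eqxx.
rewrite -[delta K _]/(mono (c :: u)) mono_cons Theta_letter untheta_mod_d1.
have hu := @hpar_mono K B deg u; have hc := @hpar_letter c.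
have h1 := @hpar_mono_nil K B deg.
rewrite (clinB _ _ clin_untheta) (untheta_tens h1 (hpar_mul hc hu)) (untheta_tens hc hu).
by rewrite /= (cyc_mul hc hu h1) mulS_nil mul_mono_nil addbF addrK cyc_letter.
Qed.

End CyclicRotation.

(** * Commutators as the kernel of [untheta] *)

Section Commutators.
Variables (K : comAlgType rat) (gr : even_grading K) (B : choiceType) (deg : B -> int).
Local Notation series := (seq B -> K).
Local Notation series2 := (seq B * seq B -> K).
Local Notation mono := (@mono K B).
Local Notation par := (par deg).
Local Notation hpar := (@hpar K B deg).
Local Notation untheta := (@untheta K B deg).
Local Notation Omega1 := (Omega1 gr deg).
Local Notation DRcomm := (DRcomm gr deg).
Local Notation That := (That gr deg).
Local Notation Pi := (Pi gr deg).
Local Notation homog2 := (homog gr (fun p => wdeg deg p.1 + wdeg deg p.2)).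
Implicit Types (f g h a : series) (u v w : seq B) (F G : series2).

Lemma clin_lactO a : clin (lactO a).
Proof. exact: (clin_op1 (clin_mulS a)). Qed.

Lemma clin_ractO a : clin (fun F => ractO F a).
Proof.
rewrite (_ : (fun F => _) = fun F => mod_d1 (op2 (fun f => mulS f a) F - tens (mu F) a)).
  apply: (clin_comp (@clin_mod_d1 K B)); apply: clin_sub; first exact: (clin_op2 (clin_mulSl a)).
  exact: (clin_comp (clin_tensl a) (@clin_mu K B)).
by apply/funext => F; apply/funext => -[u [|c v]].
Qed.

Lemma ractO_form x y a : ractO (form1 x y) a = mod_d1 (tens x (mulS y a) - tens (mulS x y) a).
Proof. by rewrite ractO_form1 !form1E (clinB _ _ (@clin_mod_d1 K B)). Qed.

Lemma lactO_tens x y a : lactO a (tens x y) = tens (mulS a x) y.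
Proof. exact: (op1_tens _ _ (clin_mulS a)). Qed.

Lemma ractO_mulS x y a b : ractO (ractO (form1 x y) a) b = ractO (form1 x y) (mulS a b).
Proof.
rewrite ractO_form (clinB _ _ (@clin_mod_d1 K B)) (clinB _ _ (clin_ractO b)) -!form1E.
rewrite !ractO_form -(clinB _ _ (@clin_mod_d1 K B)); congr mod_d1.
rewrite !mulSA; ring.
Qed.

Definition hpar2 (e : bool) F := forall z, F z != 0 -> par z.1 (+) par z.2 = e.

Lemma homog2_par d F : homog2 d F -> hpar2 (odd (absz d)) F.
Proof.
move=> hF z Fz; apply/eqP; apply: contraNT Fz => n.
apply/eqP; apply: (gr_even (hF z)).
by move: n; rewrite !parE; lia.
Qed.

Lemma ractO_tens x y a : ractO (tens x y) a = mod_d1 (tens x (mulS y a) - tens (mulS x y) a).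
Proof.
apply/funext => -[u [|c v]]//; rewrite /ractO /mod_d1 /= subfE; congr (_ - _).
exact: (congr1 (fun F => F (u, c :: v)) (op2_tens x y (clin_mulSl a))).
Qed.

(** A trace property. On t_u d(t_v), the right action of x gives t_u d(t_v x) - t_(uv) dx, and
    [cyc_mul] splits the first form into the value on x t_u d(t_v) and a term cancelling the
    second. *)
Lemma untheta_comm (a e : bool) x F : hpar a x -> hpar2 e F ->
  untheta (lactO x F) = sgf (a && e) (untheta (ractO F x)).
Proof.
move=> hx hF; have cU := @clin_untheta K B deg.
apply: (@clin_ext2 _ _ _ (fun F => untheta (lactO x F)) (fun F => sgf (a && e) (untheta (ractO F x)))).
- exact: (clin_comp cU (clin_lactO x)).
- exact/clin_sgf/(clin_comp cU (clin_ractO x)).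
move=> u v /hF <- /=; have hu := @hpar_mono K B deg u; have hv := @hpar_mono K B deg v.
rewrite lactO_tens ractO_tens untheta_mod_d1 (clinB _ _ cU).
rewrite (untheta_tens (hpar_mul hx hu) hv) (untheta_tens hu (hpar_mul hv hx)).
rewrite (untheta_tens (hpar_mul hu hv) hx) (cyc_mul hv hx hu).
by case: a {hx}; case: (par u); case: (par v) => /=; rewrite ?opprK; ring.
Qed.

Lemma homog2_slice1 d F v : homog2 d F -> That (d - wdeg deg v) (fun u => F (u, v)).
Proof. by move=> h u; apply: (gr_eq _ (h (u, v))) => /=; lia. Qed.

Lemma homog2_slice2 d F u : homog2 d F -> That (d - wdeg deg u) (fun v => F (u, v)).
Proof. by move=> h v; apply: (gr_eq _ (h (u, v))) => /=; lia. Qed.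

Lemma homog2_lactO p d a F : That p a -> homog2 d F -> homog2 (p + d) (lactO a F).
Proof.
by move=> ha hF [u v]; apply: (gr_eq _ (That_mulS ha (homog2_slice1 v hF) u)) => /=; lia.
Qed.

Lemma homog2_mod_d1 d F : homog2 d F -> homog2 d (mod_d1 F).
Proof. by move=> h [u [|c v]]; [exact: gr0|exact: h]. Qed.

Lemma homog2_ractO p d a F : That p a -> homog2 d F -> homog2 (d + p) (ractO F a).
Proof.
move=> ha hF [u [|c v]]; first exact: gr0.
rewrite /ractO /=; apply: grB.
  by apply: (gr_eq _ (That_mulS (homog2_slice2 u hF) ha (c :: v))) => /=; lia.
have hm : gr (d - wdeg deg u) (mu F u).
  apply: gr_sum => i _; apply: (gr_eq _ (hF (take i u, drop i u))) => /=.
  by have := wdeg_cat deg (take i u) (drop i u); rewrite cat_take_drop => ->; lia.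
by apply: (gr_eq _ (grM hm (ha (c :: v)))); lia.
Qed.

Lemma homog2_Theta d f : That d f -> homog2 d (Theta f).
Proof.
move=> hf [u [|c v]]; first exact: gr0.
rewrite /Theta /=; case: u => [|e [|e' u]] /=; last exact: gr0.
  by apply: (gr_eq _ (hf (c :: v))); rewrite wdeg_nil; lia.
apply: grN; apply: (gr_eq _ (hf (e :: c :: v))).
by rewrite -(wdeg_cat deg [:: e] (c :: v)).
Qed.

Lemma homog2_Omega1 d F : homog2 d F -> Omega1 d (mod_d1 F).
Proof. by move=> h; split=> //; exact: homog2_mod_d1. Qed.

Lemma Theta_Omega1 d f : That d f -> Omega1 d (Theta f).
Proof. by move=> h; split=> //; exact: homog2_Theta. Qed.

Lemma cyc_word_That v u : That (wdeg deg (v ++ u)) (cyc_word K deg v u).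
Proof.
elim: v u => [|c v IHv] u /=; first by move=> w; exact: gr0.
apply: homogD; first exact: That_mono.
apply: That_sgf; apply: (homog_eq _ (IHv (u ++ [:: c]))).
by apply: wdeg_perm; rewrite catA cats1 perm_rcons.
Qed.

Lemma untheta_That d F : homog2 d F -> That d (untheta F).
Proof.
move=> h; apply: (homog_eq (addr0 d)); apply: (homog_clin (@clin_untheta K B deg) _ h) => -[u v].
rewrite untheta_delta /= addr0 -wdeg_cat.
apply: That_sgf; apply: (homog_eq _ (cyc_word_That v u)).
by apply: wdeg_perm; rewrite perm_catC.
Qed.

Lemma Pi_untheta d F : homog2 d F -> Pi d (untheta F).
Proof. by move=> h; split; [exact: untheta_That|exact: untheta_at_nil]. Qed.

Lemma untheta_DRcomm d F : DRcomm d F -> untheta F = 0.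
Proof.
move=> [J [x [hx sx ->]]]; have cU := @clin_untheta K B deg.
rewrite (clin_infsum cU sx) -[RHS](infsum0 K J); congr infsum; apply/funext => j.
have [p [q [a [eta [_ ha [heta _] ->]]]]] := hx j.
rewrite ksignE kscale_sign (clinB _ _ cU) (untheta_comm (That_par ha) (homog2_par heta)).
by case: (_ && _); rewrite /= ?(clinN _ cU) subrr.
Qed.

Lemma DRcomm_Omega1 d F : DRcomm d F -> Omega1 d F.
Proof.
move=> [J [x [hx sx ->]]]; split.
  apply: homog_infsum => // j; have [p [q [a [eta [<- ha [heta _] ->]]]]] := hx j.
  rewrite ksignE kscale_sign; apply: homogD; first exact: homog2_lactO.
  apply: homogN; have h := homog2_ractO ha heta; rewrite addrC in h.
  by case: (_ && _) => //=; exact: homogN.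
move=> u; have [s us hs] := finite_suppE (sx (u, [::])).
rewrite (infsumE us)// big1// => j _; have [p [q [a [eta [_ ha [_ h0] ->]]]]] := hx j.
rewrite subfE /kscale /= mulr0 subr0 /lactO/=.
by rewrite (_ : (fun u0 => _) = 0) ?(clin0 (clin_mulS a))//; apply/funext => w; exact: h0.
Qed.

(* t_u dt_v - Theta (untheta (t_u dt_v)) is the sum of the commutators
   [t_x, Theta t_y] over the factorisations u v = x y with x at least as long
   as u and y nonempty; kappa x collects the t_y. *)
Definition kappa (x : seq B) F : series := fun y => if y is [::] then 0 else
  \sum_(i <- index_iota 0 (size x).+1) 1 * F (take i x, drop i x ++ y).

Lemma clin_kappa x : clin (kappa x).
Proof.
apply: clin_coord => -[|c y]; first by exists (fun=> 0); [exact: clin_zero|].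
exists (fun F _ => \sum_(i <- index_iota 0 (size x).+1) 1 * F (take i x, drop i x ++ (c :: y))) => //.
exact: (@clin_matrix K (seq B * seq B)%type (seq B) nat (fun=> index_iota 0 (size x).+1)
  (fun _ _ => 1) (fun _ i => (take i x, drop i x ++ (c :: y)))).
Qed.

Lemma kappa_delta x u v y : kappa x (delta K (u, v)) y =
  [&& y != [::], (size u <= size x)%N & x ++ y == u ++ v]%:R.
Proof.
case: y => [|c y] //; rewrite /kappa [c :: y != [::]]/= andTb.
move: (c :: y) => {c} {}y.
rewrite big_mkord; under eq_bigr do rewrite mul1r /delta xpair_eqE.
case: leqP => [ux|xu] /=; last first.
  rewrite big1// => i _; case: eqP => // e; move: xu; rewrite -e size_take_min.
  by rewrite ltnNge geq_minr.
rewrite (bigD1 (Ordinal (ux : size u < (size x).+1)%N))//= big1 => [|i ix].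
  rewrite addr0 -[in RHS](cat_take_drop (size u) x) -catA eqseq_cat//.
  by rewrite size_take_min (minn_idPl ux).
case: eqP => //= e; suff : i = Ordinal (ux : size u < (size x).+1)%N by move=> ii; rewrite ii eqxx in ix.
by apply/val_inj; rewrite /= -e size_take_min (minn_idPl _)// -ltnS.
Qed.

Lemma kappa_homog d x F : homog2 d F -> Pi (d - wdeg deg x) (kappa x F).
Proof.
move=> h; split=> // -[|c y]; first exact: gr0.
apply: gr_sum => i _; rewrite mul1r; apply: (gr_eq _ (h (take i x, drop i x ++ c :: y))) => /=.
by have := wdeg_cat deg (take i x) (drop i x); rewrite cat_take_drop wdeg_cat => ->; lia.
Qed.

(** If F has parity e, then the one-form commuted with t_x has parity e (+) par x, which explains
    the sign. *)
Definition cyc_comm (e : bool) (x : seq B) F : series2 :=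
  lactO (mono x) (Theta (kappa x F))
  - sgf (par x && (e (+) par x)) (ractO (Theta (kappa x F)) (mono x)).

Lemma clin_cyc_comm e x : clin (cyc_comm e x).
Proof.
have c := clin_comp (@clin_Theta K B) (clin_kappa x).
by apply: clin_sub; [exact: (clin_comp (clin_lactO _) c)|exact/clin_sgf/(clin_comp (clin_ractO _) c)].
Qed.

(** The left action needs x to be a prefix of u, the right action needs x to be a suffix of v. So at
    each coordinate finitely many commutators contribute, even for an infinite F. *)
Lemma cyc_comm_supp e x F u v : cyc_comm e x F (u, v) != 0 ->
  x \in [seq take i u | i <- iota 0 (size u).+1] ++ [seq drop i v | i <- iota 0 (size v).+1].
Proof.
apply: contraNT; rewrite mem_cat negb_or => /andP[xu xv]; apply/eqP.
have m0 (i : nat) : (i < (size u).+1)%N -> mono x (take i u) = 0.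
  move=> iu; rewrite /Defs.mono; case: eqP => // e0; case/mapP: xu; exists i => //.
  by rewrite mem_iota add0n.
have m1 (i : nat) : (i < (size v).+1)%N -> mono x (drop i v) = 0.
  move=> iv; rewrite /Defs.mono; case: eqP => // e0; case/mapP: xv; exists i => //.
  by rewrite mem_iota add0n.
have l0 G : lactO (mono x) G (u, v) = 0.
  by rewrite /lactO /mulS big1// => i _; rewrite m0// mul0r.
have r0 G : ractO G (mono x) (u, v) = 0.
  rewrite /ractO /=; case: v {xv l0} m1 => // c v m1; rewrite /mulS big1 => [|i _].
    by have := m1 0%N isT; rewrite drop0 => ->; rewrite mulr0 subr0.
  by rewrite m1// mulr0.
by rewrite /cyc_comm addfE oppfE l0; case: (_ && _); rewrite /= ?oppfE r0 !oppr0 addr0.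
Qed.

Lemma cyc_comm_summable e F : summable (fun x => cyc_comm e x F).
Proof. by move=> [u v]; apply: finite_suppP => x; exact: cyc_comm_supp. Qed.

Lemma clin_infsum_cyc_comm e : clin (fun F => infsum (fun x => cyc_comm e x F)).
Proof.
apply: clin_coord => -[u v].
pose s := undup ([seq take i u | i <- iota 0 (size u).+1] ++ [seq drop i v | i <- iota 0 (size v).+1]).
exists (fun F => \sum_(x <- s) cyc_comm e x F).
  by apply: clin_bigsum => x; exact: clin_cyc_comm.
move=> F; rewrite fct_sumE; apply: infsumE; first exact: undup_uniq.
by move=> x /cyc_comm_supp; rewrite mem_undup.
Qed.

(** A factorisation with x at least as long as u either has x = u, leaving t_c t_v, or has x at
    least as long as uc. *)
Lemma kappa_delta_cons x u c v : kappa x (delta K (u, c :: v))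
  = kscale (x == u)%:R (mono (c :: v)) + kappa x (delta K (rcons u c, v)).
Proof.
apply/funext => y; rewrite addfE !kappa_delta size_rcons cat_rcons /kscale /Defs.mono.
have [->|] := eqVneq x u.
  rewrite leqnn ltnn /= eqseq_cat// eqxx /= andbF mul1r addr0.
  by case: eqP => [->|] //; rewrite ?andbT ?andbF.
move=> xu; rewrite mul0r add0r; congr (_%:R); congr (nat_of_bool (_ && _)).
by case: ltngtP => //= e; rewrite eqseq_cat// (negPf xu).
Qed.

Lemma infsum_at (x0 : seq B) F : infsum (fun x => kscale (x == x0)%:R F) = F.
Proof.
apply/funext => z; rewrite (@infsumE _ _ _ _ _ [:: x0]) ?big_seq1 /kscale ?eqxx ?mul1r//.
by move=> x; rewrite inE; case: (x == x0); rewrite ?mul0r ?eqxx.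
Qed.

(** One term of a telescoping sum. The commutator of t_u with dt_c.t_v has left part t_u d(t_c t_v)
    - t_u t_c d(t_v), where c has moved across the d, and right part the corresponding difference of
    values of [untheta]. *)
Lemma cyc_comm_cons u c v :
  lactO (mono u) (Theta (mono (c :: v)))
    - sgf (par u && par (c :: v)) (ractO (Theta (mono (c :: v))) (mono u))
  = mod_d1 (delta K (u, c :: v)) - mod_d1 (delta K (rcons u c, v))
    - (Theta (untheta (delta K (u, c :: v))) - Theta (untheta (delta K (rcons u c, v)))).
Proof.
have cm := @clin_mod_d1 K B; have cT := @clin_Theta K B.
have hu := @hpar_mono K B deg.
have lm F : lactO (mono u) (mod_d1 F) = mod_d1 (lactO (mono u) F).
  by apply/funext => -[w [|d w']]//; rewrite /lactO /mod_d1 /= -/(0 : series) (clin0 (clin_mulS _)).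
have e1 : lactO (mono u) (Theta (mono (c :: v)))
  = mod_d1 (delta K (u, c :: v)) - mod_d1 (delta K (rcons u c, v)).
  rewrite mono_cons Theta_letter lm (clinB _ _ (clin_lactO _)) !lactO_tens (clinB _ _ cm).
  by rewrite mulS_nil -mono_cons -mono_cat cats1 -!delta_tens.
have e2 : ractO (Theta (mono (c :: v))) (mono u) = Theta (mono (c :: v ++ u)).
  have hW : Wmod gr deg (1 - deg c) (mono [:: c]).
    split; first by have := That_mono gr deg [:: c]; rewrite wdeg_cons wdeg_nil addr0.
    by move=> w; rewrite /Defs.mono; case: (w =P [:: c]) => [->|].
  by rewrite (mono_cons K c v) (mono_cons K c (v ++ u)) !(Theta_tensor _ hW) ractO_mulS mono_cat.
rewrite e1 e2; congr (_ - _); rewrite -(clinB _ _ cT) -(clinB _ _ (@clin_untheta K B deg)).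
rewrite -[sgf _ _](_ : Theta (sgf (par u && par (c :: v)) (mono (c :: v ++ u))) = _); last first.
  by case: (_ && _) => //=; exact: clinN.
congr Theta; rewrite (clinB _ _ (@clin_untheta K B deg)) !delta_tens.
rewrite (untheta_tens (hu u) (hu (c :: v))) (untheta_tens (hu (rcons u c)) (hu v)).
rewrite !cyc_mono /= !cats1 -(cats1 u c) par_cat (par_cons deg c v) cats1.
by case: (par [:: c]); case: (par u); case: (par v) => /=; ring.
Qed.

(** The letters of v move across the d one by one, each contributing one commutator, until t_u d(1)
    = 0 is reached. The parity e of the form stays fixed throughout. *)
Lemma infsum_cyc_comm_delta e u v : par u (+) par v = e ->
  infsum (fun x => cyc_comm e x (delta K (u, v)))
  = mod_d1 (delta K (u, v)) - Theta (untheta (delta K (u, v))).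
Proof.
have cU := @clin_untheta K B deg; have cT := @clin_Theta K B.
have hu := @hpar_mono K B deg.
elim: v u => [|c v IHv] u he.
  have -> : (fun x => cyc_comm e x (delta K (u, [::]))) = fun=> 0.
    apply/funext => x; have k0 : kappa x (delta K (u, [::])) = 0.
      apply/funext => y; rewrite kappa_delta cats0.
      case: y => [|c y] //=; case: leqP => //= ux; case: eqP => // h.
      by move/(congr1 size): h; rewrite size_cat /=; lia.
    rewrite /cyc_comm k0 (clin0 cT) (clin0 (clin_lactO _)) (clin0 (clin_ractO _)).
    by case: (_ && _); rewrite /= ?oppr0 addr0.
  rewrite infsum0 mod_d1_delta delta_tens (untheta_tens (hu u) (hu [::])) cyc_mono_nil.
  by case: (_ && _); rewrite /= ?oppr0 (clin0 cT) subr0.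
have he' : par (rcons u c) (+) par v = e.
  by rewrite -he -cats1 par_cat (par_cons deg c v) addbA.
pose C : series2 := lactO (mono u) (Theta (mono (c :: v)))
    - sgf (par u && par (c :: v)) (ractO (Theta (mono (c :: v))) (mono u)).
have step x : cyc_comm e x (delta K (u, c :: v))
  = kscale (x == u)%:R C + cyc_comm e x (delta K (rcons u c, v)).
  rewrite {1}/cyc_comm kappa_delta_cons.
  have cl := clin_comp (clin_lactO (mono x)) cT.
  have cr := clin_comp (clin_ractO (mono x)) cT.
  rewrite (clinD cl) (clinD cr) (clinZ cl) (clinZ cr) /cyc_comm.
  have [->|_] := eqVneq x u; last first.
    by rewrite !kscale0r; case: (_ && _) => /=; ring.
  rewrite !kscale1r /C -he addbAC addbb addFb.
  by case: (_ && _) => /=; ring.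
rewrite (_ : (fun x => _) = fun x => kscale (x == u)%:R C + cyc_comm e x (delta K (rcons u c, v)));
  last exact/funext.
rewrite infsumD.
- by rewrite infsum_at (IHv _ he') /C cyc_comm_cons; ring.
- move=> z; apply: (@finite_suppP _ _ _ [:: u]) => x; rewrite inE /kscale.
  by case: (x == u); rewrite ?mul0r ?eqxx.
- exact: cyc_comm_summable.
Qed.

Lemma infsum_cyc_comm e F : hpar2 e F ->
  infsum (fun x => cyc_comm e x F) = mod_d1 F - Theta (untheta F).
Proof.
move=> hF; have cU := @clin_untheta K B deg; have cT := @clin_Theta K B.
apply: (@clin_ext _ _ _ (fun F => infsum (fun x => cyc_comm e x F))
   (fun F => mod_d1 F - Theta (untheta F))).
- exact: clin_infsum_cyc_comm.
- by apply: clin_sub; [exact: clin_mod_d1|exact: (clin_comp cT cU)].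
by move=> [u v] /hF /=; exact: infsum_cyc_comm_delta.
Qed.

Lemma DRcomm_untheta d F : Omega1 d F -> DRcomm d (F - Theta (untheta F)).
Proof.
move=> [hF F0]; exists (seq B), (fun x => cyc_comm (odd (absz d)) x F); split.
- move=> x; exists (wdeg deg x), (d - wdeg deg x), (mono x), (Theta (kappa x F)); split.
  + by lia.
  + exact: That_mono.
  + exact: (Theta_Omega1 (kappa_homog x hF).1).
  rewrite ksignE kscale_sign /cyc_comm; congr (_ - sgf (_ && _) _).
  by rewrite odd_abszD !parE; congr (_ (+) _); lia.
- exact: cyc_comm_summable.
rewrite infsum_cyc_comm; last exact: homog2_par.
congr (_ - _); apply/funext => -[u [|c v]]//.
by rewrite /mod_d1 F0.
Qed.

(** With [untheta_DRcomm], membership in the space of convergent sums of commutators becomes an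
    equation. *)
Lemma DRcommP d F : Omega1 d F -> untheta F = 0 -> DRcomm d F.
Proof.
move=> hF F0; have := DRcomm_untheta hF.
by rewrite F0 (clin0 (@clin_Theta K B)) subr0.
Qed.

End Commutators.

(** * The Hochschild differential *)

Section HochschildDifferential.
Variables (K : comAlgType rat) (gr : even_grading K) (B : choiceType) (deg : B -> int).
Local Notation series := (seq B -> K).
Local Notation series2 := (seq B * seq B -> K).
Local Notation mono := (@mono K B).
Local Notation par := (par deg).
Local Notation hpar := (@hpar K B deg).
Local Notation prim := (@prim K B deg).
Local Notation shuf := (@shuf K B deg).
Local Notation cyc := (@cyc K B deg).
Local Notation untheta := (@untheta K B deg).
Local Notation Omega1 := (Omega1 gr deg).
Local Notation DRcomm := (DRcomm gr deg).
Local Notation That := (That gr deg).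
Local Notation Lhat := (Lhat gr deg).
Local Notation Pi := (Pi gr deg).
Local Notation homog2 := (homog gr (fun p => wdeg deg p.1 + wdeg deg p.2)).
Implicit Types (f g h p q y : series) (u v w : seq B) (F G : series2).

(** 1 (x) T on W (x) TW, without sign. It serves both 1 (x) s and, by conversion, [idem_tilde]. *)
Definition tail_op (T : series -> series) f : series :=
  fun u => if u is c :: v then T (fun w => f (c :: w)) v else 0.

Lemma clin_tail_op T : clin T -> clin (tail_op T).
Proof.
move=> cT; apply: clin_coord => -[|c v]; first by exists (fun=> 0); [exact: clin_zero|].
exists (fun f _ => T (fun w => 1 * f (c :: w)) v) => [|f /=]; last first.
  by congr (T _ v); apply/funext => w; rewrite mul1r.
apply: (clin_comp (T := fun f w => 1 * f (c :: w)) (U := fun f (_ : seq B) => T f v)).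
  apply: clin_coord => w; exists (fun f (_ : seq B) => T f v) => //.
  split=> [f g|k f|z]; rewrite ?(clinD cT) ?(clinZ cT)//; exact: (clin_fin cT v).
exact: (clin_pullback (fun=> 1) (fun w => c :: w)).
Qed.

Local Notation tail_shuf := (tail_op shuf).

Lemma clin_tail_shuf : clin tail_shuf.
Proof. exact: (clin_tail_op (@clin_shuf K B deg)). Qed.

Lemma tail_shuf_letter c y : tail_shuf (mulS (mono [:: c]) y) = mulS (mono [:: c]) (shuf y).
Proof.
apply/funext => -[|d v]; first by rewrite mulS_letter_nil.
rewrite mulS_letter /= (_ : (fun w => _) = kscale (d == c)%:R y).
  by rewrite (clinZ (@clin_shuf K B deg)).
by apply/funext => w; rewrite mulS_letter.
Qed.

Lemma tail_shuf_mono_nil : tail_shuf (mono [::]) = 0.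
Proof.
apply/funext => -[|c v]//=.
rewrite (_ : (fun w => _) = 0) ?(clin0 (@clin_shuf K B deg))//.
Qed.

Definition cyc_equivariant p := forall y, tail_shuf (cyc (tens p y)) = cyc (tens p (shuf y)).

Lemma cyc_equivariant_ext p : (forall u, tail_shuf (cyc (tens p (mono u))) = cyc (tens p (shuf (mono u)))) ->
  cyc_equivariant p.
Proof.
move=> h y; have cr := clin_cycr deg p.
apply: (@clin_ext _ _ _ (fun y => tail_shuf (cyc (tens p y))) (fun y => cyc (tens p (shuf y)))).
- exact: (clin_comp clin_tail_shuf cr).
- exact: (clin_comp cr (@clin_shuf K B deg)).
by move=> u _; exact: h.
Qed.

Lemma cyc_sbrk a b e p q y : hpar a p -> hpar b q -> hpar e y ->
  cyc (tens (sbrk a b p q) y)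
  = cyc (tens p (sbrk b e q y)) - sgf (a && b) (cyc (tens q (sbrk a e p y))).
Proof.
move=> hp hq hy; have cl := clin_cycl deg y; have cp := clin_cycr deg p; have cq := clin_cycr deg q.
rewrite /sbrk (clinD cl) (clinD cp) (clinD cq) (cyc_mul hp hq hy).
by case: a hp; case: b hq; case: e hy => hy hq hp /=;
  rewrite ?(clinN _ cl) ?(clinN _ cp) ?(clinN _ cq) (cyc_mul hq hp hy) /= ?opprK; ring.
Qed.

Lemma lie_monomial_equivariant d p : lie_monomial gr deg d p -> cyc_equivariant p.
Proof.
have cs := clin_tail_shuf.
elim=> {d p} [d w [hw w1]|d e p q hp0 hp hq0 hq].
  move=> y.
  apply: (@clin_ext _ _ _ (fun p => tail_shuf (cyc (tens p y))) (fun p => cyc (tens p (shuf y)))).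
  - exact: (clin_comp cs (clin_cycl deg y)).
  - exact: clin_cycl.
  move=> u wu; have : size u = 1%N by apply/eqP; apply: contraNT wu => /w1/eqP.
  case: u {wu} => [|c []]//= _; rewrite -[delta K [:: c]]/(mono [:: c]) !cyc_letter.
  exact: tail_shuf_letter.
apply: cyc_equivariant_ext => u; have hu := @hpar_mono K B deg u.
have Pp := lie_monomial_primitive hp0; have Pq := lie_monomial_primitive hq0.
have hsu := shuf_par hu.
rewrite brkE (cyc_sbrk Pp.1 Pq.1 hu) (cyc_sbrk Pp.1 Pq.1 hsu).
rewrite -(shuf_sbrk Pq hu) -(shuf_sbrk Pp hu) -hp -hq (clinD cs); congr (_ + _).
by case: (_ && _); rewrite /= !(clinN _ cs).
Qed.

Lemma Lhat_equivariant d p : Lhat d p -> cyc_equivariant p.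
Proof.
move=> [J [x [hx sx ->]]] y.
apply: (@clin_infsum_ext _ _ _ _ (fun p => tail_shuf (cyc (tens p y))) (fun p => cyc (tens p (shuf y)))) => //.
- exact: (clin_comp clin_tail_shuf (clin_cycl deg y)).
- exact: clin_cycl.
by move=> j; exact: (lie_monomial_equivariant (hx j)).
Qed.

Variables D : series -> series.
Hypotheses (dD : superder deg true D)
  (DL : forall c, Lhat (1 - deg c + 1) (D (mono [:: c])))
  (Dsq : forall f, D (D f) = 0)
  (Dshuf : forall f, shuf (D f) = D (shuf f))
  (DThat : forall d f, That d f -> That (d + 1) (D f)).

(** The differential b as a formula in place of a choice. For the odd derivation D, [prim true D] is
    the Lie derivative up to terms containing d(1). *)
Definition cyc_diff f := untheta (prim true D (Theta f)).

Let cD := der_clin dD.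
Let cP := clin_prim deg true cD.
Let cU := @clin_untheta K B deg.

Lemma clin_cyc_diff : clin cyc_diff.
Proof. by apply: (clin_comp cU); apply: (clin_comp cP); exact: clin_Theta. Qed.

Lemma untheta_prim_mod_d1 F : untheta (prim true D (mod_d1 F)) = untheta (prim true D F).
Proof.
apply: (clin_mod_d1_ext _ (clin_comp cU cP)) => u; have hu := @hpar_mono K B deg u.
have h1 := @hpar_mono_nil K B deg.
rewrite (prim_tens _ _ cD hu) (der_mono_nil dD) (clin0 (clin_tensr _)).
rewrite (clinD cU) (untheta_tens (der_par dD hu) h1) cyc_mono_nil.
by rewrite andbF; case: (_ && _); rewrite /= ?oppr0 (clin0 cU) addr0.
Qed.

Lemma cyc_diff_letter b c y : hpar b y -> cyc_diff (mulS (mono [:: c]) y)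
  = cyc (tens (D (mono [:: c])) y)
    + sgf (par [:: c]) (cyc (tens (mono [:: c]) (D y))).
Proof.
move=> hy; have hc := @hpar_letter K B deg c; have h1 := @hpar_mono_nil K B deg.
have hDc := der_par dD hc; have hDy := der_par dD hy.
have cr := clin_cycr deg (mono [::]); have cl := clin_cycl deg (mono [::]).
have cUP := clin_comp cU cP.
rewrite /cyc_diff Theta_letter untheta_prim_mod_d1 (clinB _ _ cUP).
rewrite (prim_tens _ _ cD h1) (prim_tens _ _ cD hc) (der_mono_nil dD) (clin0 (clin_tensl _)).
rewrite add0r (der_leib dD _ hc) andbF /= tensDr !(clinD cU).
rewrite (untheta_tens h1 (hpar_mul hDc hy)) /= (cyc_mul hDc hy h1) mulS_nil mul_mono_nil.
rewrite (untheta_tens hDc hy) addbF.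
case: (par [:: c]) hc hDc => /= hc hDc;
  rewrite ?tensNr ?(clinN _ cU) (untheta_tens h1 (hpar_mul hc hDy)) (untheta_tens hc hDy) /=
    (cyc_mul hc hDy h1) mulS_nil mul_mono_nil addbF /=; ring.
Qed.

(** Induction on v: the first letter is split off, the rest is rotated, and the formula for letters
    is matched with the Leibniz expansion of D(t_c t_v) through [cyc_mul]. *)
Lemma cyc_diff_word v u : cyc_diff (cyc_word K deg v u)
  = cyc (tens (D (mono v)) (mono u)) + sgf (par v) (cyc (tens (mono v) (D (mono u)))).
Proof.
have cb := clin_cyc_diff; have hm := @hpar_mono K B deg.
elim: v u => [|c v IHv] u.
  rewrite (clin0 cb) (der_mono_nil dD) (clin0 (clin_cycl deg _)) cyc_mono_nil par_nil.
  by rewrite addr0.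
have hc := hm [:: c]; have hv := hm v; have hu := hm u.
have hDc := der_par dD hc; have hDv := der_par dD hv; have hDu := der_par dD hu.
have eS (b : bool) f : cyc_diff (sgf b f) = sgf b (cyc_diff f).
  by case: b => //=; exact: clinN.
rewrite /= (clinD cb) eS IHv mono_cons mono_cat (cyc_diff_letter c (hpar_mul hv hu)).
rewrite cyc_letter (mono_cat K u [:: c]) (mono_cons K c v) (der_leib dD _ hv) (der_leib dD _ hu) (der_leib dD _ hc).
have eL (b : bool) f g y : cyc (tens (f + sgf b g) y) = cyc (tens f y) + sgf b (cyc (tens g y)).
  by rewrite (clinD (clin_cycl deg y)); case: b; rewrite //= (clinN _ (clin_cycl deg y)).
have eR (b : bool) f g y : cyc (tens y (f + sgf b g)) = cyc (tens y f) + sgf b (cyc (tens y g)).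
  by rewrite (clinD (clin_cycr deg y)); case: b; rewrite //= (clinN _ (clin_cycr deg y)).
rewrite eL eR (cyc_mul hDc hv hu) (cyc_mul hc hDv hu) (cyc_mul hc hv hDu) !cyc_letter.
have eM (b : bool) f g y : mulS y (f + sgf b g) = mulS y f + sgf b (mulS y g).
  by rewrite mulSDr; case: b; rewrite //= mulSNr.
rewrite eM (par_cons deg c v).
case: (par [:: c]); case: (par v); case: (par u) => /=; ring.
Qed.

(** Having this for all p, not only for letters, gives the compatibility of b with commutators as
    well as b^2 = 0, where p is the series D t_c. *)
Lemma cyc_diff_cyc a p y : hpar a p ->
  cyc_diff (cyc (tens p y)) = cyc (tens (D p) y) + sgf a (cyc (tens p (D y))).
Proof.
move=> hp; have cb := clin_cyc_diff.
apply: (@clin_ext _ _ _ (fun p => cyc_diff (cyc (tens p y)))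
  (fun p => cyc (tens (D p) y) + sgf a (cyc (tens p (D y))))).
- exact: (clin_comp cb (clin_cycl deg y)).
- apply: clin_add; first exact: (clin_comp (clin_cycl deg y) cD).
  exact/clin_sgf/clin_cycl.
move=> v /hp <-; rewrite -[delta K v]/(mono v).
apply: (@clin_ext _ _ _ (fun y => cyc_diff (cyc (tens (mono v) y)))
  (fun y => cyc (tens (D (mono v)) y) + sgf (par v) (cyc (tens (mono v) (D y))))).
- exact: (clin_comp cb (clin_cycr deg _)).
- apply: clin_add; first exact: clin_cycr.
  exact/clin_sgf/(clin_comp (clin_cycr deg _) cD).
by move=> u _; rewrite -[delta K u]/(mono u) cyc_mono cyc_diff_word.
Qed.

(** The image of L_D F under [untheta] depends only on that of F, so L_D descends to the quotient by
    commutators. *)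
Lemma untheta_prim F : untheta (prim true D F) = cyc_diff (untheta F).
Proof.
have cb := clin_cyc_diff.
apply: (@clin_ext2 _ _ _ (fun F => untheta (prim true D F)) (fun F => cyc_diff (untheta F))).
- exact: (clin_comp cU cP).
- exact: (clin_comp cb cU).
move=> u v _; have hu := @hpar_mono K B deg u; have hv := @hpar_mono K B deg v.
rewrite (prim_tens _ _ cD hu) (untheta_tens hu hv).
have eS (b : bool) f : cyc_diff (sgf b f) = sgf b (cyc_diff f).
  by case: b => //=; exact: clinN.
rewrite eS (cyc_diff_cyc _ hv) (clinD cU) (untheta_tens (der_par dD hu) hv).
have -> (b : bool) F' : untheta (sgf b F') = sgf b (untheta F').
  by case: b => //=; exact: clinN.
rewrite (untheta_tens hu (der_par dD hv)).
by case: (par u); case: (par v) => /=; ring.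
Qed.

Lemma cyc_diff_mono_nil : cyc_diff (mono [::]) = 0.
Proof.
have -> : cyc_diff (mono [::]) = untheta (prim true D 0).
  congr (untheta (prim true D _)); apply/funext => -[u [|c v]]//.
  by rewrite /Theta /Defs.mono /=; case: u => [|d [|d' u]] //=; rewrite oppr0.
by rewrite (clin0 cP) (clin0 cU).
Qed.

Lemma cyc_diff_sq f : cyc_diff (cyc_diff f) = 0.
Proof.
have cb := clin_cyc_diff; apply: (clin_ext0 (clin_comp cb cb)) => u _.
rewrite -[delta K u]/(mono u); case: u => [|c u]; first by rewrite cyc_diff_mono_nil (clin0 cb).
have hc := @hpar_mono K B deg [:: c].
rewrite mono_cons (cyc_diff_letter c (@hpar_mono K B deg u)) (clinD cb).
have eS (b : bool) g : cyc_diff (sgf b g) = sgf b (cyc_diff g).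
  by case: b => //=; exact: clinN.
rewrite eS (cyc_diff_cyc _ (der_par dD hc)) (cyc_diff_cyc _ hc) !Dsq.
rewrite (clin0 (clin_cycl deg _)) (clin0 (clin_cycr deg _)).
by case: (par [:: c]) => /=; ring.
Qed.

Lemma tail_shuf_cyc_diff f : tail_shuf (cyc_diff f) = cyc_diff (tail_shuf f).
Proof.
have cb := clin_cyc_diff; have ct := clin_tail_shuf.
apply: (@clin_ext _ _ _ (fun f => tail_shuf (cyc_diff f)) (fun f => cyc_diff (tail_shuf f))).
- exact: (clin_comp ct cb).
- exact: (clin_comp cb ct).
move=> u _; rewrite -[delta K u]/(mono u); case: u => [|c u].
  by rewrite cyc_diff_mono_nil tail_shuf_mono_nil (clin0 ct) (clin0 cb).
have hu := @hpar_mono K B deg u.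
rewrite mono_cons tail_shuf_letter (cyc_diff_letter c hu) (cyc_diff_letter c (shuf_par hu)).
rewrite (clinD ct) (Lhat_equivariant (DL c)); congr (_ + _).
have -> (b : bool) g : tail_shuf (sgf b g) = sgf b (tail_shuf g).
  by case: b => //=; exact: clinN.
by rewrite !cyc_letter tail_shuf_letter Dshuf.
Qed.

Lemma homog2_prim d F : homog2 d F -> homog2 (d + 1) (prim true D F).
Proof.
move=> h; apply: homogD => -[u v] /=.
  by apply: (gr_eq _ (DThat (homog2_slice1 v h) u)); lia.
by apply: gr_sign; apply: (gr_eq _ (DThat (homog2_slice2 u h) v)); lia.
Qed.

Lemma cyc_diff_Pi d f : That d f -> Pi (d + 1) (cyc_diff f).
Proof. by move=> h; apply: Pi_untheta; apply: homog2_prim; exact: homog2_Theta. Qed.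

Variable M : series -> series.
Hypothesis MD : forall d f, That d f -> M f = D f.

Lemma LieD_prim d F : Omega1 d F -> LieD deg 1 M F = mod_d1 (prim true D F).
Proof.
move=> [h _]; apply/funext => -[u [|c v]]//; rewrite /LieD /mod_d1 /= primE.
rewrite (MD (homog2_slice1 _ h)) (MD (homog2_slice2 _ h)) /op1 /sg2 /op2 /=.
by rewrite ksignE.
Qed.

Lemma LieD_Omega1 d F : Omega1 d F -> Omega1 (d + 1) (LieD deg 1 M F).
Proof.
by move=> h; rewrite (LieD_prim h); apply/homog2_Omega1/homog2_prim; case: h.
Qed.

Lemma untheta_LieD d F : Omega1 d F -> untheta (LieD deg 1 M F) = cyc_diff (untheta F).
Proof. by move=> h; rewrite (LieD_prim h) untheta_mod_d1 untheta_prim. Qed.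

Lemma Omega1_opp d F : Omega1 d F -> Omega1 d (- F).
Proof. by move=> [h h0]; split=> [|u]; [exact: homogN|rewrite oppfE h0 oppr0]. Qed.

Lemma DRcomm_cyc_diff d f : Pi d f ->
  DRcomm (d + 1) (Theta (cyc_diff f) - LieD deg 1 M (Theta f)).
Proof.
move=> [hf f0]; have hO := Theta_Omega1 hf.
have cT := @clin_Theta K B.
have := DRcomm_untheta (Omega1_opp (LieD_Omega1 hO)).
by rewrite (clinN _ cU) (untheta_LieD hO) (untheta_Theta deg f0) (clinN _ cT) opprK [- _ + _]addrC.
Qed.

(** The choice in the definition of b is unique: [untheta] kills the commutator and recovers g from
    [Theta] g. *)
Lemma hoch_diffE d f : Pi d f -> hoch_diff gr deg M f = cyc_diff f.
Proof.
move=> hf; have ex : exists g, exists d, [/\ Pi d f, Pi (d + 1) g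
    & DRcomm (d + 1) (Theta g - LieD deg 1 M (Theta f))].
  by exists (cyc_diff f), d; split => //; [exact: cyc_diff_Pi hf.1|exact: DRcomm_cyc_diff].
(* The chosen degree e may differ from d, so the rest of the argument uses e only. *)
have [e [[he f0] [hg g0] hD]] := xgetPex 0 ex.
have := untheta_DRcomm hD; rewrite (clinB _ _ cU) (untheta_Theta deg g0).
rewrite (untheta_LieD (Theta_Omega1 he)) (untheta_Theta deg f0) => /eqP.
by rewrite subr_eq0 => /eqP.
Qed.

Lemma hochschild_identification : hoch_identification gr deg M.
Proof.
have cT := @clin_Theta K B; split.
- by move=> d f [hf _]; exact: Theta_Omega1.
- by move=> d f [_ f0] /untheta_DRcomm; rewrite (untheta_Theta deg f0).
- move=> d F hF; exists (untheta F); first by case: hF => h _; exact: Pi_untheta.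
  exact: DRcomm_untheta.
- move=> d F hF; have hO := DRcomm_Omega1 hF.
  apply: DRcommP; first exact: LieD_Omega1.
  by rewrite (untheta_LieD hO) (untheta_DRcomm hF) (clin0 clin_cyc_diff).
- by move=> d f hf; rewrite (hoch_diffE hf); exact: DRcomm_cyc_diff.
Qed.

End HochschildDifferential.

(** * Splitting into eigenspaces *)

Section EigenSplitting.
Variables (K : comAlgType rat) (gr : even_grading K) (I : eqType) (A : gmod K I).
Variables (D D' S : (I -> K) -> I -> K) (e : nat -> (I -> K) -> I -> K).
Variables (ev : nat -> rat) (l : I -> nat).
Hypotheses (modA : is_submodule gr A)
  (sumA : forall d (x : nat -> I -> K), summable x -> (forall i, A d (x i)) -> A d (infsum x))
  (cD : clin D') (DE : forall d f, A d f -> D f = D' f)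
  (Ddeg : forall d f, A d f -> A (d + 1) (D' f))
  (Dsq : forall d f, A d f -> D' (D' f) = 0)
  (cS : clin S) (DS : forall f, S (D' f) = D' (S f))
  (ce : forall i, clin (e i)) (eA : forall i d f, A d f -> A d (e i f))
  (Se : forall i f, S (e i f) = ev i *: e i f)
  (e_eig : forall i j d f, A d f -> S f = ev j *: f -> e i f = if i == j then f else 0)
  (e_big : forall i f u, (l u < i)%N -> e i f u = 0)
  (e_sum : forall d f u, A d f -> \sum_(i < (l u).+1) e i f u = f u).

Let P i : gmod K I := fun d => e i @` A d.

Let P_A i d f : P i d f -> A d f.
Proof. by move=> [g hg <-]; exact: eA. Qed.

Let P_eig i d f : P i d f -> S f = ev i *: f.
Proof. by move=> [g hg <-]; exact: Se. Qed.

Let P_big i d f u : P i d f -> (l u < i)%N -> f u = 0.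
Proof. by move=> [g hg <-]; exact: e_big. Qed.

Let eig_P i d f : A d f -> S f = ev i *: f -> P i d f.
Proof. by move=> hf h; exists f => //; rewrite (e_eig i hf h) eqxx. Qed.

Let P_supp d x u i : gprod P d x -> x i u != 0 -> i \in iota 0 (l u).+1.
Proof.
move=> hx; apply: contraNT; rewrite mem_iota add0n ltnS /= -ltnNge => h.
by rewrite (P_big (hx i) h).
Qed.

Let P_summable d x : gprod P d x -> summable x.
Proof. by move=> hx u; apply: finite_suppP => i; exact: P_supp hx. Qed.

Let P_sum d x : gprod P d x -> A d (infsum x).
Proof. by move=> hx; apply: sumA (P_summable hx) _ => i; exact: P_A (hx i). Qed.

Let e_infsum d x i : gprod P d x -> e i (infsum x) = x i.
Proof.
move=> hx; rewrite (clin_infsum (ce i) (P_summable hx)).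
apply/funext => u; rewrite (@infsumE _ _ _ _ _ [:: i]).
- by rewrite big_seq1 (e_eig i (P_A (hx i)) (P_eig (hx i))) eqxx.
- by [].
move=> j; rewrite inE (e_eig i (P_A (hx j)) (P_eig (hx j))).
by have [_|_] := eqVneq i j; rewrite // zerofE eqxx.
Qed.

(** Each piece is the full eigenspace of S inside A, by [eig_P], hence stable under an operator
    commuting with S. At a coordinate u only the indices i <= l u contribute, which gives
    convergence and continuity of summation. Its inverse sends f to the family of the e i f and is
    continuous because each e i is. *)
Lemma eigen_splitting : splits_as_product gr A D P.
Proof.
split.
- split=> //.
  + by move=> d f hf; rewrite (DE hf); exact: Ddeg.
  + by move=> d f g hf hg; rewrite (DE hf) (DE hg) (DE (subD modA hf hg)) (clinD cD).
  + by move=> i d k f hk hf; rewrite (DE hf) (DE (subZ modA hk hf)) (clinZ cD).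
  + by move=> d f hf; rewrite (DE hf) (DE (Ddeg hf)) (Dsq hf).
- move=> i; split.
  + by move=> d f; exact: P_A.
  + split=> [d|d _ _ [f hf <-] [g hg <-]|j d k _ hk [f hf <-]].
    * by exists 0; [exact: (sub0 modA)|exact: (clin0 (ce i))].
    * by exists (f + g); [exact: (subD modA)|exact: (clinD (ce i))].
    * by exists (kscale k f); [exact: (subZ modA)|exact: (clinZ (ce i))].
  + move=> d f hf; have hA := P_A hf; rewrite (DE hA); apply: eig_P; first exact: Ddeg.
    by rewrite DS (P_eig hf) (clin_rat _ _ cD).
- exact: P_summable.
- move=> d; split.
  + by move=> x; exact: P_sum.
  + move=> x y; rewrite !in_setE => hx hy xy; apply/funext => i.
    by rewrite -(e_infsum i hx) xy (e_infsum i hy).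
  + move=> f hf; have hx : gprod P d (fun i => e i f) by move=> i; exists f.
    exists (fun i => e i f) => //; apply/funext => u.
    rewrite (@infsumE _ _ _ _ _ (iota 0 (l u).+1)) ?iota_uniq//; last first.
      by move=> i; exact: P_supp hx.
    by rewrite -(e_sum u hf) -(big_mkord xpredT (fun i => e i f u)) /index_iota subn0.
- move=> d x hx; rewrite (DE (P_sum hx)) (clin_infsum cD (P_summable hx)).
  by congr infsum; apply/funext => i; rewrite (DE (P_A (hx i))).
- move=> u; exists (l u).+1, [:: u] => d x hx h0.
  rewrite (@infsumE _ _ _ _ _ (iota 0 (l u).+1)) ?iota_uniq//; last first.
    by move=> i; exact: P_supp hx.
  rewrite big_seq big1// => i; rewrite mem_iota add0n => /andP[_ il].
  by rewrite h0// inE.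
- move=> i u; have [F hF] := clin_fin (ce i) u; exists F => d x hx h0.
  by rewrite -(e_infsum i hx) hF.
Qed.

End EigenSplitting.

(** * Degrees and eigenvectors on the module Pi *)

Section PiModule.
Variables (K : comAlgType rat) (gr : even_grading K) (B : choiceType) (deg : B -> int).
Local Notation series := (seq B -> K).
Local Notation That := (That gr deg).
Local Notation Pi := (Pi gr deg).
Local Notation shuf := (@shuf K B deg).
Local Notation idem := (@idem K B deg).
Local Notation idem_tilde := (@idem_tilde K B deg).
Local Notation tail_shuf := (tail_op shuf).
Implicit Types f : series.

Lemma Pi_submodule : is_submodule gr Pi.
Proof.
have sub := homog_submodule gr (wdeg deg); split.
- by move=> d; split=> //; exact: (sub0 sub).
- by move=> d f g [hf f0] [hg g0]; split; [exact: (subD sub)|rewrite addfE f0 g0 addr0].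
- by move=> i d k f hk [hf f0]; split; [exact: (subZ sub)|rewrite /kscale f0 mulr0].
Qed.

Lemma susp_submodule (I : eqType) (A : gmod K I) : is_submodule gr A -> is_submodule gr (susp A).
Proof.
move=> sub; split=> [d|d f g|i d k f hk hf]; first exact: (sub0 sub).
  exact: (subD sub).
by rewrite /susp -addrA; exact: (subZ sub).
Qed.

Lemma Pi_infsum d (x : nat -> series) : summable x -> (forall i, Pi d (x i)) -> Pi d (infsum x).
Proof.
move=> sx hx; split; first by apply: homog_infsum => // i; have [] := hx i.
rewrite (@infsumE _ _ _ _ _ [::]) ?big_nil// => i.
by have [_ ->] := hx i; rewrite eqxx.
Qed.

Lemma shuf_That d f : That d f -> That d (shuf f).
Proof.
move=> hf; apply: (homog_eq (addr0 d)); apply: (homog_clin (@clin_shuf K B deg) _ hf) => u v.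
rewrite addr0 -[delta K u]/(mono K u).
suff h : That (wdeg deg u) (shuf (mono K u)) by exact: h.
rewrite /Defs.shuf Delta_mono => {}v; apply: gr_sum => i _.
have : homog gr (fun z => wdeg deg z.1 + wdeg deg z.2) (wdeg deg u) (Delta_word K deg u).
  elim: u => [|c u IHu].
    move=> [a b]; rewrite /= /tens wdeg_nil /mono.
    case: (a =P [::]) => [->|_]; last by rewrite mul0r; exact: gr0.
    case: (b =P [::]) => [->|_]; last by rewrite mulr0; exact: gr0.
    by rewrite mul1r wdeg_nil; exact: gr1.
  have hc := That_mono gr deg [:: c]; rewrite wdeg_cons wdeg_nil addr0 in hc.
  rewrite Delta_word_cons wdeg_cons; apply: homogD; first exact: (homog2_lactO hc IHu).
  move=> [a b]; apply: gr_sign.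
  by apply: (gr_eq _ (That_mulS hc (homog2_slice2 a IHu) b)) => /=; lia.
move=> /(_ (take i v, drop i v)) /=; apply: gr_eq.
by have := wdeg_cat deg (take i v) (drop i v); rewrite cat_take_drop => ->; lia.
Qed.

(** The coefficients of the interpolation polynomial are rational, hence of degree 0 in K by
    [gr_rat]. *)
Lemma idem_That i d f : That d f -> That d (idem i f).
Proof.
move=> hf u; rewrite idemE /idem_part.
have [iu|ui] := leqP i (size u); last first.
  by rewrite /idem_comp leqNgt ui; exact: gr0.
rewrite idem_compE//; apply: gr_ratscale.
have : That d (part (size u) f).
  by move=> v; rewrite /part; case: ifP => _; [exact: hf|exact: gr0].
move: (part _ _) => g hg; suff: That d (idem_poly deg [seq r <- iota 0 (size u).+1 | r != i] g) by [].
elim: [seq _ <- _ | _] => [|r rs IHrs] //=.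
by apply: homogD; [exact: shuf_That|apply/homogN/homog_ratscale].
Qed.

Lemma idem_at_nil i f : f [::] = 0 -> idem i f [::] = 0.
Proof.
move=> f0; rewrite idemE /idem_part.
have p0 : part 0 f = 0 by apply/funext => -[|c u]; rewrite /part.
by rewrite [part _ f]p0 (clin0 (@clin_idem_comp K B deg 0 i)).
Qed.

Lemma idem_Pi i d f : Pi d f -> Pi d (idem i f).
Proof. by move=> [hf f0]; split; [exact: idem_That|exact: idem_at_nil]. Qed.

Lemma idem_tilde_Pi i d f : Pi d f -> Pi d (idem_tilde i f).
Proof.
move=> [hf f0]; split=> // -[|c v]; first exact: gr0.
have h : That (d - (1 - deg c)) (fun w => f (c :: w)).
  by move=> w; apply: (gr_eq _ (hf (c :: w))); rewrite wdeg_cons; lia.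
by apply: (gr_eq _ (idem_That i h v)); rewrite wdeg_cons; lia.
Qed.

Lemma tail_shuf_idem_tilde i f : tail_shuf (idem_tilde i f) = lam i *: idem_tilde i f.
Proof.
apply/funext => -[|c v]; first by rewrite ratscaleE /kscale /= mulr0.
exact: (congr1 (fun g => g v) (shuf_idem gr deg i (fun w => f (c :: w)))).
Qed.

Lemma idem_tilde_eig i j f : f [::] = 0 -> tail_shuf f = lam j *: f ->
  idem_tilde i f = if i == j then f else 0.
Proof.
move=> f0 hf; apply/funext => -[|c v]; first by case: eqP; rewrite //= f0.
have h : shuf (fun w => f (c :: w)) = lam j *: (fun w => f (c :: w)).
  by apply/funext => w; exact: (congr1 (fun g => g (c :: w)) hf).
by rewrite /= (idem_eig gr i h); case: eqP.
Qed.

End PiModule.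

Theorem theorem7p11 (K : comAlgType rat) (gr : even_grading K)
    (B : choiceType) (deg : B -> int)
    (m M : (seq B -> K) -> (seq B -> K)) :
  is_Cinfty gr deg m -> is_extension gr deg m M ->
  splits_as_product gr (susp (Pi gr deg)) M
    (fun i => susp (image_Pi gr deg (idem deg i.+1)))
  /\
  (hoch_identification gr deg M /\
   splits_as_product gr (susp (Pi gr deg)) (hoch_diff gr deg M)
     (fun i => susp (image_Pi gr deg (idem_tilde deg i)))).
Proof.
move=> Cm mM; have dD := vext_deriv mM; have cD := clin_vext mM.
have ME := vextE mM; have DT := vext_That mM; have DL := vext_letter Cm mM.
have Dsq := vext_sq Cm mM; have Dshuf := shuf_vext Cm mM.
have sub := susp_submodule (Pi_submodule gr deg).
have sumP d := @Pi_infsum K gr B deg (d + 1).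
have cs := @clin_shuf K B deg.
split; [|split].
(* The i-th piece belongs to e(i+1), since the product in (i) starts at e(1). *)
- apply: (@eigen_splitting K gr _ _ M (vext M) (shuf deg) (fun i => idem deg i.+1)
    (fun i => lam i.+1) size) => //.
  + by move=> d f [hf _]; exact: ME hf.
  + by move=> d f [hf f0]; split; [exact: DT|exact: (vext_at_nil Cm mM)].
  + by move=> i; exact: clin_idem.
  + by move=> i d f; exact: idem_Pi.
  + by move=> i f; exact: (shuf_idem gr).
  + by move=> i j d f _ hf; rewrite (idem_eig gr _ hf) eqSS.
  + by move=> i f u ui; apply: idem_big; rewrite ltnW.
  (* In word length n > 0 both e(0) and e(n+1) contribute nothing, so the shifted sum over 1..n+1
     equals the sum over 0..n. At the empty word all terms vanish. *)
  + move=> d f u [_ f0]; rewrite -[RHS](idem_sum gr deg).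
    case: u => [|c u]; first by rewrite !big_ord_recl !big_ord0 !addr0 !idem_at_nil.
    rewrite [RHS]big_ord_recl (idem0 gr)// add0r [LHS]big_ord_recr /=.
    by rewrite idem_big// addr0.
- exact: (hochschild_identification dD DT ME).
(* As 1 (x) s leaves the first letter alone, the indices at u are bounded by the length of its tail.
   Index 0 now occurs, on words of one letter. *)
apply: (@eigen_splitting K gr _ _ (hoch_diff gr deg M) (cyc_diff deg (vext M)) (tail_op (shuf deg))
    (idem_tilde deg) lam (fun u => (size u).-1)) => //.
- exact: clin_cyc_diff dD.
- by move=> d f; exact: (hoch_diffE dD DT ME).
- by move=> d f [hf _]; exact: (cyc_diff_Pi DT).
- by move=> d f _; exact: (cyc_diff_sq dD Dsq).
- exact: (tail_shuf_cyc_diff dD DL Dshuf).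
- by move=> i; apply: clin_tail_op; exact: clin_idem.
- by move=> i d f; exact: idem_tilde_Pi.
- exact: (tail_shuf_idem_tilde gr).
- by move=> i j d f [_ f0]; exact: (idem_tilde_eig gr).
- by move=> i f [|c u] //= ui; exact: idem_big.
- move=> d f [|c u] [_ f0]; first by rewrite f0 big1.
  exact: (idem_sum gr deg (fun w => f (c :: w)) u).
Qed.
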